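(* Let $M$ be a $2$-dimensional manifold and let $\sigma$ be a foliation by curves on $M$ (a $1$-dimensional distribution). Then the harmonicity of $\sigma$ depends only on the conformal structure on $M$: for every Riemannian metric $g$ on $M$ and every smooth function $\mu$ on $M$, $\sigma$ is harmonic with respect to $g$ if and only if $\sigma$ is harmonic with respect to $\tilde g=e^{2\mu}g$.
   Context: Let $h$ be a Riemannian metric on $M$ with Levi--Civita connection $D$, and let $\sigma$ be a distribution on $M$ (a smooth subbundle of $TM$) with $h$-orthogonal complement $\sigma^{\bot}$; $\top,\bot$ denote the orthogonal projections onto $\sigma,\sigma^{\bot}$. The distribution $\sigma$ is harmonic with respect to $h$ if, as a section of the Grassmann bundle of $\dim\sigma$-dimensional tangent subspaces, it is a critical point of the vertical energy functional (half the integral of the squared norm of the vertical part of its differential, over $M$ or over compact subsets). This is equivalent to the vanishing of the vertical tension field, i.e. to $$\tau^V(\sigma)(X,Y)=h\Big(\sum_{\alpha}\big((D^2X)(E_{\alpha},E_{\alpha})-2D_{E_{\alpha}}(D_{E_{\alpha}}X)^{\top}\big),Y\Big)=0\quad\text{for all }X\in\sigma,\ Y\in\sigma^{\bot},$$ where $(D^2X)(E,E)=D_ED_EX-D_{D_EE}X$, $(E_\alpha)$ is a local $h$-orthonormal frame on $M$, and $X$ is extended to a local section of $\sigma$ (the result does not depend on the extension or the frame). *)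

(* Defs.v *)
From HB Require Import structures.
From mathcomp Require Import all_boot all_order all_algebra.
From mathcomp Require Import all_classical all_reals all_analysis.
Set Implicit Arguments.
Unset Strict Implicit.
Unset Printing Implicit Defensive.
Import Order.TTheory GRing.Theory Num.Theory.
Import numFieldNormedType.Exports.
Local Open Scope classical_set_scope.
Local Open Scope ring_scope.

(* C^k maps on an open subset [U] of a finite-dimensional normed space; the
   values of [f] outside [U] are irrelevant. *)
Fixpoint Ck (R : realType) (V W : normedModType R) (k : nat)
    (U : set V) (f : V -> W) : Prop :=
  match k with
  | 0%N => forall x, U x -> {for x, continuous f}
  | k'.+1 => (forall x, U x -> differentiable f x) /\
             (forall v, Ck k' U (fun x => 'D_v f x))
  end.

Definition smooth_on (R : realType) (V W : normedModType R)
    (U : set V) (f : V -> W) : Prop := forall k, Ck k U f.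

(* Charts are total functions with a total candidate inverse; only their
   restrictions to [cdom] and [cmap @` cdom] are meaningful. *)
Record chart (R : realType) (M : topologicalType) := Chart {
  cmap :> M -> 'rV[R]_2 ;
  cinv : 'rV[R]_2 -> M ;
  cdom : set M ;
  cdom_open : open cdom ;
  cimg_open : open (cmap @` cdom) ;
  cmapK : forall x, cdom x -> cinv (cmap x) = x ;
  cmap_continuous : forall x, cdom x -> {for x, continuous cmap} ;
  cinv_continuous :
    forall p, (cmap @` cdom) p -> {for p, continuous cinv} }.

Definition cimg (R : realType) (M : topologicalType) (c : chart R M) :
  set 'rV[R]_2 := c @` cdom c.

Definition transition (R : realType) (M : topologicalType) (c c' : chart R M) :
  'rV[R]_2 -> 'rV[R]_2 := fun p => c' (cinv c p).

(* The atlas need not be maximal.  The base point of a [ptopologicalType] is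
   only there because the library integrates over pointed types: it amounts to
   non-emptiness. *)
Record surface (R : realType) := Surface {
  points :> ptopologicalType ;
  points_hausdorff : hausdorff_space points ;
  points_second_countable : @second_countable points ;
  atlas : set (chart R points) ;
  atlas_cover : forall x : points, exists2 c, atlas c & cdom c x ;
  atlas_smooth : forall c c', atlas c -> atlas c' ->
    smooth_on (c @` (cdom c `&` cdom c')) (transition c c') }.

Definition smooth_function (R : realType) (M : surface R) (f : M -> R) : Prop :=
  forall c, atlas c -> smooth_on (cimg c) (fun p => f (cinv c p)).

(* A tangent vector at [x] is given by its coordinates in each chart around
   [x]; coordinates in [c] and [c'] are related by this map. *)
Definition dtransition (R : realType) (M : surface R) (c c' : chart R M) (x : M)
  (u : 'rV[R]_2) : 'rV[R]_2 := 'D_u (transition c c') (c x).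

Definition ip (R : realType) (G : 'M[R]_2) (u v : 'rV[R]_2) : R :=
  (u *m G *m v^T) 0 0.

(* [g c x] is the Gram matrix at [x] of the coordinate frame of [c]. *)
Definition metric_field (R : realType) (M : surface R) :=
  chart R M -> M -> 'M[R]_2.

Definition riemannian (R : realType) (M : surface R) (g : metric_field M) :
    Prop :=
  [/\ forall c x, atlas c -> cdom c x -> (g c x)^T = g c x,
      forall c x u, atlas c -> cdom c x -> u != 0 -> 0 < ip (g c x) u u,
      forall c i j, atlas c -> smooth_on (cimg c) (fun p => g c (cinv c p) i j)
    & forall c c' x u v, atlas c -> atlas c' -> cdom c x -> cdom c' x ->
        ip (g c x) u v =
        ip (g c' x) (dtransition c c' x u) (dtransition c c' x v)].

Definition conformal (R : realType) (M : surface R) (mu : M -> R)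
  (g : metric_field M) : metric_field M :=
  fun c x => expR (2 * mu x) *: g c x.

(* [s c x] is the set of coordinates in [c] of the vectors of the subspace of
   the tangent space at [x]. *)
Definition subspace_field (R : realType) (M : surface R) :=
  chart R M -> M -> set 'rV[R]_2.

Definition line (R : realType) (v : 'rV[R]_2) : set 'rV[R]_2 :=
  [set a *: v | a in [set: R]].

Definition coherent (R : realType) (M : surface R) (s : subspace_field M) : Prop :=
  forall c c' x, atlas c -> atlas c' -> cdom c x -> cdom c' x ->
    s c' x = dtransition c c' x @` s c x.

(* Smooth distributions of rank 1; in rank 1 these are the foliations by
   curves. *)
Definition line_field (R : realType) (M : surface R) (s : subspace_field M) :
    Prop :=
  coherent s /\
  forall c x, atlas c -> cdom c x ->
    exists (U : set 'rV[R]_2) (X : 'rV[R]_2 -> 'rV[R]_2),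
      [/\ open U, U (c x), U `<=` cimg c, smooth_on U X &
          forall p, U p -> X p != 0 /\ s c (cinv c p) = line (X p)].

Definition partial (R : realType) (i : 'I_2) (f : 'rV[R]_2 -> R)
  (p : 'rV[R]_2) : R := 'D_(delta_mx 0 i) f p.

Definition christoffel (R : realType) (G : 'rV[R]_2 -> 'M[R]_2)
    (p : 'rV[R]_2) (k i j : 'I_2) : R :=
  2^-1 * \sum_(l < 2) invmx (G p) k l *
    (partial i (fun q => G q j l) p + partial j (fun q => G q i l) p
     - partial l (fun q => G q i j) p).

(* Levi-Civita derivative at [p] of the field [X] in the direction [u]. *)
Definition covD (R : realType) (G : 'rV[R]_2 -> 'M[R]_2)
    (X : 'rV[R]_2 -> 'rV[R]_2) (p u : 'rV[R]_2) : 'rV[R]_2 :=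
  'D_u X p +
  \row_(k < 2) \sum_(i < 2) \sum_(j < 2)
     christoffel G p k i j * u 0 i * X p 0 j.

Definition local_section (R : realType) (M : surface R) (s : subspace_field M)
    (c : chart R M) (x : M) (X : 'rV[R]_2 -> 'rV[R]_2) : Prop :=
  exists U : set 'rV[R]_2,
    [/\ open U, U (c x), U `<=` cimg c, smooth_on U X &
        forall p, U p -> s c (cinv c p) (X p)].

(* Component of [v] orthogonal to the unit vector [e]. *)
Definition perp (R : realType) (G : 'M[R]_2) (e v : 'rV[R]_2) : 'rV[R]_2 :=
  v - ip G v e *: e.

Definition orthonormal_frame (R : realType) (G : 'M[R]_2)
  (E : 'I_2 -> 'rV[R]_2) : Prop :=
  forall a b, ip G (E a) (E b) = (a == b)%:R.

(* The vertical tangent space of the Grassmann bundle at a line l of T_xM is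
   Hom(l, l^bot), and the vertical part of the differential of the section s at
   x sends v to the homomorphism X |-> (D_v X)^bot, which is tensorial in X.
   Its squared norm is the sum over an orthonormal basis (E_a) of T_xM and an
   orthonormal basis (X) of l; it depends neither on the bases, nor on the
   extension of X to a local section, nor on the chart. *)
Definition vertical_norm2 (R : realType) (M : surface R) (g : metric_field M)
    (s : subspace_field M) (x : M) : R :=
  xget 0 [set r | exists (c : chart R M) (X : 'rV[R]_2 -> 'rV[R]_2)
                         (E : 'I_2 -> 'rV[R]_2),
    let G := g c x in
    let A a := perp G (X (c x))
                 (covD (fun p => g c (cinv c p)) X (c x) (E a)) in
    [/\ atlas c /\ cdom c x, local_section s c x X,
        ip G (X (c x)) (X (c x)) = 1, orthonormal_frame G E &
        r = \sum_(a < 2) ip G (A a) (A a)]].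

Notation borel M := (g_sigma_algebraType (@open M)).

Definition pt2 (R : realType) (z : R * R) : 'rV[R]_2 :=
  \row_(i < 2) (if i == 0 then z.1 else z.2).

(* This determines the measure uniquely, as the surface is covered by countably
   many charts. *)
Definition riemannian_volume (R : realType) (M : surface R)
    (g : metric_field M) (vol : {measure set (borel M) -> \bar R}) : Prop :=
  forall c (A : set (borel M)), atlas c -> measurable A -> A `<=` cdom c ->
    vol A = (\int[(@lebesgue_measure R) \x (@lebesgue_measure R)]_(z in
               @pt2 R @^-1` (c @` A))
               (Num.sqrt (\det (g c (cinv c (pt2 z)))))%:E)%E.

Definition vertical_energy (R : realType) (M : surface R) (g : metric_field M)
    (vol : {measure set (borel M) -> \bar R}) (K : set M) (s : subspace_field M) :
    R :=
  2^-1 * \int[vol]_(x in (K : set (borel M))) vertical_norm2 g s x.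

(* Smooth variations of [s] with parameter in ]-eps, eps[, fixed outside [K]. *)
Definition compact_variation (R : realType) (M : surface R) (K : set M)
    (s : subspace_field M) (eps : R) (st : R -> subspace_field M) : Prop :=
  [/\ forall t, `|t| < eps -> coherent (st t),
      forall c t x, atlas c -> `|t| < eps -> cdom c x ->
        exists (U : set (R * 'rV[R]_2)%type)
               (X : (R * 'rV[R]_2)%type -> 'rV[R]_2),
          [/\ open U, U (t, c x), (forall z, U z -> cimg c z.2),
              smooth_on U X &
              forall z, U z -> X z != 0 /\
                st z.1 c (cinv c z.2) = line (X z)],
      forall c x, atlas c -> cdom c x -> st 0 c x = s c x
    & forall c t x, atlas c -> `|t| < eps -> cdom c x -> ~ K x ->
        st t c x = s c x].

(* Critical points of the vertical energy over compact subsets. *)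
Definition harmonic_distribution (R : realType) (M : surface R)
    (g : metric_field M) (s : subspace_field M) : Prop :=
  forall (vol : {measure set (borel M) -> \bar R}), riemannian_volume g vol ->
  forall K : set M, compact K ->
  forall (eps : R) (st : R -> subspace_field M), 0 < eps ->
    compact_variation K s eps st ->
    is_derive (0 : R) (1 : R) (fun t : R => vertical_energy g vol K (st t))
      (0 : R).

(* Main.v *)
(* For a line field s on a surface, let b_s be the connection form of an
   orthonormal frame adapted to s, so that D_v X = b_s(v) N for a local unit
   section X of s and its normal N.  The vertical part of the differential of s
   has squared norm |b_s|^2, and in dimension 2 the density |b|^2 dvol of a 1-form
   is conformally invariant.  Replacing g by e^(2 mu) g adds the form *dmu
   to b_s, so the difference of the two energies is, up to a constant, the
   integral of the product <b_s, *dmu>.  Along a variation s_t supported in a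
   compact set K one has b_(s_t) = b_s + d theta, where theta is the angle from s
   to s_t, which vanishes off K; hence this integral changes by the integral of
   d theta /\ dmu = d(theta dmu) (up to sign), which is 0 by Stokes' theorem.  So the two
   energies differ by a constant along the variation, and they have the same
   critical points.  The sign ambiguities of theta and of the star operator under
   a change of orientation compensate, so M need not be orientable. *)
Require Import Defs.
From HB Require Import structures.
From mathcomp Require Import all_boot all_order all_algebra.
From mathcomp Require Import all_classical all_reals all_analysis.
From mathcomp Require Import ring lra measurable_realfun.
From mathcomp Require finmap.
Set Implicit Arguments.
Unset Strict Implicit.
Unset Printing Implicit Defensive.
Import Order.TTheory GRing.Theory Num.Theory.
Import numFieldNormedType.Exports.
Local Open Scope classical_set_scope.
Local Open Scope ring_scope.

(** * Differential calculus *)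

(** The angle between two lines is defined modulo pi, and [atan] of its tangent is a regular branch
    only where the lines are not orthogonal. A derivative at [t = 0] sees only small [t], and
    compactness of [K] keeps [st t] away from the orthogonal of [s] at all points for such [t]; this
    gives a canonical angle without any lifting in [t]. For each small [t] the two energies differ
    by exactly the same constant, so nothing is differentiated under the integral sign. Stokes'
    theorem is localised by a partition of unity over [K] alone: finitely many bumps divided by
    their sum, which is positive on [K]. The terms with derivatives of the bumps add up to zero,
    because the quotients sum to 1 near every point of [K]; to add these terms, they are all carried
    to one chart. Harmonicity quantifies over the volume measures of a metric, so a volume for the
    conformal metric has to be produced from one for [g]. One implication then suffices: the other
    is the same statement for the opposite function. *)

Section calculus.
Context {R : realType}.
Implicit Types (U V W : normedModType R).

(** The difference [g - f] vanishes near [x], so its differential there is zero; only this function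
    has to meet the definition of differentiability by hand. *)
Lemma near_eq_differentiable V W (f g : V -> W) x :
  (\forall y \near x, f y = g y) -> differentiable f x -> differentiable g x.
Proof.
move=> fg df.
pose h := g - f.
have h0 : \forall y \near x, h y = 0.
  by near=> y; rewrite /h !fctE (near fg) ?subrr//; near: y; exact: fg.
have -> : g = f + h by apply/funext => y; rewrite /h !fctE addrC subrK.
apply: differentiableD; first exact: df.
have e0 : h \o shift x = cst (h x) + \0 +o_ 0 id.
  apply/eqaddoE; rewrite addr0 (nbhs_singleton h0) -[LHS]add0r.
  congr (_ + _); rewrite littleoE//.
  move=> e e0 /=.
  have : (fun y : V => y + x) y @[y --> (0 : V)] --> x.
    by rewrite -[X in _ --> X]add0r; apply: cvgD; [exact: cvg_id|exact: cvg_cst].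
  move=> /(_ _ h0); rewrite nbhs_simpl /=.
  by apply: (@filterS _ (nbhs (0 : V))) => y /= ->; rewrite normr0 mulr_ge0// ltW.
have dh : 'd h x = \0 :> (V -> W).
  by apply: diff_unique => // ; exact: cst_continuous.
apply/diff_locallyP; rewrite dh; split => //; exact: cst_continuous.
Unshelve. all: by end_near. Qed.

Lemma derivable_diff V W (f : V -> W) x v : differentiable f x ->
  is_derive x v f ('D_v f x).
Proof. by move=> df; apply: derivableP; exact: diff_derivable. Qed.

Lemma derD V W (f g : V -> W) x v df dg : is_derive x v f df ->
  is_derive x v g dg -> is_derive x v (fun q => f q + g q) (df + dg).
Proof. exact: is_deriveD. Qed.

Lemma derB V W (f g : V -> W) x v df dg : is_derive x v f df ->
  is_derive x v g dg -> is_derive x v (fun q => f q - g q) (df - dg).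
Proof. exact: is_deriveB. Qed.

Lemma derM V (f g : V -> R) x v df dg : is_derive x v f df ->
  is_derive x v g dg ->
  is_derive x v (fun q => f q * g q) (df * g x + f x * dg).
Proof.
move=> hf hg; apply: (is_derive_eq (is_deriveM hf hg)).
by rewrite /GRing.scale /= addrC (mulrC (g x)).
Qed.

Lemma derC V W (a : W) (x v : V) : is_derive x v (fun=> a) 0.
Proof. exact: is_derive_cst. Qed.

Lemma derive_val V W (f : V -> W) x v df : is_derive x v f df -> 'D_v f x = df.
Proof. by case. Qed.

Lemma der_comp U V W (f : V -> W) (c : U -> V) x w :
  differentiable c x -> differentiable f (c x) ->
  is_derive x w (fun y => f (c y)) ('D_('D_w c x) f (c x)).
Proof.
move=> dc df; have dfc := differentiable_comp dc df.
apply: DeriveDef; first exact: diff_derivable.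
rewrite deriveE// (deriveE _ dc) (deriveE _ df).
by have /= -> := diff_comp dc df.
Qed.

Lemma der_comp1 V (f : R -> R) (c : V -> R) x w df dc :
  differentiable c x -> is_derive (c x) 1 f df -> is_derive x w c dc ->
  is_derive x w (fun y => f (c y)) (df * dc).
Proof.
move=> dfc hf hc.
have df' : differentiable f (c x) by apply/derivable1_diffP; case: hf.
apply: (is_derive_eq (der_comp w dfc df')).
rewrite (derive_val hc) deriveE// -[dc]mulr1 -[_ * 1]/(dc *: 1) linearZ/=.
by rewrite -deriveE// (derive_val hf) /GRing.scale /= mulrC mulr1.
Qed.

Lemma MVT_line V (f : V -> R) (p u : V) (h : R) : 0 < h ->
  (forall a, 0 <= a <= h -> differentiable f (p + a *: u)) ->
  exists2 a, 0 < a < h & f (p + h *: u) - f p = h * 'D_u f (p + a *: u).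
Proof.
move=> h0 df.
have dl (a : R) : is_derive a (1 : R) (fun a : R => p + a *: u) u.
  apply: (is_derive_eq (derD (derC _ _ _) _)); last by rewrite add0r.
  apply: DeriveDef; first exact: diff_derivable.
  by rewrite deriveE// diff_val scale1r.
have dif (a : R) : differentiable (fun a : R => p + a *: u) a.
  by apply: differentiableD => //.
have dfl (a : R) : 0 <= a <= h ->
    is_derive a (1 : R) (fun a : R => f (p + a *: u)) ('D_u f (p + a *: u)).
  move=> ah; apply: (is_derive_eq (der_comp _ (dif a) (df a ah))).
  by rewrite (derive_val (dl a)).
have [a|| a ain E] := @MVT R (fun a => f (p + a *: u))
   (fun a => 'D_u f (p + a *: u)) 0 h h0.
- by rewrite in_itv/= => /andP[a0 ah]; apply: dfl; rewrite !ltW.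
- apply: derivable_within_continuous => a; rewrite in_itv/= => ah.
  by case: (dfl a ah).
- exists a; first by move: ain; rewrite in_itv.
  by move: E; rewrite scale0r addr0 subr0 mulrC.
Qed.

(** The second difference of [f] over the parallelogram is a first difference of
    [F q = f (q + h *: v) - f q]. The mean value theorem applies to [F] along [u], then to ['D_u f]
    along [v]. The left side is symmetric in [u] and [v], while the right side fixes an order of
    differentiation. *)
Lemma second_difference V (f : V -> R) (p u v : V) (h : R) : 0 < h ->
  (forall a b, 0 <= a <= h -> 0 <= b <= h ->
    differentiable f (p + a *: u + b *: v) /\
    differentiable ('D_u f) (p + a *: u + b *: v)) ->
  exists a b, [/\ 0 < a < h, 0 < b < h &
    f (p + h *: u + h *: v) - f (p + h *: u) - f (p + h *: v) + f p =
    h ^+ 2 * 'D_v ('D_u f) (p + a *: u + b *: v)].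
Proof.
move=> h0 df.
have hh : 0 <= h <= h by rewrite lexx ltW.
have h00 : 0 <= (0 : R) <= h by rewrite lexx ltW.
pose F q := f (q + h *: v) - f q.
have sh q : differentiable (fun q : V => q + h *: v) q by apply: differentiableD.
have dF a : 0 <= a <= h -> differentiable F (p + a *: u).
  move=> ah; apply: differentiableB.
    apply: (@differentiable_comp _ _ _ _ (fun q => q + h *: v)) => //.
    exact: (df a h ah hh).1.
  by have := (df a 0 ah h00).1; rewrite scale0r addr0.
have [a ah Ea] := MVT_line h0 dF.
have ah' : 0 <= a <= h by case/andP: ah => a0 ah; rewrite !ltW.
have [b bh Eb] := @MVT_line V ('D_u f) (p + a *: u) v h h0
   (fun b bh => (df a b ah' bh).2).
exists a, b; split => //.
rewrite expr2 -mulrA -Eb.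
have -> : 'D_u f (p + a *: u + h *: v) - 'D_u f (p + a *: u) = 'D_u F (p + a *: u).
  apply/esym/derive_val/derB; last first.
    by apply: derivable_diff; have := (df a 0 ah' h00).1; rewrite scale0r addr0.
  apply: (is_derive_eq (der_comp u (sh _) (df a h ah' hh).1)).
  congr (derive f _ _).
  by apply: derive_val; apply: (is_derive_eq (derD _ (derC _ _ _)));
     rewrite ?addr0.
rewrite -Ea /F; ring.
Qed.

Lemma dist_half (e A B X : R) : `|A - X| < e / 2 -> `|B - X| < e / 2 ->
  `|A - B| <= e.
Proof.
rewrite !ltr_norml ler_norml => /andP[? ?] /andP[? ?].
by apply/andP; split; lra.
Qed.

(** Schwarz's theorem. Evaluating the symmetric second difference in both orders shows that the two
    mixed derivatives share a value, taken at two points close to [p]; by continuity this value is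
    within [e / 2] of both derivatives at [p]. *)
Lemma derive_swap V (f : V -> R) (p u v : V) :
  (\forall q \near p, [/\ differentiable f q, differentiable ('D_u f) q
     & differentiable ('D_v f) q]) ->
  {for p, continuous ('D_v ('D_u f))} -> {for p, continuous ('D_u ('D_v f))} ->
  'D_v ('D_u f) p = 'D_u ('D_v f) p.
Proof.
move=> df c1 c2; apply/eqP; rewrite -subr_eq0 -normr_le0; apply/ler_addgt0Pr => e e0.
rewrite add0r.
have e2 : 0 < e / 2 by rewrite divr_gt0.
have n1 : \forall q \near p, `|'D_v ('D_u f) p - 'D_v ('D_u f) q| < e / 2.
  by move/cvgrPdist_lt: c1 => /(_ _ e2) H; exact: H.
have n2 : \forall q \near p, `|'D_u ('D_v f) p - 'D_u ('D_v f) q| < e / 2.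
  by move/cvgrPdist_lt: c2 => /(_ _ e2) H; exact: H.
have [d /= d0 D] : exists2 d, 0 < d & forall q, `|p - q| < d ->
   [/\ [/\ differentiable f q, differentiable ('D_u f) q
     & differentiable ('D_v f) q], `|'D_v ('D_u f) p - 'D_v ('D_u f) q| < e / 2 &
     `|'D_u ('D_v f) p - 'D_u ('D_v f) q| < e / 2].
  have : \forall q \near p, [/\ [/\ differentiable f q, differentiable ('D_u f) q
     & differentiable ('D_v f) q], `|'D_v ('D_u f) p - 'D_v ('D_u f) q| < e / 2 &
     `|'D_u ('D_v f) p - 'D_u ('D_v f) q| < e / 2].
    by apply: filterS (filterI df (filterI n1 n2)) => q [Q1 [Q2 Q3]]; exact: And3 Q1 Q2 Q3.
  move=> /nbhs_ballP[d /= d0 D]; exists d => // q pq; apply: D.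
  by rewrite -ball_normE.
(* The parallelogram of step [h] stays in the ball of radius [d], since [h] times the bracket is
   [d / 2]; the 1 guards against [u = v = 0]. *)
pose h := d / (2 * (`|u| + `|v| + 1)).
have n0 : 0 < `|u| + `|v| + 1 by rewrite ltr_wpDl// addr_ge0.
have h0 : 0 < h by rewrite divr_gt0// mulr_gt0.
have small a b : 0 <= a <= h -> 0 <= b <= h -> `|p - (p + a *: u + b *: v)| < d.
  move=> /andP[a0 ah] /andP[b0 bh].
  rewrite opprD addrA opprD addrA subrr add0r -opprD normrN.
  apply: (le_lt_trans (ler_normD _ _)); rewrite !normrZ !ger0_norm//.
  have : a * `|u| + b * `|v| <= h * (`|u| + `|v|).
    by rewrite mulrDr lerD// ler_wpM2r.
  move=> /le_lt_trans; apply.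
  have : h * (`|u| + `|v| + 1) = d / 2 by rewrite /h; field; rewrite gt_eqF.
  rewrite mulrDr mulr1; lra.
have [a [b [ah bh E1]]] := @second_difference V f p u v h h0
  (fun a b ha hb => let: And3 (And3 x y _) _ _ := D _ (small a b ha hb) in conj x y).
have [b' [a' [bh' ah' E2]]] : exists a b, [/\ 0 < a < h, 0 < b < h &
    f (p + h *: v + h *: u) - f (p + h *: v) - f (p + h *: u) + f p =
    h ^+ 2 * 'D_u ('D_v f) (p + a *: v + b *: u)].
  apply: second_difference => // s t hs ht; rewrite addrAC.
  by case: (D _ (small t s ht hs)) => -[].
have w s : 0 < s < h -> 0 <= s <= h by case/andP => *; rewrite !ltW.
have [_ B1 _] := D _ (small _ _ (w _ ah) (w _ bh)).
have [_ _ B2] := D _ (small _ _ (w _ ah') (w _ bh')).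
move: E2; rewrite [p + b' *: v + _]addrAC [p + h *: v + _]addrAC.
rewrite [X in X + f p]addrAC E1 => E.
have h2 : h ^+ 2 != 0 by apply: expf_neq0; rewrite gt_eqF.
apply: dist_half B1 _.
have := mulfI h2 E => ->.
exact: B2.
Qed.

End calculus.

(** Continuity is asked of each directional derivative, which avoids a topology on linear maps, and
    on a whole neighbourhood, so that the property persists at nearby points. *)
Definition C1near (R : realType) (V W : normedModType R) (f : V -> W) (p : V) :=
  \forall q \near p,
    differentiable f q /\ forall v, {for q, continuous ('D_v f)}.

(** * Closure properties of functions of class C^1 near a point *)

Section C1near_theory.
Context {R : realType}.
Implicit Types (V W : normedModType R).

Lemma near_near (V : topologicalType) (P : V -> Prop) (p : V) :
  (\forall q \near p, P q) -> \forall q \near p, \forall r \near q, P r.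
Proof. by move=> /nbhs_interior. Qed.

Lemma C1near_diff V W (f : V -> W) p : C1near f p -> differentiable f p.
Proof. by move=> /nbhs_singleton[]. Qed.

Lemma C1near_cont V W (f : V -> W) p : C1near f p -> {for p, continuous f}.
Proof. by move=> /C1near_diff/differentiable_continuous. Qed.

Lemma C1near_dcont V W (f : V -> W) p v : C1near f p -> {for p, continuous ('D_v f)}.
Proof. by move=> /nbhs_singleton[]. Qed.

Lemma near_eq_continuous (V W : topologicalType) (f g : V -> W) (p : V) :
  (\forall q \near p, f q = g q) -> {for p, continuous f} -> {for p, continuous g}.
Proof.
move=> fg; rewrite /prop_for /continuous_at -(nbhs_singleton fg).
by apply: cvg_trans; apply: near_eq_cvg.
Qed.

Lemma near_eq_derive_near V W (f g : V -> W) (p v : V) :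
  (\forall q \near p, f q = g q) -> \forall q \near p, 'D_v f q = 'D_v g q.
Proof. by move=> /near_near; apply: filterS => q; exact: near_eq_derive. Qed.

Lemma C1near_eq V W (f g : V -> W) p :
  (\forall q \near p, f q = g q) -> C1near f p -> C1near g p.
Proof.
move=> /near_near fg; apply: filterS2 fg => q fg [df cf]; split.
  exact: near_eq_differentiable fg df.
by move=> v; apply: near_eq_continuous (cf v); exact: near_eq_derive_near.
Qed.

(** Most rules below exhibit a formula [df] for the derivatives; agreement near [p] transfers its
    continuity to ['D_v f]. *)
Lemma C1nearI V W (f : V -> W) (df : V -> V -> W) p :
  (\forall q \near p, [/\ differentiable f q,
     (forall v, 'D_v f q = df v q) & forall v, {for q, continuous (df v)}]) ->
  C1near f p.
Proof.
move=> /near_near; apply: filterS => q H.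
have [d _ c] := nbhs_singleton H; split => // v.
apply: near_eq_continuous (c v).
by apply: filterS H => r [_ -> _].
Qed.

Lemma C1near_cst V W (a : W) (p : V) : C1near (fun=> a) p.
Proof.
apply: (@C1nearI _ _ _ (fun _ _ => 0)); near=> q; split.
- exact: differentiable_cst.
- by move=> v; exact: derive_cst.
- by move=> v; exact: cvg_cst.
Unshelve. all: by end_near. Qed.

Lemma C1nearD V W (f g : V -> W) p : C1near f p -> C1near g p ->
  C1near (fun q => f q + g q) p.
Proof.
move=> cf cg; apply: (@C1nearI _ _ _ (fun v q => 'D_v f q + 'D_v g q)).
apply: filterS2 cf cg => q [df cf] [dg cg]; split.
- exact: differentiableD.
- by move=> v; apply/derive_val/derD; exact: derivable_diff.
- by move=> v; apply: cvgD; [exact: cf|exact: cg].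
Qed.

Lemma C1nearM V (f g : V -> R) p : C1near f p -> C1near g p ->
  C1near (fun q => f q * g q) p.
Proof.
move=> cf cg; apply: (@C1nearI _ _ _ (fun v q => 'D_v f q * g q + f q * 'D_v g q)).
apply: filterS2 cf cg => q [df cf] [dg cg]; split.
- exact: differentiableM.
- by move=> v; apply/derive_val/derM; exact: derivable_diff.
- move=> v; apply: cvgD.
  + exact: cvgM (cf v) (differentiable_continuous dg).
  + exact: cvgM (differentiable_continuous df) (cg v).
Qed.

Lemma C1near_sum V n (f : 'I_n -> V -> R) p : (forall i, C1near (f i) p) ->
  C1near (fun q => \sum_(i < n) f i q) p.
Proof.
elim: n f => [|n IH] f cf.
  by apply: C1near_eq (C1near_cst _ _); near=> q; rewrite big_ord0.
apply: (@C1near_eq _ _ (fun q => \sum_(i < n) f (widen_ord (leqnSn n) i) q + f ord_max q)).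
  by near=> q; rewrite big_ord_recr.
exact: C1nearD (IH _ (fun i => cf _)) (cf _).
Unshelve. all: by end_near. Qed.

Lemma C1near_comp1 V (h dh : R -> R) (f : V -> R) p : C1near f p ->
  (\forall y \near f p, is_derive y (1 : R) h (dh y) /\ {for y, continuous dh}) ->
  C1near (fun q => h (f q)) p.
Proof.
move=> cf H; apply: (@C1nearI _ _ _ (fun v q => dh (f q) * 'D_v f q)).
have H' := C1near_cont cf H.
near=> q.
have [df cf'] : differentiable f q /\ forall v, {for q, continuous ('D_v f)}.
  by near: q.
have [dq cq] : is_derive (f q) (1 : R) h (dh (f q)) /\ {for f q, continuous dh}.
  by near: q.
split.
- apply: (@differentiable_comp _ _ _ _ f h) => //.
  by apply/derivable1_diffP; case: dq.
- by move=> v; apply/derive_val/der_comp1 => //; exact: derivable_diff.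
- move=> v; apply: cvgM; last exact: cf'.
  by apply: (@continuous_comp _ _ _ f dh) => //; exact: differentiable_continuous.
Unshelve. all: by end_near. Qed.

Lemma I2P (i : 'I_2) : i = 0 \/ i = 1.
Proof. by case: i => -[|[|//]] i; [left|right]; exact/val_inj. Qed.

Lemma rV2E (u : 'rV[R]_2) : u = u 0 0 *: delta_mx 0 0 + u 0 1 *: delta_mx 0 1.
Proof.
by apply/rowP => i; rewrite !mxE; case: (I2P i) => -> /=;
  rewrite ?mulr1 ?mulr0 ?addr0 ?add0r.
Qed.

Lemma derive_linear V W (f : V -> W) p a b u v : differentiable f p ->
  'D_(a *: u + b *: v) f p = a *: 'D_u f p + b *: 'D_v f p.
Proof. by move=> df; rewrite !deriveE// linearD !linearZ. Qed.

Lemma derive_dirD V W (f : V -> W) p u v : differentiable f p ->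
  'D_(u + v) f p = 'D_u f p + 'D_v f p.
Proof. by move=> df; rewrite !deriveE// linearD. Qed.

Lemma derive_rV2 W (f : 'rV[R]_2 -> W) p u : differentiable f p ->
  'D_u f p = u 0 0 *: 'D_(delta_mx 0 0) f p + u 0 1 *: 'D_(delta_mx 0 1) f p.
Proof. by move=> df; rewrite [in LHS](rV2E u) derive_linear. Qed.

Lemma coord_diff V m n (f : V -> 'M[R]_(m, n)) p i j : differentiable f p ->
  differentiable (fun q => f q i j) p.
Proof.
move=> df; apply: (@differentiable_comp _ _ _ _ f (fun A : 'M[R]_(m, n) => A i j)) => //.
exact: differentiable_coord.
Qed.

Lemma derive_coord V m n (f : V -> 'M[R]_(m, n)) p v i j : differentiable f p ->
  'D_v (fun q => f q i j) p = ('D_v f p) i j.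
Proof. by move=> df; rewrite derive_mx ?mxE//; exact: diff_derivable. Qed.

Lemma C1near_coord V m n (f : V -> 'M[R]_(m, n)) p i j : C1near f p ->
  C1near (fun q => f q i j) p.
Proof.
move=> cf; apply: (@C1nearI _ _ _ (fun v q => ('D_v f q) i j)).
apply: filterS cf => q [df cf]; split.
- exact: coord_diff.
- by move=> v; exact: derive_coord.
- move=> v; apply: (@continuous_comp _ _ _ ('D_v f) (fun A => A i j)); first exact: cf.
  exact: coord_continuous.
Qed.

(** The direction ['D_v T q] moves with [q]. Expanding the chain rule in the two coordinates of [T]
    leaves derivatives of [f] in fixed directions, whose continuity is given. *)
Lemma C1near_comp V (f : 'rV[R]_2 -> R) (T : V -> 'rV[R]_2) p :
  C1near T p -> C1near f (T p) -> C1near (fun q => f (T q)) p.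
Proof.
move=> cT cf.
apply: (@C1nearI _ _ _ (fun v q => ('D_v T q) 0 0 * 'D_(delta_mx 0 0) f (T q)
   + ('D_v T q) 0 1 * 'D_(delta_mx 0 1) f (T q))).
have H' := C1near_cont cT cf.
near=> q.
have [dT cT'] : differentiable T q /\ forall v, {for q, continuous ('D_v T)}.
  by near: q.
have [df cf'] : differentiable f (T q) /\ forall v, {for T q, continuous ('D_v f)}.
  by near: q.
split.
- exact: differentiable_comp.
- by move=> v; rewrite (derive_val (der_comp v dT df)) (derive_rV2 _ df).
- move=> v; apply: cvgD; apply: cvgM.
  + apply: (@continuous_comp _ _ _ ('D_v T) (fun A => A 0 0)); first exact: cT'.
    exact: coord_continuous.
  + apply: (@continuous_comp _ _ _ T ('D__ f)); last exact: cf'.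
    exact: differentiable_continuous.
  + apply: (@continuous_comp _ _ _ ('D_v T) (fun A => A 0 1)); first exact: cT'.
    exact: coord_continuous.
  + apply: (@continuous_comp _ _ _ T ('D__ f)); last exact: cf'.
    exact: differentiable_continuous.
Unshelve. all: by end_near. Qed.

Lemma C1nearN V (f : V -> R) p : C1near f p -> C1near (fun q => - f q) p.
Proof.
move=> cf; apply: (@C1near_eq _ _ (fun q => (-1) * f q)).
  by near=> q; rewrite mulN1r.
exact: C1nearM (C1near_cst _ _) cf.
Unshelve. all: by end_near. Qed.

Lemma C1nearB V (f g : V -> R) p : C1near f p -> C1near g p ->
  C1near (fun q => f q - g q) p.
Proof. by move=> cf cg; exact: C1nearD cf (C1nearN cg). Qed.

Lemma is_derive1_inv (y : R) : y != 0 ->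
  is_derive y (1 : R) (GRing.inv : R -> R) (- y ^- 2).
Proof.
move=> y0.
have dv := @derivableV _ _ id y (1 : R) y0 (@derivable_id _ _ y 1).
apply: DeriveDef => //.
by rewrite (@deriveV _ _ id y 1 y0 (@derivable_id _ _ y 1)) derive_id /GRing.scale/= mulr1.
Qed.

Lemma C1nearV V (f : V -> R) p : C1near f p -> f p != 0 ->
  C1near (fun q => (f q)^-1) p.
Proof.
move=> cf fp; apply: (C1near_comp1 (h := GRing.inv) (dh := (fun y => - y ^- 2)) cf).
have : \forall y \near f p, y != 0.
  by apply: open_nbhs_nbhs; split => //; exact: open_neq.
apply: filterS => y y0; split; first exact: is_derive1_inv.
by apply: cvgN; apply: cvgV; [rewrite expf_neq0|exact: exprn_continuous].
Qed.

Lemma C1near_sqrt V (f : V -> R) p : C1near f p -> 0 < f p ->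
  C1near (fun q => Num.sqrt (f q)) p.
Proof.
move=> cf fp; apply: (C1near_comp1 (h := Num.sqrt) (dh := (fun y => (2 * Num.sqrt y)^-1)) cf).
have : \forall y \near f p, 0 < y by exact: lt_nbhsr.
apply: filterS => y y0; split.
- exact: is_derive1_sqrt.
- apply: cvgV; first by rewrite mulf_neq0// gt_eqF// sqrtr_gt0.
  by apply: cvgM; [exact: cvg_cst|exact: sqrt_continuous].
Qed.

Lemma C1near_atan V (f : V -> R) p : C1near f p ->
  C1near (fun q => atan (f q)) p.
Proof.
move=> cf; apply: (C1near_comp1 (h := atan) (dh := (fun y => (1 + y ^+ 2)^-1)) cf).
near=> y; split; first exact: is_derive1_atan.
apply: cvgV; first by rewrite gt_eqF// ltr_pwDl// sqr_ge0.
by apply: cvgD; [exact: cvg_cst|exact: exprn_continuous].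
Unshelve. all: by end_near. Qed.

Lemma C1near_exp V (f : V -> R) p : C1near f p ->
  C1near (fun q => expR (f q)) p.
Proof.
move=> cf; apply: (C1near_comp1 (h := expR) (dh := expR) cf).
by near=> y; split; [exact: is_derive_expR|exact: continuous_expR].
Unshelve. all: by end_near. Qed.

End C1near_theory.

(** * Maps of class C^k on open sets *)

Section Ck_theory.
Context {R : realType}.
Implicit Types (V W : normedModType R).

Lemma Ck_diff V W k (U : set V) (f : V -> W) x : Ck k.+1 U f -> U x -> differentiable f x.
Proof. by move=> [df _]; exact: df. Qed.

Lemma Ck_cont V W k (U : set V) (f : V -> W) x : Ck k U f -> U x -> {for x, continuous f}.
Proof. by case: k => [|k] H Ux; [exact: H|exact/differentiable_continuous/Ck_diff/Ux/H]. Qed.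

Lemma Ck_le V W k (U : set V) (f : V -> W) : Ck k.+1 U f -> Ck k U f.
Proof.
elim: k f => [|k IH] f H; first by move=> x Ux; exact: (Ck_cont H Ux).
by case: H => df H; split => // v; exact/IH/H.
Qed.

Lemma Ck_C1near V W (U : set V) (f : V -> W) p : open U -> Ck 1 U f -> U p -> C1near f p.
Proof.
move=> oU [d c] Up; have : \forall q \near p, U q by exact: open_nbhs_nbhs.
by apply: filterS => q Uq; split; [exact: d|move=> v; exact: c].
Qed.

Lemma open_near (V : topologicalType) (U : set V) (p : V) : open U -> U p -> \forall q \near p, U q.
Proof. by move=> *; exact: open_nbhs_nbhs. Qed.

Lemma Ck_eq V W k (U : set V) (f g : V -> W) : open U -> {in U, f =1 g} ->
  Ck k U f -> Ck k U g.
Proof.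
move=> oU; elim: k f g => [|k IH] f g fg.
  move=> H x Ux; apply: near_eq_continuous (H x Ux).
  by apply: filterS (open_near oU Ux) => q Uq; apply: fg; rewrite inE.
have nfg x : U x -> \forall q \near x, f q = g q.
  by move=> Ux; apply: filterS (open_near oU Ux) => q Uq; apply: fg; rewrite inE.
move=> [d H]; split => [x Ux|v].
  by apply: near_eq_differentiable (d x Ux); exact: nfg.
by apply: IH (H v) => x; rewrite inE => Ux; apply: near_eq_derive; exact: nfg.
Qed.

Lemma Ck_cst V W k (U : set V) (a : W) : Ck k U (fun=> a).
Proof.
elim: k a => [|k IH] a; first by move=> x _; exact: cvg_cst.
split => [x _|v]; first exact: differentiable_cst.
have -> : (fun x : V => 'D_v (fun=> a) x) = fun=> 0.
  by apply/funext => x; exact: derive_cst.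
exact: IH.
Qed.

Lemma CkD V W k (U : set V) (f g : V -> W) : open U -> Ck k U f -> Ck k U g ->
  Ck k U (fun q => f q + g q).
Proof.
move=> oU; elim: k f g => [|k IH] f g hf hg.
  by move=> x Ux; apply: cvgD; [exact: hf|exact: hg].
split => [x Ux|v]; first by apply: differentiableD; [exact: (Ck_diff hf)|exact: (Ck_diff hg)].
apply: (Ck_eq oU _ (IH _ _ (hf.2 v) (hg.2 v))) => x; rewrite inE => Ux.
by apply/esym/derive_val/derD; apply: derivable_diff; [exact: (Ck_diff hf)|exact: (Ck_diff hg)].
Qed.

Lemma CkM V k (U : set V) (f g : V -> R) : open U -> Ck k U f -> Ck k U g ->
  Ck k U (fun q => f q * g q).
Proof.
move=> oU; elim: k f g => [|k IH] f g hf hg.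
  by move=> x Ux; apply: cvgM; [exact: hf|exact: hg].
split => [x Ux|v]; first by apply: differentiableM; [exact: (Ck_diff hf)|exact: (Ck_diff hg)].
apply: (Ck_eq oU _ (CkD oU (IH _ _ (hf.2 v) (Ck_le hg)) (IH _ _ (Ck_le hf) (hg.2 v)))).
move=> x; rewrite inE => Ux.
by apply/esym/derive_val/derM; apply: derivable_diff; [exact: (Ck_diff hf)|exact: (Ck_diff hg)].
Qed.

Lemma Ck_exp V k (U : set V) (f : V -> R) : open U -> Ck k U f ->
  Ck k U (fun q => expR (f q)).
Proof.
move=> oU; elim: k f => [|k IH] f hf.
  move=> x Ux; apply: (@continuous_comp _ _ _ f expR); first exact: hf.
  exact: continuous_expR.
have dE x : differentiable (@expR R) x by exact/derivable1_diffP.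
split => [x Ux|v].
  by apply: (@differentiable_comp _ _ _ _ f expR) => //; exact: (Ck_diff hf).
apply: (Ck_eq oU _ (CkM oU (IH _ (Ck_le hf)) (hf.2 v))) => x; rewrite inE => Ux.
apply/esym/derive_val/der_comp1; first exact: (Ck_diff hf).
by apply: derivable_diff; exact: (Ck_diff hf).
Qed.

Lemma CkZ V W k (U : set V) (f : V -> W) (a : R) : open U -> Ck k U f ->
  Ck k U (fun q => a *: f q).
Proof.
move=> oU; elim: k f => [|k IH] f hf.
  by move=> x Ux; apply: cvgZr; exact: hf.
split => [x Ux|v]; first by apply: differentiableZ; exact: (Ck_diff hf).
apply: (Ck_eq oU _ (IH _ (hf.2 v))) => x; rewrite inE => Ux.
by rewrite (deriveZ a) //; exact/diff_derivable/(Ck_diff hf).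
Qed.

(** A derivative of the slice along [v] is a derivative of [f] along [(0, v)], which carries the
    induction. Freezing the parameter of a smooth variation thus gives a smooth line field. *)
Lemma Ck_slice V W k (U : set (R * V)%type) (f : R * V -> W) (t : R) :
  open U -> Ck k U f -> Ck k [set p | U (t, p)] (fun p => f (t, p)).
Proof.
move=> oU.
have dt x : differentiable (fun p : V => (t, p)) x.
  apply: (@differentiable_pair _ _ _ _ (fun=> t) id); first exact: differentiable_cst.
  exact: ex_diff.
have oV : open [set p | U (t, p)].
  apply: (@open_comp _ _ (fun p : V => (t, p))) => // x _.
  exact: differentiable_continuous.
elim: k f => [|k IH] f hf.
  move=> x Ux; apply: (@continuous_comp _ _ _ (fun p : V => (t, p)) f).
    exact: differentiable_continuous.
  exact: hf.
split => [x Ux|v].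
  by apply: (@differentiable_comp _ _ _ _ (fun p : V => (t, p)) f) => //; exact: (Ck_diff hf).
apply: (Ck_eq oV _ (IH _ (hf.2 (0, v)))) => x; rewrite inE => Ux.
apply/esym; rewrite (derive_val (der_comp v (dt x) (Ck_diff hf Ux))).
congr (derive f _ _).
rewrite (deriveE _ (dt x)).
have -> := @diff_pair _ _ _ _ (fun=> t) (@id V) x (differentiable_cst _ _) (ex_diff).
by rewrite diff_cst diff_val.
Qed.

Lemma Ck2_swap V (U : set V) (f : V -> R) p u v : open U -> Ck 2 U f -> U p ->
  'D_v ('D_u f) p = 'D_u ('D_v f) p.
Proof.
move=> oU [df ddf] Up; apply: derive_swap.
- apply: filterS (open_near oU Up) => q Uq.
  by split; [exact: df|exact: (ddf u).1|exact: (ddf v).1].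
- exact: (ddf u).2.
- exact: (ddf v).2.
Qed.

Lemma Ck_coord V k (U : set V) m n (f : V -> 'M[R]_(m, n)) i j : open U -> Ck k U f ->
  Ck k U (fun q => f q i j).
Proof.
move=> oU; elim: k f => [|k IH] f hf.
  move=> x Ux; apply: (@continuous_comp _ _ _ f (fun A => A i j)); first exact: hf.
  exact: coord_continuous.
split => [x Ux|v]; first by apply: coord_diff; exact: (Ck_diff hf).
apply: (Ck_eq oU _ (IH _ (hf.2 v))) => x; rewrite inE => Ux.
by apply/esym/derive_coord/(Ck_diff hf).
Qed.

End Ck_theory.

(** * Planar Riemannian geometry *)

Section algebra2.
Context {R : realType}.
Implicit Types (G : 'M[R]_2) (u v w : 'rV[R]_2).

(** The determinant of the pair; times [Num.sqrt (\det G)] it is the area form of [G] for the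
    orientation of the coordinates. *)
Definition wdg u v : R := u 0 0 * v 0 1 - u 0 1 * v 0 0.

Lemma ipE G u v : ip G u v = u 0 0 * G 0 0 * v 0 0 + u 0 0 * G 0 1 * v 0 1
  + (u 0 1 * G 1 0 * v 0 0 + u 0 1 * G 1 1 * v 0 1).
Proof.
rewrite /ip !mxE big_ord_recl big_ord1 !mxE !big_ord_recl !big_ord0 !addr0.
have -> : lift ord0 (0 : 'I_1) = 1 :> 'I_2 by exact/val_inj.
rewrite /=; ring.
Qed.

Lemma det2E G : \det G = G 0 0 * G 1 1 - G 0 1 * G 1 0.
Proof.
rewrite (expand_det_row _ ord0) !big_ord_recl big_ord0 /cofactor !det_mx11 !mxE.
have -> : lift ord0 (0 : 'I_1) = 1 :> 'I_2 by exact/val_inj.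
have -> : lift (1 : 'I_2) (0 : 'I_1) = 0 :> 'I_2 by exact/val_inj.
rewrite /=; ring.
Qed.

Definition spd G := G^T = G /\ forall u, u != 0 -> 0 < ip G u u.

Lemma spd_sym G : spd G -> G 1 0 = G 0 1.
Proof. by move=> [s _]; rewrite -[in LHS]s mxE. Qed.

Lemma ipC G u v : G^T = G -> ip G u v = ip G v u.
Proof.
move=> s; have s10 : G 1 0 = G 0 1 by rewrite -[in LHS]s mxE.
rewrite !ipE s10; ring.
Qed.

Lemma ipDl G u v w : ip G (u + v) w = ip G u w + ip G v w.
Proof. rewrite !ipE !mxE; ring. Qed.

Lemma ipDr G u v w : ip G w (u + v) = ip G w u + ip G w v.
Proof. rewrite !ipE !mxE; ring. Qed.

Lemma ipZl G a u w : ip G (a *: u) w = a * ip G u w.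
Proof. rewrite !ipE !mxE; ring. Qed.

Lemma ipZr G a u w : ip G w (a *: u) = a * ip G w u.
Proof. rewrite !ipE !mxE; ring. Qed.

Lemma ip0l G w : ip G 0 w = 0.
Proof. rewrite !ipE !mxE; ring. Qed.

Lemma ip0r G w : ip G w 0 = 0.
Proof. rewrite !ipE !mxE; ring. Qed.

Lemma ip_scale G a u v : ip (a *: G) u v = a * ip G u v.
Proof. rewrite !ipE !mxE; ring. Qed.

(** Both sides are the Gram determinant of [u] and [v]. It serves twice: to measure the part of a
    vector orthogonal to a unit vector, and to recognise the denominator in the derivative of an
    angle. *)
Lemma lagrange G u v : G^T = G ->
  ip G u u * ip G v v - ip G u v ^+ 2 = \det G * wdg u v ^+ 2.
Proof.
move=> s; have s10 : G 1 0 = G 0 1 by rewrite -[in LHS]s mxE.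
rewrite !ipE det2E /wdg s10; ring.
Qed.

Lemma rV2_neq0 u : u 0 0 != 0 -> u != 0.
Proof. by apply: contra => /eqP ->; rewrite mxE. Qed.

Lemma spd_det G : spd G -> 0 < \det G.
Proof.
move=> sG; have s := spd_sym sG; case: sG => _ pG.
have := pG _ (@rV2_neq0 (delta_mx 0 0) _); rewrite !mxE/= oner_neq0.
rewrite ipE !mxE/= => /(_ isT) G0.
(* [w] is [G]-orthogonal to the first basis vector and has squared length [G 0 0 * \det G]. *)
pose w : 'rV[R]_2 := \row_j (if j == 0 then - G 0 1 else G 0 0).
have G00 : 0 < G 0 0 by lra.
have : w != 0.
  apply/eqP => /(congr1 (fun u : 'rV_2 => u 0 1)); rewrite !mxE /= => /eqP.
  by rewrite gt_eqF.
move=> /pG; rewrite ipE !mxE/= det2E s.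
move=> H; have : 0 < G 0 0 * (G 0 0 * G 1 1 - G 0 1 * G 0 1) by lra.
by rewrite pmulr_rgt0.
Qed.

Lemma spd_unit G : spd G -> G \in unitmx.
Proof. by move=> /spd_det d; rewrite unitmxE unitfE gt_eqF. Qed.

Lemma wdg_cramer u v w : wdg u v *: w = wdg w v *: u + wdg u w *: v.
Proof. by apply/rowP => i; rewrite /wdg !mxE; case: (I2P i) => ->; ring. Qed.

Lemma wdgDr u v w : wdg u (v + w) = wdg u v + wdg u w.
Proof. rewrite /wdg !mxE; ring. Qed.

Lemma wdgDl u v w : wdg (v + w) u = wdg v u + wdg w u.
Proof. rewrite /wdg !mxE; ring. Qed.

Lemma wdgZr u a v : wdg u (a *: v) = a * wdg u v.
Proof. rewrite /wdg !mxE; ring. Qed.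

Lemma wdgZl u a v : wdg (a *: v) u = a * wdg v u.
Proof. rewrite /wdg !mxE; ring. Qed.

Lemma wdgNC u v : wdg u v = - wdg v u.
Proof. rewrite /wdg; ring. Qed.

Lemma wdgxx u : wdg u u = 0.
Proof. rewrite /wdg; ring. Qed.

Lemma wdg0P u v : u != 0 -> wdg u v = 0 -> exists a, v = a *: u.
Proof.
move=> u0 w0.
have [u00|u00] := eqVneq (u 0 0) 0; last first.
  exists (v 0 0 / u 0 0); apply/rowP => i; rewrite mxE.
  move: w0; rewrite /wdg => /eqP; rewrite subr_eq0 => /eqP e.
  by case: (I2P i) => ->; [field|apply: (mulfI u00); rewrite e; field].
have u01 : u 0 1 != 0.
  apply: contra u0 => /eqP u01; apply/eqP/rowP => i; rewrite mxE.
  by case: (I2P i) => ->.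
exists (v 0 1 / u 0 1); apply/rowP => i; rewrite mxE.
move: w0; rewrite /wdg u00 mul0r sub0r => /eqP; rewrite oppr_eq0 mulf_eq0.
by rewrite (negbTE u01)/= => /eqP v0; case: (I2P i) => ->; rewrite ?v0 ?u00 ?mulr0//; field.
Qed.

Lemma ip_nondeg G u v d0 d1 : spd G -> wdg d0 d1 != 0 ->
  ip G u d0 = ip G v d0 -> ip G u d1 = ip G v d1 -> u = v.
Proof.
move=> sG w0 e0 e1; apply/eqP; rewrite -subr_eq0; apply/negP => /negP uv.
have := sG.2 _ uv.
have a0 : ip G (u - v) d0 = 0 by rewrite -scaleN1r ipDl ipZl e0; ring.
have a1 : ip G (u - v) d1 = 0 by rewrite -scaleN1r ipDl ipZl e1; ring.
have : ip G (u - v) (wdg d0 d1 *: (u - v)) = 0.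
  by rewrite wdg_cramer ipDr !ipZr a0 a1 !mulr0 addr0.
by rewrite ipZr => /eqP; rewrite mulf_eq0 (negbTE w0)/= => /eqP ->; rewrite ltxx.
Qed.

(* the squared norm of the covector (b0, b1) *)
Definition cometric G (b0 b1 : R) : R :=
  (G 1 1 * b0 ^+ 2 - 2 * G 0 1 * b0 * b1 + G 0 0 * b1 ^+ 2) / \det G.

(** With the frame as rows of [M], orthonormality reads [M *m G *m M^T = 1%:M], so [M^T *m M] is the
    inverse of [G] and the sum is the quadratic form of this inverse at the covector. [A], [B] and
    [C] compute its entries multiplied by the determinant. *)
Lemma frame_cometric G (E : 'I_2 -> 'rV[R]_2) b0 b1 : spd G ->
  orthonormal_frame G E ->
  \sum_(a < 2) (E a 0 0 * b0 + E a 0 1 * b1) ^+ 2 = cometric G b0 b1.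
Proof.
move=> sG oE; have s := spd_sym sG; have d := spd_det sG.
pose M : 'M[R]_2 := \matrix_(a, j) E a 0 j.
have ME a : row a M = E a by apply/rowP => j; rewrite !mxE.
have : M *m G *m M^T = 1%:M.
  apply/matrixP => a b; rewrite [RHS]mxE -oE /ip.
  rewrite -!ME !mxE; apply: eq_bigr => k _; rewrite !mxE; congr (_ * _).
  by apply: eq_bigr => l _; rewrite !mxE.
rewrite -mulmxA => /mulmx1C; rewrite -mulmxA => H.
have h i j := congr1 (fun A : 'M[R]_2 => A i j) H.
move: (h 0 0) (h 0 1) (h 1 0) (h 1 1).
rewrite !mxE !big_ord_recl !big_ord0 !mxE !big_ord_recl !big_ord0 !mxE.
have -> : lift ord0 (ord0 : 'I_1) = 1 :> 'I_2 by exact/val_inj.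
rewrite /= s !addr0 /cometric det2E s.
move: d; rewrite det2E s.
have -> : ord0 = 0 :> 'I_2 by [].
move: (E 0 0 0) (E 0 0 1) (E 1 0 0) (E 1 0 1) (G 0 0) (G 0 1) (G 1 1).
move=> a b c e x y z D h00 h01 h10 h11.
apply: (@mulIf _ (x * z - y * y)); first by rewrite gt_eqF.
rewrite divfK ?gt_eqF//.
have A : (a * a + c * c) * (x * z - y * y) = z.
  transitivity (z * (x * (a * a + c * c) + y * (b * a + e * c))
    - y * (y * (a * a + c * c) + z * (b * a + e * c))); first by ring.
  by rewrite h00 h10; ring.
have B : (a * b + c * e) * (x * z - y * y) = - y.
  transitivity (z * (x * (a * b + c * e) + y * (b * b + e * e))
    - y * (y * (a * b + c * e) + z * (b * b + e * e))); first by ring.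
  by rewrite h01 h11; ring.
have C : (b * b + e * e) * (x * z - y * y) = x.
  transitivity (x * (y * (a * b + c * e) + z * (b * b + e * e))
    - y * (x * (a * b + c * e) + y * (b * b + e * e))); first by ring.
  by rewrite h01 h11; ring.
transitivity ((a * a + c * c) * (x * z - y * y) * b0 ^+ 2
  + 2 * ((a * b + c * e) * (x * z - y * y)) * b0 * b1
  + (b * b + e * e) * (x * z - y * y) * b1 ^+ 2); first by ring.
rewrite A B C; ring.
Qed.

End algebra2.

(* [ring] compares atoms up to conversion, which is costly on derivatives *)
Ltac ring_atoms := repeat match goal with
  | |- context [@christoffel ?R ?G ?p ?a ?b ?c] =>
      generalize (@christoffel R G p a b c); intro
  | |- context [@partial ?R ?i ?f ?p] => generalize (@partial R i f p); intro
  | |- context [@derive ?R ?V ?W ?f ?p ?v] => generalize (@derive R V W f p v); intro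
  end;
  repeat match goal with
  | |- context [@fun_of_matrix ?R ?m ?n ?A ?i ?j] =>
      let x := fresh in set x := (@fun_of_matrix R m n A i j); clearbody x
  end; ring.

(* keeps unification from unfolding derivatives into limits *)
Local Opaque derive.

(** * The Levi-Civita connection in coordinates *)

Section levi_civita.
Context {R : realType}.
Local Notation V := 'rV[R]_2.
Implicit Types (G : V -> 'M[R]_2) (X Y : V -> V) (p u v w : V).

Definition chr G p u v : V :=
  \row_(k < 2) \sum_(i < 2) \sum_(j < 2) christoffel G p k i j * u 0 i * v 0 j.

Definition dmetric G p u v w : R := 'D_u (fun q => ip (G q) v w) p.

Definition metric_near G p :=
  (\forall q \near p, spd (G q)) /\ forall i j, C1near (fun q => G q i j) p.

Lemma covDE G X p u : covD G X p u = 'D_u X p + chr G p u (X p).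
Proof. by []. Qed.

Lemma sum2 (f : 'I_2 -> R) : \sum_(i < 2) f i = f 0 + f 1.
Proof. by rewrite big_ord_recl big_ord1; congr (_ + f _); exact/val_inj. Qed.

Lemma sum22 (f : 'I_2 -> 'I_2 -> R) : \sum_(i < 2) \sum_(j < 2) f i j =
  f 0 0 + f 0 1 + (f 1 0 + f 1 1).
Proof. by rewrite !sum2. Qed.

Lemma sum222 (f : 'I_2 -> 'I_2 -> 'I_2 -> R) :
  \sum_(i < 2) \sum_(j < 2) \sum_(l < 2) f i j l =
  f 0 0 0 + f 0 0 1 + (f 0 1 0 + f 0 1 1)
  + (f 1 0 0 + f 1 0 1 + (f 1 1 0 + f 1 1 1)).
Proof. by rewrite !sum2. Qed.

Lemma chrE G p u v k : chr G p u v 0 k =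
  christoffel G p k 0 0 * u 0 0 * v 0 0 + christoffel G p k 0 1 * u 0 0 * v 0 1
  + (christoffel G p k 1 0 * u 0 1 * v 0 0 + christoffel G p k 1 1 * u 0 1 * v 0 1).
Proof. by rewrite mxE !sum2. Qed.

Lemma chrDr G p u v w : chr G p u (v + w) = chr G p u v + chr G p u w.
Proof. by apply/rowP => k; rewrite [RHS]mxE !chrE !mxE; ring_atoms. Qed.

Lemma chrZr G p a u v : chr G p u (a *: v) = a *: chr G p u v.
Proof. by apply/rowP => k; rewrite [RHS]mxE !chrE !mxE; ring_atoms. Qed.

Section at_point.
Variables (G : V -> 'M[R]_2) (p : V).
Hypothesis mG : metric_near G p.

Let sG : spd (G p). Proof. exact: nbhs_singleton mG.1. Qed.

Lemma derive_entry i j u : is_derive p u (fun q => G q i j)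
  (u 0 0 * partial 0 (fun q => G q i j) p + u 0 1 * partial 1 (fun q => G q i j) p).
Proof.
have d := C1near_diff (mG.2 i j).
by apply: is_derive_eq (derivable_diff _ d) _; rewrite (derive_rV2 _ d).
Qed.

Lemma derive_ip X Y u : differentiable X p -> differentiable Y p ->
  is_derive p u (fun q => ip (G q) (X q) (Y q))
    (dmetric G p u (X p) (Y p) + ip (G p) ('D_u X p) (Y p)
       + ip (G p) (X p) ('D_u Y p)).
Proof.
move=> dX dY.
have dx (Z : V -> V) i : differentiable Z p ->
    is_derive p u (fun q => Z q 0 i) ('D_u Z p 0 i).
  move=> dZ; rewrite -(derive_coord _ _ _ dZ); exact: derivable_diff (coord_diff _ _ dZ).
have key (Z T : V -> V) : differentiable Z p -> differentiable T p ->
    is_derive p u (fun q => ip (G q) (Z q) (T q)) (\sum_(i < 2) \sum_(j < 2)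
     (('D_u Z p 0 i * G p i j + Z p 0 i * 'D_u (fun q => G q i j) p) * T p 0 j
     + Z p 0 i * G p i j * 'D_u T p 0 j)).
  move=> dZ dT.
  have t i j : is_derive p u (fun q => Z q 0 i * G q i j * T q 0 j)
     (('D_u Z p 0 i * G p i j + Z p 0 i * 'D_u (fun q => G q i j) p) * T p 0 j
     + Z p 0 i * G p i j * 'D_u T p 0 j).
    exact: derM (derM (dx Z i dZ) (derivable_diff u (C1near_diff (mG.2 i j)))) (dx T j dT).
  have -> : (fun q => ip (G q) (Z q) (T q)) = (fun q =>
      Z q 0 0 * G q 0 0 * T q 0 0 + Z q 0 0 * G q 0 1 * T q 0 1
  + (Z q 0 1 * G q 1 0 * T q 0 0 + Z q 0 1 * G q 1 1 * T q 0 1)).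
    by apply/funext => q; rewrite ipE.
  rewrite !sum2.
  exact: derD (derD (t _ _) (t _ _)) (derD (t _ _) (t _ _)).
apply: is_derive_eq (key X Y dX dY) _.
rewrite /dmetric (derive_val (key (fun=> X p) (fun=> Y p)
  (differentiable_cst _ _) (differentiable_cst _ _))).
rewrite !derive_cst !ipE !sum2 !mxE; ring_atoms.
Qed.

Lemma dmetricE u v w : dmetric G p u v w = \sum_(i < 2) \sum_(j < 2) \sum_(l < 2)
  u 0 i * v 0 j * w 0 l * partial i (fun q => G q j l) p.
Proof.
have -> : dmetric G p u v w = \sum_(j < 2) \sum_(l < 2)
   v 0 j * w 0 l * 'D_u (fun q => G q j l) p.
  rewrite /dmetric.
  have t i j : is_derive p u (fun q => v 0 i * w 0 j * G q i j)
     (0 * G p i j + v 0 i * w 0 j * 'D_u (fun q => G q i j) p).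
    exact: derM (derC _ _ _) (derivable_diff u (C1near_diff (mG.2 i j))).
  have -> : (fun q => ip (G q) v w) = (fun q =>
      v 0 0 * w 0 0 * G q 0 0 + v 0 0 * w 0 1 * G q 0 1
  + (v 0 1 * w 0 0 * G q 1 0 + v 0 1 * w 0 1 * G q 1 1)).
    by apply/funext => q; rewrite ipE; ring.
  rewrite (derive_val (derD (derD (t _ _) (t _ _)) (derD (t _ _) (t _ _)))).
  by rewrite !sum2 !mul0r !add0r.
rewrite sum22 !(derive_val (derive_entry _ _ _)) sum222; ring_atoms.
Qed.

Lemma dmetricC u v w : dmetric G p u v w = dmetric G p u w v.
Proof.
apply: near_eq_derive; apply: filterS mG.1 => q [s _]; exact: ipC.
Qed.

(** Pairing with [G p] cancels the inverse matrix in [christoffel]. What remains are the symbols of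
    the first kind, and [z] is twice the corresponding covector. *)
Lemma koszul u v w : ip (G p) (chr G p u v) w =
  2^-1 * (dmetric G p u v w + dmetric G p v u w - dmetric G p w u v).
Proof.
pose z : V := \row_l \sum_(i < 2) \sum_(j < 2) (partial i (fun q => G q j l) p
  + partial j (fun q => G q i l) p - partial l (fun q => G q i j) p) * u 0 i * v 0 j.
have -> : chr G p u v = 2^-1 *: (z *m (invmx (G p))^T).
  apply/rowP => k; rewrite chrE /christoffel !mxE !sum2 !mxE 2!sum22; ring_atoms.
rewrite ipZl; congr (_ * _).
rewrite /ip trmx_inv sG.1 -!mulmxA mulKmx ?spd_unit//.
rewrite mxE sum2 !mxE 2!sum22 !dmetricE !sum222; ring_atoms.
Qed.

Lemma metric_compat u v w : dmetric G p u v w =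
  ip (G p) (chr G p u v) w + ip (G p) v (chr G p u w).
Proof.
rewrite [ip _ v _]ipC ?(sG.1)// !koszul (dmetricC u w v) (dmetricC w u v).
rewrite (dmetricC v u w); by field.
Qed.

Lemma derive_ip_covD X Y u : differentiable X p -> differentiable Y p ->
  is_derive p u (fun q => ip (G q) (X q) (Y q))
    (ip (G p) (covD G X p u) (Y p) + ip (G p) (X p) (covD G Y p u)).
Proof.
move=> dX dY; apply: is_derive_eq (derive_ip u dX dY) _.
by rewrite metric_compat !covDE ipDl ipDr; ring.
Qed.

End at_point.
End levi_civita.

(** * The connection form of a plane field, and the angle between two fields *)

Section connection_form.
Context {R : realType}.
Local Notation V := 'rV[R]_2.
Implicit Types (G : V -> 'M[R]_2) (X Y : V -> V) (p u v w : V).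

(* [u |-> conn G X p u] is the connection form of the rotated frame with first
   vector [X / |X|]. *)
Definition conn G X p u : R :=
  Num.sqrt (\det (G p)) * wdg (X p) (covD G X p u) / ip (G p) (X p) (X p).

Lemma chrDl G p u v w : chr G p (u + v) w = chr G p u w + chr G p v w.
Proof. by apply/rowP => k; rewrite [RHS]mxE !chrE !mxE; ring_atoms. Qed.

Lemma chrZl G p a u v : chr G p (a *: u) v = a *: chr G p u v.
Proof. by apply/rowP => k; rewrite [RHS]mxE !chrE !mxE; ring_atoms. Qed.

Lemma chr_linear G p u v : chr G p u v =
  v 0 0 *: chr G p u (delta_mx 0 0) + v 0 1 *: chr G p u (delta_mx 0 1).
Proof. by rewrite -!chrZr -chrDr -rV2E. Qed.

Section at_point.
Variables (G : V -> 'M[R]_2) (p : V).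
Hypothesis mG : metric_near G p.

Let sG : spd (G p). Proof. exact: nbhs_singleton mG.1. Qed.
Let W0 : 0 < \det (G p). Proof. exact: spd_det. Qed.

Lemma covD_linear X a b u v : differentiable X p ->
  covD G X p (a *: u + b *: v) = a *: covD G X p u + b *: covD G X p v.
Proof.
move=> dX; rewrite !covDE chrDl !chrZl derive_linear// !scalerDr.
by rewrite addrACA.
Qed.

Lemma conn_linear X a b u v : differentiable X p ->
  conn G X p (a *: u + b *: v) = a * conn G X p u + b * conn G X p v.
Proof. by move=> dX; rewrite /conn covD_linear// wdgDr !wdgZr; ring. Qed.

Lemma C1near_det q : metric_near G q -> C1near (fun q => \det (G q)) q.
Proof.
move=> mq.
have -> : (fun q => \det (G q)) = fun q => G q 0 0 * G q 1 1 - G q 0 1 * G q 1 0.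
  by apply/funext => r; rewrite det2E.
exact: C1nearB (C1nearM (mq.2 _ _) (mq.2 _ _)) (C1nearM (mq.2 _ _) (mq.2 _ _)).
Qed.

(** Metric compatibility expresses the derivatives of the entries through [chr]; Jacobi's formula
    then yields twice the trace of [chr G p u]. *)
Lemma derive_det u : is_derive p u (fun q => \det (G q))
  (2 * \det (G p) * (chr G p u (delta_mx 0 0) 0 0 + chr G p u (delta_mx 0 1) 0 1)).
Proof.
have t i j := derivable_diff u (C1near_diff (mG.2 i j)).
have -> : (fun q => \det (G q)) = fun q => G q 0 0 * G q 1 1 - G q 0 1 * G q 1 0.
  by apply/funext => r; rewrite det2E.
apply: is_derive_eq (derB (derM (t _ _) (t _ _)) (derM (t _ _) (t _ _))) _.
have d i j : 'D_u (fun q => G q i j) p =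
    dmetric G p u (delta_mx 0 i) (delta_mx 0 j).
  rewrite /dmetric; apply: (congr1 (fun f => 'D_u f p)); apply/funext => q.
  by rewrite ipE !mxE; case: (I2P i) => ->; case: (I2P j) => -> /=; ring.
rewrite !d !(metric_compat mG) !ipE det2E !mxE/= (spd_sym sG).
ring_atoms.
Qed.

(** For any endomorphism of the plane, applying it to each argument of a determinant in turn and
    adding produces its trace; here the endomorphism is [chr G p u]. *)
Lemma wdg_chr u v w : wdg (chr G p u v) w + wdg v (chr G p u w) =
  (chr G p u (delta_mx 0 0) 0 0 + chr G p u (delta_mx 0 1) 0 1) * wdg v w.
Proof.
rewrite (chr_linear _ _ u v) (chr_linear _ _ u w).
move: (chr G p u (delta_mx 0 0)) (chr G p u (delta_mx 0 1)) => a b.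
rewrite /wdg !mxE; ring.
Qed.

Lemma derive_wdg X Y u : differentiable X p -> differentiable Y p ->
  is_derive p u (fun q => wdg (X q) (Y q)) (wdg ('D_u X p) (Y p) + wdg (X p) ('D_u Y p)).
Proof.
move=> dX dY.
have dx (Z : V -> V) i : differentiable Z p ->
    is_derive p u (fun q => Z q 0 i) ('D_u Z p 0 i).
  move=> dZ; rewrite -(derive_coord _ _ _ dZ); exact: derivable_diff (coord_diff _ _ dZ).
apply: is_derive_eq (derB (derM (dx X 0 dX) (dx Y 1 dY)) (derM (dx X 1 dX) (dx Y 0 dY))) _.
rewrite /wdg; ring_atoms.
Qed.

Definition area G X Y q : R := Num.sqrt (\det (G q)) * wdg (X q) (Y q).

Lemma derive_area X Y u : differentiable X p -> differentiable Y p ->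
  is_derive p u (area G X Y)
    (Num.sqrt (\det (G p)) * (wdg (covD G X p u) (Y p) + wdg (X p) (covD G Y p u))).
Proof.
move=> dX dY.
have s := is_derive1_sqrt W0.
apply: is_derive_eq (derM (der_comp1 (C1near_diff (C1near_det mG)) s (derive_det u))
  (derive_wdg u dX dY)) _.
rewrite !covDE wdgDl wdgDr.
have -> : forall a b c d : R, a + b + (c + d) = a + c + (b + d) by move=> *; ring.
rewrite wdg_chr.
have q0 : Num.sqrt (\det (G p)) != 0 by rewrite gt_eqF// sqrtr_gt0.
have E : \det (G p) = Num.sqrt (\det (G p)) ^+ 2 by rewrite sqr_sqrtr// ltW.
move: E q0; set a := Num.sqrt _; clearbody a => -> a0.
move: (wdg ('D_u X p) _) (wdg (X p) ('D_u Y p)) (wdg (X p) (Y p)) => x y z.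
move: (chr G p u _ 0 0 + _) => t.
by field.
Qed.

Lemma C1near_ip X Y : C1near X p -> C1near Y p ->
  C1near (fun q => ip (G q) (X q) (Y q)) p.
Proof.
move=> cX cY.
have -> : (fun q => ip (G q) (X q) (Y q)) = (fun q =>
      X q 0 0 * G q 0 0 * Y q 0 0 + X q 0 0 * G q 0 1 * Y q 0 1
  + (X q 0 1 * G q 1 0 * Y q 0 0 + X q 0 1 * G q 1 1 * Y q 0 1)).
  by apply/funext => q; rewrite ipE.
have t i j := C1nearM (C1nearM (C1near_coord 0 i cX) (mG.2 i j)) (C1near_coord 0 j cY).
exact: C1nearD (C1nearD (t _ _) (t _ _)) (C1nearD (t _ _) (t _ _)).
Qed.

Lemma C1near_area X Y : C1near X p -> C1near Y p -> C1near (area G X Y) p.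
Proof.
move=> cX cY; apply: C1nearM; first exact: C1near_sqrt (C1near_det mG) W0.
have t i j := C1nearM (C1near_coord 0 i cX) (C1near_coord 0 j cY).
exact: C1nearB (t _ _) (t _ _).
Qed.

Lemma C1near_angle X Y : C1near X p -> C1near Y p ->
  ip (G p) (X p) (Y p) != 0 ->
  C1near (fun q => atan (area G X Y q / ip (G q) (X q) (Y q))) p.
Proof.
move=> cX cY P0; apply: C1near_atan.
exact: C1nearM (C1near_area cX cY) (C1nearV (C1near_ip cX cY) P0).
Qed.

(** The quotient is the tangent of the oriented angle from [X] to [Y], whatever their lengths, which
    is why neither field has to be normalised. *)
Lemma derive_angle X Y u : C1near X p -> C1near Y p ->
  ip (G p) (X p) (Y p) != 0 -> X p != 0 -> Y p != 0 ->
  is_derive p u (fun q => atan (area G X Y q / ip (G q) (X q) (Y q)))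
    (conn G Y p u - conn G X p u).
Proof.
move=> cX cY P0 X0 Y0.
have dX := C1near_diff cX; have dY := C1near_diff cY.
have dip := derive_ip_covD mG u dX dY.
have dar := derive_area u dX dY.
have dq := derM dar (der_comp1 (C1near_diff (C1near_ip cX cY)) (is_derive1_inv P0) dip).
have cq := C1nearM (C1near_area cX cY) (C1nearV (C1near_ip cX cY) P0).
apply: is_derive_eq (der_comp1 (C1near_diff cq) (is_derive1_atan _) dq) _.
rewrite /conn.
move: (covD G X p u) (covD G Y p u) => A B.
have nx0 : ip (G p) (X p) (X p) != 0 by rewrite gt_eqF//; exact: sG.2.
have ny0 : ip (G p) (Y p) (Y p) != 0 by rewrite gt_eqF//; exact: sG.2.
have L := lagrange (X p) (Y p) sG.1.
have E : \det (G p) = Num.sqrt (\det (G p)) ^+ 2 by rewrite sqr_sqrtr// ltW.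
have s := spd_sym sG.
(* Two planar identities split the numerator of the derivative: after division by both squared
   lengths, [e1] gives the connection form of [Y] and [e2] minus that of [X]. *)
have e1 : ip (G p) (X p) (Y p) * wdg (X p) B - wdg (X p) (Y p) * ip (G p) (X p) B
    = ip (G p) (X p) (X p) * wdg (Y p) B.
  by rewrite !ipE s /wdg; ring.
have e2 : ip (G p) (X p) (Y p) * wdg A (Y p) - wdg (X p) (Y p) * ip (G p) A (Y p)
    = - (ip (G p) (Y p) (Y p) * wdg (X p) A).
  by rewrite !ipE s /wdg; ring.
rewrite E in L; rewrite /area.
move: nx0 ny0 P0 L e1 e2; clear.
move: (Num.sqrt _) (ip (G p) (X p) (X p)) (ip (G p) (Y p) (Y p)) (ip (G p) (X p) (Y p)).
move: (wdg (X p) (Y p)) (wdg (X p) B) (wdg A (Y p)) (wdg (Y p) B) (wdg (X p) A).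
move: (ip (G p) (X p) B) (ip (G p) A (Y p)).
move=> xB Ay w wxB wAy wyB wxA s nx ny P nx0 ny0 P0 L e1 e2.
have n0 : P ^+ 2 + (s * w) ^+ 2 != 0.
  rewrite (_ : _ + _ = nx * ny) ?mulf_neq0//.
  by rewrite exprMn -L; ring.
have n1 : 1 + (s * w / P) ^+ 2 != 0.
  have -> : 1 + (s * w / P) ^+ 2 = (P ^+ 2 + (s * w) ^+ 2) / P ^+ 2 by field.
  by rewrite mulf_neq0// invr_neq0// expf_neq0.
transitivity (s * ((P * wxB - w * xB) + (P * wAy - w * Ay)) / (P ^+ 2 + (s * w) ^+ 2)).
  by field; rewrite n0 P0.
have -> : P ^+ 2 + (s * w) ^+ 2 = nx * ny by rewrite exprMn -L; ring.
by rewrite e1 e2; field; rewrite nx0 ny0.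
Qed.

(** By [lagrange], the part of a vector orthogonal to the unit vector [X p] has as length the
    absolute value of its area with [X p]. *)
Lemma conn_sq_norm X u : ip (G p) (X p) (X p) = 1 ->
  let A := perp (G p) (X p) (covD G X p u) in ip (G p) A A = conn G X p u ^+ 2.
Proof.
move=> X1 /=; rewrite /perp /conn X1 divr1 exprMn sqr_sqrtr ?ltW//.
rewrite -(lagrange (X p) (covD G X p u) sG.1) X1 mul1r.
move: (covD G X p u) => B; rewrite -scaleN1r !ipDl !ipDr !ipZl !ipZr X1.
rewrite (ipC B (X p) sG.1); ring.
Qed.

Lemma sum_conn_frame X (E : 'I_2 -> V) : differentiable X p ->
  orthonormal_frame (G p) E ->
  \sum_(a < 2) conn G X p (E a) ^+ 2 =
  cometric (G p) (conn G X p (delta_mx 0 0)) (conn G X p (delta_mx 0 1)).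
Proof.
move=> dX oE; rewrite -(frame_cometric _ _ sG oE); apply: eq_bigr => a _.
by rewrite [in LHS](rV2E (E a)) conn_linear.
Qed.

End at_point.

(** * Conformal change of the connection form *)

Section conformal_change.
Variables (G : V -> 'M[R]_2) (m : V -> R) (p : V).
Hypotheses (mG : metric_near G p) (cm : C1near m p).

Let sG : spd (G p). Proof. exact: nbhs_singleton mG.1. Qed.
Let W0 : 0 < \det (G p). Proof. exact: spd_det. Qed.

Definition confG (G : V -> 'M[R]_2) (m : V -> R) q := expR (2 * m q) *: G q.

Lemma confG_metric : metric_near (confG G m) p.
Proof.
split.
  apply: filterS mG.1 => q [s pos]; split; first by rewrite /confG linearZ /= s.
  by move=> u u0; rewrite ip_scale mulr_gt0 ?expR_gt0 ?pos.
move=> i j; rewrite (_ : (fun q => _) = fun q => expR (2 * m q) * G q i j).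
  apply: C1nearM (mG.2 i j); apply: C1near_exp; apply: C1nearM cm.
  exact: C1near_cst.
by apply/funext => q; rewrite mxE.
Qed.

Lemma dmetric_conf u v w : dmetric (confG G m) p u v w =
  expR (2 * m p) * (dmetric G p u v w + 2 * 'D_u m p * ip (G p) v w).
Proof.
have dm := derivable_diff u (C1near_diff cm).
have d2 := derM (derC (2 : R) p u) dm.
have c2 := C1nearM (C1near_cst (2 : R) p) cm.
have de := der_comp1 (C1near_diff c2) (is_derive_expR _) d2.
have di := derive_ip mG u (differentiable_cst v p) (differentiable_cst w p).
rewrite /dmetric; have -> : (fun q => ip (confG G m q) v w) =
    fun q => expR (2 * m q) * ip (G q) v w.
  by apply/funext => q; rewrite ip_scale.
rewrite (derive_val (derM de di)) !derive_cst -/(dmetric G p u v w).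
rewrite ip0l ip0r; ring_atoms.
Qed.

Definition grad (G : V -> 'M[R]_2) (m : V -> R) p : V :=
  (\row_i partial i m p) *m invmx (G p).

Lemma ip_grad u : ip (G p) (grad G m p) u = 'D_u m p.
Proof.
rewrite /ip /grad mulmxKV ?spd_unit// (derive_rV2 u (C1near_diff cm)) mxE sum2.
by rewrite !mxE /GRing.scale/= /partial; ring_atoms.
Qed.

(** Koszul's formula for the two metrics gives both sides the same inner product with every vector;
    [grad] enters as the vector dual to the differential of [m]. *)
Lemma chr_conf u v : chr (confG G m) p u v =
  chr G p u v + 'D_u m p *: v + 'D_v m p *: u - ip (G p) u v *: grad G m p.
Proof.
have sc : spd (confG G m p) by exact: nbhs_singleton confG_metric.1.
have E w : ip (confG G m p) (chr (confG G m) p u v) w = ip (confG G m p)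
    (chr G p u v + 'D_u m p *: v + 'D_v m p *: u - ip (G p) u v *: grad G m p) w.
  rewrite (koszul confG_metric) !dmetric_conf /confG ip_scale -[- (_ *: grad _ _ _)]scaleNr.
  rewrite !ipDl !ipZl ip_grad (koszul mG).
  move: (dmetric _ _ _ _ _) (dmetric _ _ _ _ _) (dmetric _ _ _ _ _) => a b c.
  move: (derive _ _ _) (derive _ _ _) (derive _ _ _) (expR _) => d e f g.
  by move: (ip _ _ _) (ip _ _ _) (ip _ _ _) => x y z; field.
apply: (@ip_nondeg _ _ _ _ (delta_mx 0 0) (delta_mx 0 1) sc _ (E _) (E _)).
by rewrite /wdg !mxE/= mulr1 mul0r subr0 oner_neq0.
Qed.

(** The multiple of [X p] in [chr_conf] dies in [wdg (X p)], and [K] recombines the other two new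
    terms into [wdg n u], from which [X] has disappeared: the added term is the Hodge star of the
    differential of [m]. The conformal factors of [Num.sqrt (\det _)] and of the squared length
    cancel, as the dimension is 2. *)
Lemma conn_conf X u : X p != 0 -> conn (confG G m) X p u =
  conn G X p u + area G (fun=> grad G m p) (fun=> u) p.
Proof.
move=> X0; have n0 : ip (G p) (X p) (X p) != 0 by rewrite gt_eqF//; exact: sG.2.
have e0 : expR (2 * m p) != 0 by rewrite gt_eqF// expR_gt0.
have E : Num.sqrt (\det (confG G m p)) = expR (2 * m p) * Num.sqrt (\det (G p)).
  by rewrite /confG detZ sqrtrM ?sqr_ge0// sqrtr_sqr ger0_norm// expR_ge0.
rewrite /conn /area E !covDE chr_conf ip_scale.
move: (grad G m p) (ip_grad (X p)) => n Hn.
rewrite !addrA -[- (_ *: n)]scaleNr !wdgDr !wdgZr wdgxx mulr0 -Hn.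
have K : ip (G p) n (X p) * wdg (X p) u - ip (G p) u (X p) * wdg (X p) n
    = ip (G p) (X p) (X p) * wdg n u.
  by rewrite !ipE (spd_sym sG) /wdg; ring.
have -> : wdg n u = (ip (G p) n (X p) * wdg (X p) u - ip (G p) u (X p) * wdg (X p) n)
    / ip (G p) (X p) (X p) by rewrite K mulrC mulKf.
move: n0 e0; move: (ip (G p) n _) (ip (G p) u _) (ip (G p) (X p) (X p)) (expR _).
move: (Num.sqrt _) (wdg _ _) (wdg _ _) (wdg _ _) (wdg _ _) => *.
by field; apply/andP.
Qed.

(** The inverse metric scales by [expR (- (2 * m p))], hence the factor on the left. Expanding the
    square of the form in [conn_conf] leaves a cross term, the coefficient of the differential of
    [m] wedged with the connection form, and a term common to all fields [X]. *)
Lemma cometric_conf X : X p != 0 ->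
  expR (2 * m p) * cometric (confG G m p) (conn (confG G m) X p (delta_mx 0 0))
     (conn (confG G m) X p (delta_mx 0 1))
  - cometric (G p) (conn G X p (delta_mx 0 0)) (conn G X p (delta_mx 0 1)) =
  2 * (partial 0 m p * conn G X p (delta_mx 0 1)
     - partial 1 m p * conn G X p (delta_mx 0 0)) / Num.sqrt (\det (G p))
  + cometric (G p) (area G (fun=> grad G m p) (fun=> delta_mx 0 0) p)
      (area G (fun=> grad G m p) (fun=> delta_mx 0 1) p).
Proof.
move=> X0; rewrite !conn_conf// /area /cometric /confG detZ !mxE.
have := ip_grad (delta_mx 0 0); have := ip_grad (delta_mx 0 1).
rewrite -/(partial 0 m p) -/(partial 1 m p) !ipE !mxE/= => <- <-.
have E : \det (G p) = Num.sqrt (\det (G p)) ^+ 2 by rewrite sqr_sqrtr// ltW.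
have D := det2E (G p); rewrite (spd_sym sG) in D *.
have s0 : Num.sqrt (\det (G p)) != 0 by rewrite gt_eqF// sqrtr_gt0.
have e0 : expR (2 * m p) != 0 by rewrite gt_eqF// expR_gt0.
rewrite /wdg !mxE/=; move: E D s0 e0.
set a := Num.sqrt _; clearbody a => -> D a0; move: D.
move: (expR _) (conn _ _ _ _) (conn _ _ _ _) (grad G m p 0 0) (grad G m p 0 1).
move: (G p 0 0) (G p 0 1) (G p 1 1) => x y z e b c n1 n2 D e0.
by field; rewrite a0 e0.
Qed.

End conformal_change.

End connection_form.

(** * Change of chart *)

Lemma koszul_shift (R : realType) (G : 'M[R]_2) du dv dw huv huw hvw (a b c A B C : R) :
  G^T = G -> a = A + ip G huv dw + ip G dv huw ->
  b = B + ip G huv dw + ip G du hvw -> c = C + ip G huw dv + ip G du hvw ->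
  2^-1 * (a + b - c) = ip G huv dw + 2^-1 * (A + B - C).
Proof.
move=> s -> -> ->; rewrite (ipC dv huw s).
move: (ip _ _ _) (ip _ _ _) (ip _ _ _) => x y z; by field.
Qed.

(** Here [j] is the Jacobian determinant and [l] the ratio of two spanning vectors; squaring removes
    the sign of [j], that is, the orientation. *)
Lemma conn_sq_algebra (R : realType) (s' j n l w s n' w' : R) : 0 <= s' ->
  n != 0 -> l != 0 -> s = s' * j ^+ 2 -> n' = l * (l * n) ->
  w' = l ^+ 2 * (j * w) ->
  (Num.sqrt s' * w' / n') ^+ 2 = (Num.sqrt s * w / n) ^+ 2.
Proof.
move=> s0 n0 l0 -> -> ->.
have sj : 0 <= s' * j ^+ 2 by apply: mulr_ge0 => //; exact: sqr_ge0.
rewrite !exprMn !exprVn !sqr_sqrtr//.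
by field; rewrite n0 l0.
Qed.

(** The hypothesis is a differentiated relation of parallelism. It determines [Z] only modulo [P],
    which is enough under [wdg P]. *)
Lemma wdg_transport (R : realType) (l : R) (P Q C Z : 'rV[R]_2) :
  l * wdg Q P + wdg P Z = 0 ->
  wdg (l *: P) (Z + l *: C) = l ^+ 2 * wdg P (Q + C).
Proof.
move=> /eqP; rewrite addrC addr_eq0 => /eqP E.
by rewrite wdgZl !wdgDr wdgZr E (wdgNC Q P); ring.
Qed.

Section chart_change.
Context {R : realType}.
Local Notation V := 'rV[R]_2.
Implicit Types u v w : V.
Variables (G G' : V -> 'M[R]_2) (T : V -> V) (U : set V) (p : V).
Hypotheses (mG : metric_near G p) (mG' : metric_near G' (T p)).
Hypotheses (oU : open U) (Up : U p) (sT : Ck 2 U T).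
Hypothesis isoT : \forall q \near p, forall v w,
  ip (G q) v w = ip (G' (T q)) ('D_v T q) ('D_w T q).

Let sG : spd (G p). Proof. exact: nbhs_singleton mG.1. Qed.
Let sG' : spd (G' (T p)). Proof. exact: nbhs_singleton mG'.1. Qed.
Let cT : C1near T p. Proof. exact: Ck_C1near oU (Ck_le sT) Up. Qed.
Let dT : differentiable T p. Proof. exact: C1near_diff. Qed.
Let cdT v : C1near ('D_v T) p.
Proof. by case: sT => _ /(_ v) H; exact: Ck_C1near oU H Up. Qed.
Let iso v w := nbhs_singleton isoT v w.

Definition hess u v : V := 'D_u ('D_v T) p.

Lemma hessC u v : hess u v = hess v u.
Proof.
have h k a b : hess a b 0 k = 'D_a ('D_b (fun q => T q 0 k)) p.
  rewrite /hess -(derive_coord _ _ _ (C1near_diff (cdT b))).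
  apply: near_eq_derive; apply: filterS cT => q [dq _].
  by rewrite derive_coord.
apply/rowP => k.
exact: etrans (h k u v) (etrans (Ck2_swap v u oU (Ck_coord 0 k oU sT) Up) (esym (h k v u))).
Qed.

Lemma dT_linear u : 'D_u T p = u 0 0 *: 'D_(delta_mx 0 0) T p + u 0 1 *: 'D_(delta_mx 0 1) T p.
Proof. exact: derive_rV2 u dT. Qed.

Definition jdet := wdg ('D_(delta_mx 0 0) T p) ('D_(delta_mx 0 1) T p).

Lemma wdg_comb (a b u v : V) :
  wdg (u 0 0 *: a + u 0 1 *: b) (v 0 0 *: a + v 0 1 *: b) = wdg a b * wdg u v.
Proof. by rewrite /wdg !mxE; ring. Qed.

Lemma wdg_comb_l (a b u z : V) :
  wdg (u 0 0 *: a + u 0 1 *: b) z = u 0 0 * wdg a z + u 0 1 * wdg b z.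
Proof. by rewrite wdgDl !wdgZl. Qed.

Lemma wdg_product_rule (a0 a1 h0 h1 x x' y z : V) :
  wdg (x' 0 0 *: a0 + x' 0 1 *: a1 + (x 0 0 *: h0 + x 0 1 *: h1)) z
  + wdg (x 0 0 *: a0 + x 0 1 *: a1) y =
  x' 0 0 * wdg a0 z + x 0 0 * (wdg h0 z + wdg a0 y)
  + (x' 0 1 * wdg a1 z + x 0 1 * (wdg h1 z + wdg a1 y)).
Proof. by rewrite wdgDl !wdg_comb_l; ring. Qed.

Lemma wdg_dT u v : wdg ('D_u T p) ('D_v T p) = jdet * wdg u v.
Proof. exact: etrans (congr2 _ (dT_linear u) (dT_linear v)) (wdg_comb _ _ u v). Qed.

Lemma det_chart : \det (G p) = \det (G' (T p)) * jdet ^+ 2.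
Proof.
have we : wdg (delta_mx 0 0 : V) (delta_mx 0 1) = 1.
  by rewrite /wdg !mxE/= mulr1 mul0r subr0.
have := lagrange (delta_mx 0 0) (delta_mx 0 1) sG.1.
by rewrite we expr1n mulr1 !iso (lagrange _ _ sG'.1) -/jdet => <-.
Qed.

Lemma jdet_neq0 : jdet != 0.
Proof.
apply/negP => /eqP j0; have := spd_det sG.
by rewrite det_chart j0 expr0n mulr0 ltxx.
Qed.

Lemma dT_neq0 u : u != 0 -> 'D_u T p != 0.
Proof.
move=> u0; apply/negP => /eqP e; have := sG.2 _ u0.
by rewrite iso e ip0l ltxx.
Qed.

Let mH : metric_near (fun q => G' (T q)) p.
Proof.
split; first exact: (C1near_cont cT mG'.1).
by move=> i j; exact: C1near_comp cT (mG'.2 i j).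
Qed.

Lemma dmetric_chart u v w : dmetric G p u v w =
  dmetric G' (T p) ('D_u T p) ('D_v T p) ('D_w T p)
  + ip (G' (T p)) (hess u v) ('D_w T p) + ip (G' (T p)) ('D_v T p) (hess u w).
Proof.
have -> : dmetric G p u v w = 'D_u (fun q => ip (G' (T q)) ('D_v T q) ('D_w T q)) p.
  by apply: near_eq_derive; apply: filterS isoT => q; apply.
rewrite (derive_val (derive_ip mH u (C1near_diff (cdT v)) (C1near_diff (cdT w)))).
have -> // : dmetric (fun q => G' (T q)) p u ('D_v T p) ('D_w T p) =
  dmetric G' (T p) ('D_u T p) ('D_v T p) ('D_w T p).
apply: derive_val (der_comp (f := fun r => ip (G' r) ('D_v T p) ('D_w T p)) u dT _).
exact: C1near_diff (C1near_ip mG' (C1near_cst ('D_v T p) (T p))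
  (C1near_cst ('D_w T p) (T p))).
Qed.

(** The inhomogeneous transformation law of the Christoffel symbols. In the Koszul combination of
    three instances of [dmetric_chart] all Hessian terms cancel except two equal ones, and the
    vectors ['D_w T p] span the plane. *)
Lemma chr_chart u v : 'D_(chr G p u v) T p =
  hess u v + chr G' (T p) ('D_u T p) ('D_v T p).
Proof.
have E w : ip (G' (T p)) ('D_(chr G p u v) T p) ('D_w T p) =
    ip (G' (T p)) (hess u v + chr G' (T p) ('D_u T p) ('D_v T p)) ('D_w T p).
  have dvu := dmetric_chart v u w; rewrite (hessC v u) in dvu.
  have dwu := dmetric_chart w u v; rewrite (hessC w u) (hessC w v) in dwu.
  have H := koszul_shift sG'.1 (dmetric_chart u v w) dvu dwu.
  rewrite ipDl (koszul mG' ('D_u T p) ('D_v T p) ('D_w T p)) -H -iso.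
  exact: koszul mG u v w.
exact: ip_nondeg sG' jdet_neq0 (E _) (E _).
Qed.

(** Differentiating the parallelism of the two sections brings in a second derivative of [T], which
    is exactly the one absorbed by [chr_chart]. *)
Lemma conn_chart_sq (X X' : V -> V) u : C1near X p -> C1near X' (T p) ->
  X p != 0 -> X' (T p) != 0 ->
  (\forall q \near p, wdg ('D_(X q) T q) (X' (T q)) = 0) ->
  conn G' X' (T p) ('D_u T p) ^+ 2 = conn G X p u ^+ 2.
Proof.
move=> cX cX' X0 X'0 par.
have dX := C1near_diff cX.
have dx i : is_derive p u (fun q => X q 0 i) ('D_u X p 0 i).
  by rewrite -(derive_coord _ _ _ dX); exact: derivable_diff (coord_diff _ _ dX).
have dXT : is_derive p u (fun q => X' (T q)) ('D_('D_u T p) X' (T p)).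
  exact: der_comp dT (C1near_diff cX').
have dXT' : differentiable (fun q => X' (T q)) p.
  exact: differentiable_comp dT (C1near_diff cX').
have dw j : is_derive p u (fun q => wdg ('D_(delta_mx 0 j) T q) (X' (T q)))
   (wdg (hess u (delta_mx 0 j)) (X' (T p))
    + wdg ('D_(delta_mx 0 j) T p) ('D_('D_u T p) X' (T p))).
  by rewrite -(derive_val dXT); exact: derive_wdg u (C1near_diff (cdT _)) dXT'.
(* Writing ['D_(X q) T q] in the coordinates of [X q] avoids differentiating a derivative whose
   direction varies. *)
have d0 : 'D_u (fun q => X q 0 0 * wdg ('D_(delta_mx 0 0) T q) (X' (T q))
    + X q 0 1 * wdg ('D_(delta_mx 0 1) T q) (X' (T q))) p = 0.
  rewrite -(derive_cst (0 : R) p u); apply: near_eq_derive.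
  apply: filterS2 par cT => q e [dq _].
  apply: etrans e; apply: esym.
  exact: etrans (congr1 (fun z => wdg z (X' (T q))) (derive_rV2 (X q) dq)) (wdg_comb_l _ _ _ _).
rewrite (derive_val (derD (derM (dx 0) (dw 0)) (derM (dx 1) (dw 1)))) in d0.
have hX : hess u (X p) = X p 0 0 *: hess u (delta_mx 0 0) + X p 0 1 *: hess u (delta_mx 0 1).
  rewrite !(hessC u); exact: derive_rV2 (X p) (C1near_diff (cdT u)).
have dE' : wdg ('D_('D_u X p) T p + hess u (X p)) (X' (T p))
    + wdg ('D_(X p) T p) ('D_('D_u T p) X' (T p)) = 0.
  apply: etrans d0; apply: etrans _ (wdg_product_rule _ _ _ _ _ _ _ _).
  have eX := f_equal2 (fun a b : V => a + b) (dT_linear ('D_u X p)) hX.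
  have e1 := f_equal (fun z => wdg z (X' (T p))) eX.
  have e2 := f_equal (fun z => wdg z ('D_('D_u T p) X' (T p))) (dT_linear (X p)).
  exact: (f_equal2 (fun a b : R => a + b) e1 e2).
(* The ratio is taken at [p] only: [wdg] kills the term that a derivative of [l] would
   contribute. *)
have [l lE] : exists l, X' (T p) = l *: 'D_(X p) T p.
  apply: wdg0P; first exact: dT_neq0.
  exact: nbhs_singleton par.
have l0 : l != 0 by apply: contra X'0 => /eqP l0; rewrite lE l0 scale0r.
have dE : l * wdg ('D_('D_u X p) T p + hess u (X p)) ('D_(X p) T p)
    + wdg ('D_(X p) T p) ('D_('D_u T p) X' (T p)) = 0 by rewrite -[RHS]dE' lE wdgZr.
have cov1 : covD G' X' (T p) ('D_u T p) =
    'D_('D_u T p) X' (T p) + l *: chr G' (T p) ('D_u T p) ('D_(X p) T p).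
  rewrite covDE.
  have c : chr G' (T p) ('D_u T p) (X' (T p)) = l *: chr G' (T p) ('D_u T p) ('D_(X p) T p).
    by rewrite -chrZr; exact: f_equal lE.
  by rewrite c.
have cov2 : 'D_(covD G X p u) T p = 'D_('D_u X p) T p + hess u (X p)
    + chr G' (T p) ('D_u T p) ('D_(X p) T p).
  exact: etrans (derive_dirD _ _ dT) (etrans
    (f_equal (fun z => 'D_('D_u X p) T p + z) (chr_chart u (X p))) (addrA _ _ _)).
have W : wdg (X' (T p)) (covD G' X' (T p) ('D_u T p)) =
    l ^+ 2 * (jdet * wdg (X p) (covD G X p u)).
  exact: etrans (f_equal2 (@wdg R) lE cov1) (etrans (wdg_transport _ dE)
    (f_equal (fun z => l ^+ 2 * z)
      (etrans (f_equal (wdg _) (esym cov2)) (wdg_dT (X p) (covD G X p u))))).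
have n0 : ip (G p) (X p) (X p) != 0 by rewrite gt_eqF//; exact: sG.2.
have n' : ip (G' (T p)) (X' (T p)) (X' (T p)) = l * (l * ip (G p) (X p) (X p)).
  exact: etrans (f_equal2 (ip (G' (T p))) lE lE) (etrans (ipZl _ _ _ _)
    (f_equal (fun z => l * z) (etrans (ipZr _ _ _ _)
      (f_equal (fun z => l * z) (esym (iso _ _)))))).
exact: conn_sq_algebra (ltW (spd_det sG')) n0 l0 det_chart n' W.
Qed.

End chart_change.

(** * Measures, and integration in the plane *)

Section transfer.
Local Open Scope ereal_scope.
Context d1 d2 (T1 : measurableType d1) (T2 : measurableType d2) (R : realType).
Variables (m1 : {measure set T1 -> \bar R}) (m2 : {measure set T2 -> \bar R}).
Variables (phi : T2 -> T1) (w : T2 -> R) (D : set T1).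
Hypotheses (mphi : measurable_fun setT phi) (mw : measurable_fun setT w).
Hypotheses (w0 : forall z, (0 <= w z)%R) (mD : measurable D).
Hypothesis m1E : forall A, measurable A -> A `<=` D ->
  m1 A = \int[m2]_(z in phi @^-1` A) (w z)%:E.

Import HBNNSimple.

Let mphi1 A : measurable A -> measurable (phi @^-1` A).
Proof. by move=> mA; rewrite -[X in measurable X]setTI; exact: mphi. Qed.

(** [m1E] is the case of indicator functions, extended by linearity here and by monotone convergence
    in [ge0_transfer]. *)
Lemma transfer_nnsfun (g : {nnsfun T1 >-> R}) :
  \int[m1]_(x in D) (g x)%:E =
  \int[m2]_(z in phi @^-1` D) ((g (phi z))%:E * (w z)%:E).
Proof.
have r0 y : y \in range g -> (0 <= y)%R by rewrite inE => -[x _ <-].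
transitivity (\sum_(y \in range g) y%:E * m1 (g @^-1` [set y] `&` D)).
  transitivity (\int[m1]_(x in D) \sum_(y \in range g) (y * \1_(g @^-1` [set y]) x)%:E).
    by apply: eq_integral => x _; rewrite [in LHS]fimfunE -fsumEFin.
  rewrite ge0_integral_fsum//; last 2 first.
  - move=> y; apply/measurable_EFinP; apply: measurable_funM => //.
  - by move=> y x _; exact: nnfun_muleindic_ge0.
  apply: eq_fsbigr => y yg; under eq_integral do rewrite EFinM.
  rewrite ge0_integralZl//; last 2 first.
  - exact/measurable_EFinP.
  - by rewrite lee_fin r0.
  by rewrite integral_indic.
have mD' := mphi1 mD.
have mw' : measurable_fun (phi @^-1` D) (EFin \o w).
  by apply/measurable_EFinP; exact: measurable_funTS.
have mg y : measurable (g @^-1` [set y]) by [].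
transitivity (\int[m2]_(z in phi @^-1` D) \sum_(y \in range g)
    ((y * \1_(g @^-1` [set y]) (phi z))%:E * (w z)%:E)); last first.
  apply: eq_integral => z _.
  rewrite -ge0_mule_fsuml => [|y]; last exact: nnfun_muleindic_ge0.
  by rewrite fsumEFin// -(fimfunE _ (phi z)).
rewrite ge0_integral_fsum//; last 2 first.
- move=> y; apply: emeasurable_funM => //; apply/measurable_EFinP.
  apply: measurable_funTS; apply: measurable_funM => //.
  have mi : measurable_fun setT (\1_(g @^-1` [set y]) : T1 -> R).
    exact: measurable_indic.
  exact: measurableT_comp mi mphi.
- move=> y z _; apply: mule_ge0; last by rewrite lee_fin.
  exact: nnfun_muleindic_ge0.
apply: eq_fsbigr => y yg.
rewrite m1E; last 2 first.
- exact: measurableI.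
- by move=> x [].
rewrite preimage_setI setIC integral_mkcondr -ge0_integralZl//; last 3 first.
- apply/measurable_restrict => //; first exact: mphi1.
  by apply: measurable_funS mw' => // x [].
- by move=> z _; rewrite patchE; case: ifP => // _; rewrite lee_fin.
- by rewrite lee_fin r0.
apply: eq_integral => z _; rewrite patchE indicE.
have -> : (z \in phi @^-1` (g @^-1` [set y])) = (phi z \in g @^-1` [set y]).
  by apply/idP/idP; rewrite !inE.
by case: ifP => _; rewrite ?mulr1 ?mulr0 ?mule0 ?mul0e.
Qed.

Lemma ge0_transfer (f : T1 -> \bar R) : measurable_fun setT f ->
  (forall x, 0 <= f x) ->
  \int[m1]_(x in D) f x = \int[m2]_(z in phi @^-1` D) (f (phi z) * (w z)%:E).
Proof.
move=> mf f0.
pose g := nnsfun_approx measurableT mf.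
have mD' := mphi1 mD.
have gE n x : 0 <= (g n x)%:E by rewrite lee_fin.
transitivity (limn (fun n => \int[m1]_(x in D) (g n x)%:E)).
  rewrite -monotone_convergence//.
  - apply: eq_integral => x _; apply/esym/cvg_lim => //.
    exact: cvg_nnsfun_approx.
  - by move=> n; apply/measurable_EFinP; exact: measurable_funTS.
  - by move=> x _ n m nm; rewrite lee_fin; exact/lefP/nd_nnsfun_approx.
transitivity (limn (fun n => \int[m2]_(z in phi @^-1` D)
    ((g n (phi z))%:E * (w z)%:E))).
  by apply: congr_lim; apply/funext => n; exact: transfer_nnsfun.
rewrite -monotone_convergence//.
- apply: eq_integral => z _; apply/cvg_lim => //.
  apply: cvgeZr => //; exact: cvg_nnsfun_approx.
- move=> n; apply/measurable_EFinP/measurable_funTS/measurable_funM => //.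
  exact: measurableT_comp.
- by move=> n z _; apply: mule_ge0; rewrite lee_fin.
- move=> z _ n m nm; apply: lee_pmul => //; rewrite ?lee_fin//.
  exact/lefP/nd_nnsfun_approx.
Qed.

(** Multiplication by the nonnegative [w] commutes with positive and negative parts, so the
    nonnegative case applies to each. *)
Lemma transfer_integral (f : T1 -> \bar R) : measurable_fun setT f ->
  \int[m1]_(x in D) f x = \int[m2]_(z in phi @^-1` D) (f (phi z) * (w z)%:E).
Proof.
move=> mf; rewrite [LHS]integralE [RHS]integralE.
congr (_ - _); (rewrite ge0_transfer; last 2 first).
- exact: measurable_funepos.
- by [].
- by apply: eq_integral => z _; rewrite !funeposE muleC maxe_pMr ?lee_fin// mule0 muleC.
- exact: measurable_funeneg.
- by [].
- apply: eq_integral => z _.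
  by rewrite !funenegE muleC maxe_pMr ?lee_fin// mule0 muleN muleC.
Qed.

End transfer.

Section density.
Local Open Scope ereal_scope.
Context d (T : measurableType d) (R : realType).
Variables (m : {measure set T -> \bar R}) (w : T -> R).
Variables (mw : measurable_fun setT w) (w0 : forall x, (0 <= w x)%R).

(** Measurability and sign of [w] are arguments so that the measure structure declared below can be
    attached to the term. *)
Definition density of measurable_fun setT w & (forall x, (0 <= w x)%R) :=
  fun A : set T => \int[m]_(x in A) (w x)%:E.

Let nu := density mw w0.

Let nu0 : nu set0 = 0.
Proof. exact: integral_set0. Qed.

Let nu_ge0 A : 0 <= nu A.
Proof. by apply: integral_ge0 => x _; rewrite lee_fin. Qed.

Let nu_sigma_additive : semi_sigma_additive nu.
Proof.
move=> F mF tF mU; rewrite /nu /density ge0_integral_bigcup//; last 2 first.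
- by apply/measurable_EFinP; exact: measurable_funTS.
- by move=> x _; rewrite lee_fin.
apply: is_cvg_ereal_nneg_natsum_cond => n _ _.
by apply: integral_ge0 => x _; rewrite lee_fin.
Qed.

HB.instance Definition _ := isMeasure.Build _ _ _ nu nu0 nu_ge0 nu_sigma_additive.

Lemma integral_density D (f : T -> \bar R) : measurable D -> measurable_fun setT f ->
  \int[nu]_(x in D) f x = \int[m]_(x in D) (f x * (w x)%:E).
Proof.
move=> mD mf.
exact: (@transfer_integral _ _ _ _ _ nu m id w D (@measurable_id _ _ _) mw w0 mD).
Qed.

End density.

Section plane.
Context {R : realType}.

Lemma pt2_coord (z : R * R) : pt2 z 0 0 = z.1 /\ pt2 z 0 1 = z.2.
Proof. by rewrite /pt2 !mxE. Qed.

Lemma ball_pt2 (p : 'rV[R]_2) e (z : R * R) : 0 < e ->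
  ball p e (pt2 z) <-> `|p 0 0 - z.1| < e /\ `|p 0 1 - z.2| < e.
Proof.
have [z1 z2] := pt2_coord z.
move=> e0; split.
  by move=> [_ H]; rewrite -{1}z1 -z2; split; exact: H.
move=> [h1 h2]; split => // i j; rewrite ord1.
by case: (I2P j) => ->; rewrite /ball/= ?z1 ?z2.
Qed.

(** An open set is the union of the squares it contains with rational centre and half-side
    [n.+1%:R^-1]; these are countably many and measurable for the product structure. *)
Lemma open_pt2_measurable (U : set 'rV[R]_2) : open U -> measurable (@pt2 R @^-1` U).
Proof.
move=> oU.
pose box (i : rat * rat * nat) : set (R * R) :=
  `]ratr i.1.1 - i.2.+1%:R^-1, ratr i.1.1 + i.2.+1%:R^-1[%classic `*`
  `]ratr i.1.2 - i.2.+1%:R^-1, ratr i.1.2 + i.2.+1%:R^-1[%classic.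
have -> : @pt2 R @^-1` U = \bigcup_i (if `[< box i `<=` @pt2 R @^-1` U >] then box i else set0).
  apply/seteqP; split => [z Uz|z [i _]]; last by case: asboolP => // + bz; apply.
  have /nbhs_ballP[e /= e0 eU] : nbhs (pt2 z) U by exact: open_nbhs_nbhs.
  have [n ne] : exists n : nat, n.+1%:R^-1 < e / 2.
    have e2 : 0 < (e / 2)^-1 by rewrite invr_gt0 divr_gt0.
    exists (Num.truncn (e / 2)^-1).
    by rewrite -[ltRHS]invrK ltf_pV2 ?posrE ?ltr0n ?truncnS_gt.
  have n0 : 0 < n.+1%:R^-1 :> R by rewrite invr_gt0 ltr0n.
  have Q (x d : R) : 0 < d -> exists q, ratr q \in `]x - d, x + d[.
    by move=> d0; apply: rat_in_itvoo; lra.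
  have [q1 h1] := Q z.1 _ n0; have [q2 h2] := Q z.2 _ n0.
  exists (q1, q2, n) => //; move: h1 h2 n0 ne; rewrite !in_itv/=.
  have -> : box (q1, q2, n) = `]ratr q1 - n.+1%:R^-1, ratr q1 + n.+1%:R^-1[%classic `*`
    `]ratr q2 - n.+1%:R^-1, ratr q2 + n.+1%:R^-1[%classic by [].
  move: (_^-1) (ratr q1) (ratr q2) => d r1 r2 /andP[? ?] /andP[? ?] n0 ne.
  case: asboolP.
    by move=> _; split; rewrite /= in_itv/=; apply/andP; split; lra.
  case=> y; rewrite /= !in_itv/= => -[/andP[a b] /andP[c e']].
  apply: eU; apply/ball_pt2 => //; rewrite (pt2_coord z).1 (pt2_coord z).2.
  by split; rewrite ltr_norml; apply/andP; split; lra.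
apply: countable_bigcupT_measurable => // i; case: asboolP => // _.
by apply: measurableX.
Qed.

Lemma continuous_pt2_measurable (h : 'rV[R]_2 -> R) : continuous h ->
  measurable_fun setT (fun z => h (pt2 z)).
Proof.
move=> ch; apply: (measurability _ (RGenOInfty.measurableE R)) => _ [_ [x ->] <-].
rewrite setTI; apply: (@open_pt2_measurable (h @^-1` `]x, +oo[)).
by apply: open_comp => // y _; exact: ch.
Qed.

End plane.

Section surface_measure.
Context {R : realType} (M : surface R).

Lemma open_borel (A : set (borel M)) : @open M A -> measurable A.
Proof. by move=> oA; exact: sub_gen_smallest. Qed.

Lemma continuous_borel (f : M -> R) : (forall x, {for x, continuous f}) ->
  measurable_fun setT (f : borel M -> R).
Proof.
move=> cf; apply: (measurability _ (RGenOInfty.measurableE R)) => _ [_ [x ->] <-].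
rewrite setTI; apply: open_borel.
by apply: open_comp => // y _; exact: cf.
Qed.

(** The inverse chart made total: off the open image of [c] it takes a constant value, which keeps
    it measurable on the whole plane. *)
Definition cpar (c : chart R M) (z : R * R) : borel M :=
  if `[< cimg c (pt2 z) >] then cinv c (pt2 z) else point.

Lemma open_cimg (c : chart R M) (O : set M) : open O ->
  open [set p | cimg c p /\ O (cinv c p)].
Proof.
move=> oO; rewrite openE => p [cp Op]; rewrite /interior.
have n1 : \forall q \near p, cimg c q by apply: open_near => //; exact: cimg_open.
have n2 : \forall q \near p, O (cinv c q).
  by apply: (cinv_continuous cp); exact: open_nbhs_nbhs.
exact: filterI n1 n2.
Qed.

Lemma measurable_cpar (c : chart R M) : measurable_fun setT (cpar c).
Proof.
have key := @measurability _ _ _ (borel M) setT (cpar c) (@open M).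
apply: key => [//|_ [A oA <-]]; rewrite setTI.
have mC : measurable (@pt2 R @^-1` cimg c).
  by apply: open_pt2_measurable; exact: cimg_open.
have mO : measurable (@pt2 R @^-1` [set p | cimg c p /\ A (cinv c p)]).
  by apply: open_pt2_measurable; exact: open_cimg.
have -> : cpar c @^-1` A = (@pt2 R @^-1` [set p | cimg c p /\ A (cinv c p)])
   `|` (if `[< A point >] then ~` (@pt2 R @^-1` cimg c) else set0).
  apply/seteqP; split => z; rewrite /cpar /=.
    case: asboolP => cz Oz; first by left.
    by right; case: asboolP.
  move=> [[cz Oz]|]; first by case: asboolP.
  by case: asboolP => // Op ncz; case: asboolP.
apply: measurableU => //; case: asboolP => // _.
exact: measurableC.
Qed.

End surface_measure.

(** * Integrals of derivatives with compact support *)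

Section plane_integrals.
Context {R : realType}.
Local Notation V := 'rV[R]_2.
Local Notation mu := (@lebesgue_measure R).
Local Notation mu2 := (mu \x mu)%E.
Local Notation e_ i := (delta_mx 0 i : V).

Lemma integrable_compact_support (k : V -> R) (r : R) : continuous k ->
  (forall p i, k p != 0 -> `|p 0 i| <= r) ->
  mu2.-integrable setT (fun z => (k (pt2 z))%:E).
Proof.
move=> ck k0.
pose B : set (R * R) := `[- r, r]%classic `*` `[- r, r]%classic.
have mB : measurable B by exact: measurableX.
have -> : (fun z => (k (pt2 z))%:E) = (EFin \o (fun z => k (pt2 z))) \_ B.
  apply/funext => z; rewrite patchE; case: ifPn => //.
  rewrite notin_setE => nB /=; congr EFin; apply/eqP; apply: contra_notT nB => kz.
  have := k0 _ 0 kz; have := k0 _ 1 kz.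
  rewrite (pt2_coord z).1 (pt2_coord z).2 !ler_norml => h1 h2.
  by split => /=; rewrite in_itv.
apply: (@integrable_mkcond _ _ _ mu2 B _ mB).1.
apply: (@measurable_bounded_integrable _ _ _ mu2 (fun z => k (pt2 z)) B mB).
- have e : mu2 B = (mu `[(- r)%R, r]%classic * mu `[(- r)%R, r]%classic)%E.
    by apply: product_measure1E.
  suff: (mu2 B < +oo)%E by []; rewrite e.
  rewrite !lebesgue_measure_itv/=.
  by case: ifP => _; rewrite ?mul0e// -EFinM ltry.
- by apply: measurable_funTS; exact: continuous_pt2_measurable.
- pose P : set V := [set p | forall i, `[- r, r]%classic (p 0 i)].
  have cP : compact P.
    exact: (@rV_compact R 2 (fun=> `[- r, r]%classic) (fun=> @segment_compact R _ _)).
  have ckP : {within P, continuous k} by exact: continuous_subspaceT.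
  have [N [Nr HN]] := compact_bounded (continuous_compact ckP cP).
  exists N; split => // x Nx z [z1 z2]; apply: HN => //; exists (pt2 z) => //.
  by move=> i; case: (I2P i) => ->; rewrite ?(pt2_coord z).1 ?(pt2_coord z).2.
Qed.

Lemma integral_derive1_compact (k dk : R -> R) (r : R) :
  (forall x, is_derive x (1 : R) k (dk x)) -> continuous dk ->
  (forall x, k x != 0 -> `|x| < r) -> (forall x, dk x != 0 -> `|x| <= r) ->
  (\int[mu]_x (dk x)%:E = 0)%E.
Proof.
move=> hk cdk k0 dk0.
have [r0|r0] := ltP r 0.
  rewrite -(integral0 mu setT); apply: eq_integral => x _; congr EFin.
  by apply/eqP; apply: contraLR r0 => /dk0 xr; rewrite -leNgt (le_trans _ xr).
have kr x : r <= `|x| -> k x = 0.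
  by move=> rx; apply/eqP; apply: contraLR rx => /k0; rewrite -ltNge.
have ck x : {for x, continuous k}.
  by apply/differentiable_continuous/derivable1_diffP; case: (hk x).
(* The endpoints lie beyond the support, so [k] vanishes there; adding 1 keeps the interval
   nondegenerate when [r = 0]. *)
transitivity (\int[mu]_(x in `[(- (r + 1))%R, (r + 1)%R]) (dk x)%:E)%E.
  rewrite [RHS]integral_mkcond; apply: eq_integral => x _; rewrite patchE.
  case: ifPn => //; rewrite notin_setE /= in_itv /= => nx; congr EFin.
  apply/eqP; apply: contra_notT nx => /dk0.
  by rewrite ler_norml => /andP[? ?]; apply/andP; split; lra.
rewrite (@continuous_FTC2 _ dk k)//.
- rewrite !kr ?subee// ?normrN ger0_norm; lra.
- by lra.
- exact: continuous_subspaceT.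
- split.
  + by move=> x _; case: (hk x).
  + apply: cvg_at_right_filter; exact: ck.
  + apply: cvg_at_left_filter; exact: ck.
- by move=> x _; rewrite derive1E; exact: derive_val.
Qed.

Section derivative.
Variables (H : V -> R) (r : R).
Hypotheses (cH : forall p, C1near H p) (H0 : forall p i, H p != 0 -> `|p 0 i| < r).

Lemma derive_support u p i : 'D_u H p != 0 -> `|p 0 i| <= r.
Proof.
move=> d0; rewrite leNgt; apply/negP => rp; move/eqP: d0; apply.
have : \forall q \near p, H q = 0.
  have : \forall q \near p, r < `|(q : V) 0 i|.
    have c : {for p, continuous (fun q : V => `|q 0 i|)}.
      apply: (@continuous_comp _ _ _ (fun q : V => q 0 i) (fun x : R => `|x|)).
        exact: coord_continuous.
      exact: norm_continuous.
    exact: (cvgr_gt _ c _ rp).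
  apply: filterS => q rq; apply/eqP; apply: contraLR (ltW rq) => /H0.
  by rewrite -ltNge; exact.
by move=> h; rewrite (near_eq_derive u h) derive_cst.
Qed.

Lemma integrable_derive u :
  mu2.-integrable setT (fun z => ('D_u H (pt2 z))%:E).
Proof.
apply: (@integrable_compact_support ('D_u H) r) => [p|p i].
  exact: C1near_dcont (cH p).
exact: derive_support.
Qed.

Lemma derive_line (p u : V) (x : R) : is_derive x (1 : R)
  (fun x : R => H (p + x *: u)) ('D_u H (p + x *: u)).
Proof.
have dl : is_derive x (1 : R) (fun a : R => p + a *: u) u.
  apply: (is_derive_eq (derD (derC _ _ _) _)); last by rewrite add0r.
  apply: DeriveDef; first exact: diff_derivable.
  by rewrite deriveE// diff_val scale1r.
have dif : differentiable (fun a : R => p + a *: u) x by apply: differentiableD.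
apply: is_derive_eq (der_comp _ dif (C1near_diff (cH _))) _.
by rewrite (derive_val dl).
Qed.

Lemma continuous_line (p u : V) (k : V -> R) : continuous k ->
  continuous (fun x : R => k (p + x *: u)).
Proof.
move=> ck x; apply: (@continuous_comp _ _ _ (fun a : R => p + a *: u) k); last exact: ck.
by apply: differentiable_continuous; apply: differentiableD.
Qed.

Lemma pt2_line0 (x y : R) : pt2 (x, y) = y *: e_ 1 + x *: e_ 0.
Proof. by apply/rowP => i; rewrite !mxE; case: (I2P i) => -> /=; ring. Qed.

Lemma pt2_line1 (x y : R) : pt2 (x, y) = x *: e_ 0 + y *: e_ 1.
Proof. by apply/rowP => i; rewrite !mxE; case: (I2P i) => -> /=; ring. Qed.

(** Fubini's theorem is applied with the variable of differentiation innermost, where the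
    fundamental theorem of calculus gives 0 on every line. *)
Lemma integral_derive i : (\int[mu2]_z ('D_(e_ i) H (pt2 z))%:E = 0)%E.
Proof.
have cd : continuous ('D_(e_ i) H) by move=> p; exact: C1near_dcont (cH p).
have key (p u : V) (x : R) j : p 0 j = 0 -> u 0 j = 1 -> (p + x *: u) 0 j = x.
  by rewrite !mxE => -> ->; rewrite add0r mulr1.
have h j (p : V) : p 0 j = 0 ->
    (\int[mu]_x ('D_(e_ j) H (p + (x : R) *: e_ j))%:E = 0)%E.
  move=> p0; have e1 : e_ j 0 j = 1 by rewrite mxE !eqxx.
  have cdj : continuous ('D_(e_ j) H) by move=> q; exact: C1near_dcont (cH q).
  apply: (@integral_derive1_compact (fun x => H (p + x *: e_ j)) _ r).
  - by move=> x; exact: derive_line.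
  - exact: (@continuous_line p (e_ j) ('D_(e_ j) H) cdj).
  - by move=> x Hx; have := H0 j Hx; rewrite key.
  - by move=> x Hx; have := derive_support j Hx; rewrite key.
case: (I2P i) cd => -> cd.
- rewrite -integral21_prod_meas1; last exact: integrable_derive.
  rewrite -[RHS](integral0 mu setT); apply: eq_integral => y _.
  rewrite -(h 0 (y *: e_ 1)); last by rewrite !mxE mulr0.
  by apply: eq_integral => x _; rewrite pt2_line0.
- rewrite -integral12_prod_meas1; last exact: integrable_derive.
  rewrite -[RHS](integral0 mu setT); apply: eq_integral => x _.
  rewrite -(h 1 (x *: e_ 0)); last by rewrite !mxE mulr0.
  by apply: eq_integral => y _; rewrite pt2_line1.
Qed.

End derivative.
End plane_integrals.

(** * Stokes' theorem in the plane *)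

Section stokes.
Context {R : realType}.
Local Notation V := 'rV[R]_2.
Local Notation mu := (@lebesgue_measure R).
Local Notation mu2 := (mu \x mu)%E.
Local Notation e_ i := (delta_mx 0 i : V).

(** The coefficient of the 2-form [df /\ dg]. *)
Definition jacob (f g : V -> R) p : R :=
  partial 0 f p * partial 1 g p - partial 1 f p * partial 0 g p.

(** [dh /\ dm] is the differential of [h dm], whose coefficients are the [H i]; the second
    derivatives of [m] cancel by symmetry. As [U] and the complement of the closed set [L] cover the
    plane, each [H i] is C^1 everywhere, with bounded support. *)
Lemma stokes_plane (U L : set V) (h m : V -> R) (r : R) :
  open U -> closed L -> L `<=` U -> (forall p i, L p -> `|p 0 i| < r) ->
  (forall p, U p -> C1near h p) -> (forall p, ~ L p -> h p = 0) -> Ck 2 U m ->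
  (\int[mu2]_z (jacob h m (pt2 z))%:E = 0)%E.
Proof.
move=> oU cL LU Lr ch h0 cm.
have near0 p : ~ L p -> \forall q \near p, h q = 0.
  move=> nLp; have : \forall q \near p, ~ L q.
    by apply: (open_near (U := ~` L)) => //; exact: closed_openC.
  by apply: filterS => q; exact: h0.
pose H i q := h q * partial i m q.
have cH i p : C1near (H i) p.
  have [Lp|nLp] := pselect (L p).
    apply: C1nearM; first exact/ch/LU.
    by apply: Ck_C1near oU _ (LU _ Lp); exact: cm.2.
  apply: C1near_eq (C1near_cst (0 : R) p).
  by apply: filterS (near0 p nLp) => q; rewrite /H => ->; rewrite mul0r.
have H0 j p i : H j p != 0 -> `|p 0 i| < r.
  move=> Hp; apply: Lr; apply: contrapT => /h0 hp.
  by move: Hp; rewrite /H hp mul0r eqxx.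
have E p : jacob h m p = 'D_(e_ 0) (H 1) p - 'D_(e_ 1) (H 0) p.
  have [Lp|nLp] := pselect (L p); last first.
    have n0 := near0 p nLp.
    have n1 j : \forall q \near p, H j q = 0.
      by apply: filterS n0 => q; rewrite /H => ->; rewrite mul0r.
    rewrite /jacob /partial (near_eq_derive _ n0) (near_eq_derive _ n0).
    rewrite (near_eq_derive _ (n1 0)) (near_eq_derive _ (n1 1)) !derive_cst.
    by rewrite !mul0r.
  have dh u := derivable_diff u (C1near_diff (ch p (LU p Lp))).
  have dm u i : is_derive p u (fun q => partial i m q) ('D_u ('D_(e_ i) m) p).
    apply: derivable_diff; apply: (Ck_diff (k := 0) _ (LU p Lp)); exact: cm.2.
  rewrite (derive_val (derM (dh (e_ 0)) (dm (e_ 0) 1))).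
  rewrite (derive_val (derM (dh (e_ 1)) (dm (e_ 1) 0))).
  have := Ck2_swap (e_ 0) (e_ 1) oU cm (LU p Lp) => ->.
  rewrite /jacob -/(partial 0 h p) -/(partial 1 h p).
  set d := 'D__ ('D__ m) p; move: (partial _ _ _ * _) (partial _ _ _ * _) => a b.
  by rewrite opprD addrACA subrr addr0.
under eq_integral do rewrite E EFinB.
have i1 i j := integrable_derive (cH i) (H0 i) (e_ j).
rewrite integralB//.
have I0 := integral_derive (cH 1) (H0 1) 0.
have I1 := integral_derive (cH 0) (H0 0) 1.
exact: etrans (f_equal2 (fun a b : \bar R => a - b)%E I0 I1) (sube0 _).
Qed.

End stokes.

(** * Surfaces *)

Section gram_schmidt.
Context {R : realType}.
Implicit Types G : 'M[R]_2.

Lemma exists_frame G : spd G -> exists E, orthonormal_frame G E.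
Proof.
move=> sG; have s := spd_sym sG; have d := spd_det sG.
have G00 : 0 < G 0 0.
  have e0 : (delta_mx 0 0 : 'rV[R]_2) != 0 by apply: rV2_neq0; rewrite mxE oner_neq0.
  by have := sG.2 _ e0; rewrite ipE !mxE/= !mul1r !mul0r !mulr1 !mulr0 !addr0.
(* The Gram-Schmidt partner of the first basis vector, before normalisation; its squared length is
   [G 0 0 * \det G]. *)
pose w : 'rV[R]_2 := \row_j (if j == 0 then - G 0 1 else G 0 0).
pose E (a : 'I_2) : 'rV[R]_2 := if a == 0 then (Num.sqrt (G 0 0))^-1 *: delta_mx 0 0
  else (Num.sqrt (G 0 0 * \det G))^-1 *: w.
have q0 : Num.sqrt (G 0 0) != 0 by rewrite gt_eqF// sqrtr_gt0.
have q1 : Num.sqrt (G 0 0 * \det G) != 0 by rewrite gt_eqF// sqrtr_gt0 mulr_gt0.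
have Q0 : G 0 0 = Num.sqrt (G 0 0) ^+ 2 by rewrite sqr_sqrtr// ltW.
have Q1 : G 0 0 * \det G = Num.sqrt (G 0 0 * \det G) ^+ 2.
  by rewrite sqr_sqrtr// ltW// mulr_gt0.
have ww : ip G w w = G 0 0 * \det G.
  by rewrite ipE !mxE/= det2E s; ring.
have ew : ip G (delta_mx 0 0) w = 0 by rewrite ipE !mxE/= ; ring.
have we : ip G w (delta_mx 0 0) = 0 by rewrite ipC ?sG.1.
have ee : ip G (delta_mx 0 0) (delta_mx 0 0) = G 0 0 by rewrite ipE !mxE/=; ring.
exists E => a b; rewrite /E; case: (I2P a) => ->; case: (I2P b) => -> /=;
  rewrite ipZl ipZr ?ee ?ew ?we ?ww ?mulr0//.
- by rewrite [X in _ * (_ * X)]Q0; field.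
- by rewrite [X in _ * (_ * X)]Q1; field.
Qed.

Lemma line_neq0_scale (v w : 'rV[R]_2) : line v w -> w != 0 -> exists2 a, a != 0 & w = a *: v.
Proof.
move=> [a _ <-] w0; exists a => //.
by apply: contra w0 => /eqP ->; rewrite scale0r.
Qed.

Lemma line_wdg (v w z : 'rV[R]_2) : line v w -> line v z -> wdg w z = 0.
Proof. by move=> [a _ <-] [b _ <-]; rewrite wdgZl wdgZr wdgxx !mulr0. Qed.

End gram_schmidt.

(** * Charts, and the vertical norm read in a chart *)

Section charts.
Context {R : realType} (M : surface R).
Implicit Types (c : chart R M) (x y : M).
Local Notation V := 'rV[R]_2.

Lemma cimg_map c x : cdom c x -> cimg c (c x).
Proof. by move=> cx; exists x. Qed.

Lemma cimgP c p : cimg c p -> cdom c (cinv c p) /\ c (cinv c p) = p.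
Proof. by move=> [x cx <-]; rewrite cmapK. Qed.

Lemma near_cimg c x : cdom c x -> \forall p \near c x, cimg c p.
Proof. by move=> cx; apply: open_near; [exact: cimg_open|exact: cimg_map]. Qed.

Lemma near_cinv c x (P : M -> Prop) : cdom c x -> (\forall y \near x, P y) ->
  \forall p \near c x, P (cinv c p).
Proof.
move=> cx nP; have := cinv_continuous (cimg_map cx).
by move=> /(_ P); rewrite cmapK//; apply.
Qed.

Lemma near_cmap c x (Q : V -> Prop) : cdom c x -> (\forall p \near c x, Q p) ->
  \forall y \near x, Q (c y).
Proof. by move=> cx; exact: cmap_continuous. Qed.

Lemma near_cdom c x : cdom c x -> \forall y \near x, cdom c y.
Proof. by move=> cx; apply: open_near => //; exact: cdom_open. Qed.

Definition overlap c c' : set V := c @` (cdom c `&` cdom c').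

Lemma open_overlap c c' : open (overlap c c').
Proof.
have -> : overlap c c' = [set p | cimg c p /\ cdom c' (cinv c p)].
  apply/seteqP; split => [p [x [cx c'x] <-]|p [cp c'p]].
    by split; [exact: cimg_map|rewrite cmapK].
  by exists (cinv c p); [split => //; exact: (cimgP cp).1|exact: (cimgP cp).2].
by apply: open_cimg; exact: cdom_open.
Qed.

Lemma transition_map c c' x : cdom c x -> transition c c' (c x) = c' x.
Proof. by move=> cx; rewrite /transition cmapK. Qed.

Lemma near_overlap c c' x : cdom c x -> cdom c' x ->
  \forall p \near c x, [/\ cimg c p, cdom c (cinv c p), cdom c' (cinv c p),
     c (cinv c p) = p & cinv c' (transition c c' p) = cinv c p].
Proof.
move=> cx c'x; apply: filterS2 (near_cimg cx) (near_cinv cx (near_cdom c'x)).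
move=> p cp c'p; have [d e] := cimgP cp.
by split => //; rewrite /transition cmapK.
Qed.

Variable (g : metric_field M).
Hypothesis hg : riemannian g.

Definition gram c (p : V) : 'M[R]_2 := g c (cinv c p).

Lemma gram_map c x : cdom c x -> gram c (c x) = g c x.
Proof. by move=> cx; rewrite /gram cmapK. Qed.

Lemma gram_spd c x : atlas c -> cdom c x -> spd (g c x).
Proof. by case: hg => s pos _ _ ac cx; split; [exact: s|move=> u; exact: pos]. Qed.

Lemma gram_metric_near c x : atlas c -> cdom c x -> metric_near (gram c) (c x).
Proof.
move=> ac cx; split.
  apply: filterS (near_cimg cx) => p cp; apply: gram_spd => //.
  exact: (cimgP cp).1.
move=> i j; have H : Ck 1 (cimg c) (fun p => g c (cinv c p) i j).
  by case: hg => _ _ /(_ c i j ac) H _; exact: (H 1%N).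
exact: (@Ck_C1near _ _ _ (cimg c) _ _ (@cimg_open _ _ c) H (cimg_map cx)).
Qed.

Lemma transition_smooth c c' k : atlas c -> atlas c' -> Ck k (overlap c c') (transition c c').
Proof. by move=> ac ac'; exact: atlas_smooth. Qed.

Lemma overlap_map c c' x : cdom c x -> cdom c' x -> overlap c c' (c x).
Proof. by move=> cx c'x; exists x. Qed.

Lemma gram_isometry c c' x : atlas c -> atlas c' -> cdom c x -> cdom c' x ->
  \forall q \near c x, forall v w, ip (gram c q) v w =
    ip (gram c' (transition c c' q)) ('D_v (transition c c') q)
       ('D_w (transition c c') q).
Proof.
move=> ac ac' cx c'x; apply: filterS (near_overlap cx c'x).
move=> q [cq dq d'q e e'] v w; rewrite /gram e'.
case: hg => _ _ _ /(_ c c' (cinv c q) v w ac ac' dq d'q) ->.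
by rewrite /dtransition e.
Qed.

Section vertical_norm.
Variable (s : subspace_field M).
Hypothesis hs : line_field s.

Lemma line_field_line c x : atlas c -> cdom c x ->
  exists2 v, v != 0 & s c x = line v.
Proof.
move=> ac cx; have [U [X [oU Ux UC _ H]]] := hs.2 c x ac cx.
by have [v0 e] := H _ Ux; exists (X (c x)) => //; rewrite -e cmapK.
Qed.

Lemma local_section_C1near c x X : local_section s c x X -> C1near X (c x).
Proof. by move=> [U [oU Ux _ sX _]]; exact: Ck_C1near oU (sX 1%N) Ux. Qed.

Lemma local_section_near c x X : local_section s c x X ->
  \forall p \near c x, s c (cinv c p) (X p).
Proof. by move=> [U [oU Ux _ _ H]]; apply: filterS (open_near oU Ux) => p /H. Qed.

Definition cometric_conn c (X : V -> V) p : R :=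
  cometric (gram c p) (conn (gram c) X p (delta_mx 0 0))
    (conn (gram c) X p (delta_mx 0 1)).

(** The differential of the transition map is isometric, so it carries an orthonormal frame to one;
    the sums of squares over the two frames then agree term by term by [conn_chart_sq]. *)
Lemma cometric_conn_chart c c' x X X' : atlas c -> atlas c' ->
  cdom c x -> cdom c' x -> local_section s c x X -> local_section s c' x X' ->
  X (c x) != 0 -> X' (c' x) != 0 ->
  cometric_conn c X (c x) = cometric_conn c' X' (c' x).
Proof.
move=> ac ac' cx c'x lX lX' X0 X'0; pose T := transition c c'.
have Tx : T (c x) = c' x by exact: transition_map.
have mG := gram_metric_near ac cx; have mG' := gram_metric_near ac' c'x.
have cX := local_section_C1near lX; have cX' := local_section_C1near lX'.
have [E oE] := exists_frame (nbhs_singleton mG.1).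
have iso := gram_isometry ac ac' cx c'x.
have oE' : orthonormal_frame (gram c' (c' x)) (fun a => 'D_(E a) T (c x)).
  have i0 := nbhs_singleton iso; rewrite -/T Tx in i0.
  by move=> a b; exact: etrans (esym (i0 (E a) (E b))) (oE a b).
rewrite /cometric_conn -(sum_conn_frame mG (C1near_diff cX) oE).
rewrite -(sum_conn_frame mG' (C1near_diff cX') oE').
have sT : Ck 2 (overlap c c') T by exact: transition_smooth.
(* Coherence puts the image of [X q] and the vector [X' (T q)] on the same line. *)
have par : \forall q \near c x, wdg ('D_(X q) T q) (X' (T q)) = 0.
  have n1 := local_section_near lX.
  have cT : {for c x, continuous T}.
    exact: Ck_cont sT (overlap_map cx c'x).
  have n2 : \forall q \near c x, s c' (cinv c' (T q)) (X' (T q)).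
    by have l := local_section_near lX'; rewrite -Tx in l; exact: (cT _ l).
  apply: filterS3 (near_overlap cx c'x) n1 n2 => q [cq dq d'q e e'] s1 s2.
  have [v v0 sv] := line_field_line ac' d'q.
  have s1' : s c' (cinv c q) ('D_(X q) T q).
    rewrite (hs.1 c c' _ ac ac' dq d'q); exists (X q) => //.
    by rewrite /dtransition e.
  by rewrite e' sv in s2; rewrite sv in s1'; exact: line_wdg s1' s2.
apply: eq_bigr => a _; apply: esym; rewrite -Tx in mG' cX' X'0 *.
exact: (conn_chart_sq mG mG' (@open_overlap c c') (overlap_map cx c'x) sT iso _ cX cX' X0 X'0 par).
Qed.

Lemma local_section_scale c x X a : local_section s c x X ->
  atlas c -> local_section s c x (fun p => a *: X p).
Proof.
move=> [U [oU Ux UC sX H]] ac; exists U; split => //.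
  by move=> k; apply: CkZ.
move=> p Up; have [dp _] := cimgP (UC _ Up).
have [v v0 e] := line_field_line ac dp.
by have := H p Up; rewrite e => -[b _ <-]; exists (a * b) => //; rewrite scalerA.
Qed.

(** All admissible choices in the definition give the same value, so [xget] returns it as soon as
    one choice exists. *)
Lemma vertical_norm2E c x X : atlas c -> cdom c x -> local_section s c x X ->
  X (c x) != 0 -> vertical_norm2 g s x = cometric_conn c X (c x).
Proof.
move=> ac cx lX X0.
have sG := gram_spd ac cx.
have all1 c' X' E : atlas c' -> cdom c' x -> local_section s c' x X' ->
    ip (g c' x) (X' (c' x)) (X' (c' x)) = 1 -> orthonormal_frame (g c' x) E ->
    \sum_(a < 2) ip (g c' x) (perp (g c' x) (X' (c' x)) (covD (gram c') X' (c' x) (E a)))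
      (perp (g c' x) (X' (c' x)) (covD (gram c') X' (c' x) (E a)))
    = cometric_conn c X (c x).
  move=> ac' c'x lX' X1 oE.
  have X'0 : X' (c' x) != 0.
    by apply/eqP => e; move/eqP: X1; rewrite e ip0l eq_sym oner_eq0.
  rewrite (cometric_conn_chart ac ac' cx c'x lX lX' X0 X'0).
  have mG' := gram_metric_near ac' c'x.
  rewrite -(gram_map c'x) in X1 oE *.
  rewrite /cometric_conn -(sum_conn_frame mG' (C1near_diff (local_section_C1near lX')) oE).
  by apply: eq_bigr => a _; exact: (conn_sq_norm mG' (E a) X1).
apply: xget_unique => [|r]; last first.
  move=> [c' [X' [E [[ac' c'x] lX' X1 oE ->]]]]; exact: all1.
have [E oE] := exists_frame sG.
pose n := ip (g c x) (X (c x)) (X (c x)).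
have n0 : 0 < n by exact: sG.2.
(* Unit length is prescribed at [x] only, so rescaling by a constant is enough and keeps the section
   smooth. *)
exists c, (fun p => (Num.sqrt n)^-1 *: X p), E; split => //.
- exact: local_section_scale.
- rewrite ipZl ipZr -/n -[X in _ * (_ * X) = _](sqr_sqrtr (ltW n0)).
  by field; rewrite gt_eqF// sqrtr_gt0.
apply/esym; apply: all1 => //.
- exact: local_section_scale.
- rewrite ipZl ipZr -/n -[X in _ * (_ * X) = _](sqr_sqrtr (ltW n0)).
  by field; rewrite gt_eqF// sqrtr_gt0.
Qed.

(** A single [X] serves all points near [x], which is what continuity of the norm and
    differentiation of the angle require. *)
Lemma line_field_section c x : atlas c -> cdom c x -> exists X,
  \forall y \near x, [/\ cdom c y, local_section s c y X, X (c y) != 0 &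
    s c y = line (X (c y))].
Proof.
move=> ac cx; have [U [X [oU Ux UC sX H]]] := hs.2 c x ac cx.
exists X; apply: filterS2 (near_cdom cx) (near_cmap cx (open_near oU Ux)) => y cy Uy.
have [X0 e] := H _ Uy; split => //.
  by exists U; split => // p Up; have [_ ->] := H p Up; exists 1; rewrite ?scale1r.
by rewrite -e cmapK.
Qed.

End vertical_norm.
End charts.

(** * Continuity of the vertical norm *)

Section continuity_rules.
Context {R : realType} (T : topologicalType).
Implicit Types (p : T) (f h : T -> R).
Local Notation cont p f := {for p, continuous f}.

Lemma contD p f h : cont p f -> cont p h -> cont p (fun q => f q + h q).
Proof. by move=> cf ch; exact: cvgD cf ch. Qed.

Lemma contM p f h : cont p f -> cont p h -> cont p (fun q => f q * h q).
Proof. by move=> cf ch; exact: cvgM cf ch. Qed.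

Lemma contN p f : cont p f -> cont p (fun q => - f q).
Proof. by move=> cf; exact: cvgN cf. Qed.

Lemma contV p f : cont p f -> f p != 0 -> cont p (fun q => (f q)^-1).
Proof. by move=> cf f0; exact: cvgV f0 cf. Qed.

Lemma contC p (a : R) : cont p (fun=> a).
Proof. exact: (@cst_continuous T R a p). Qed.

End continuity_rules.

Section continuity.
Context {R : realType}.
Local Notation V := 'rV[R]_2.
Implicit Types (G : V -> 'M[R]_2) (X : V -> V) (p u : V) (f h : V -> R).
Local Notation cont p f := {for p, continuous f}.

(** Addition in ['I_2] is modulo 2, so [k + 1] is the other index. *)
Lemma invmx2 (A : 'M[R]_2) k l : A \in unitmx ->
  invmx A k l = (\det A)^-1 * (if k == l then A (k + 1) (k + 1) else - A k l).
Proof.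
move=> uA; rewrite /invmx uA !mxE; congr (_ * _).
have l0 : lift (0 : 'I_2) (0 : 'I_1) = 1 :> 'I_2 by exact/val_inj.
have l1 : lift (1 : 'I_2) (0 : 'I_1) = 0 :> 'I_2 by exact/val_inj.
have e11 : 1 + 1 = 0 :> 'I_2 by exact/val_inj.
rewrite /cofactor det_mx11 !mxE.
by case: (I2P k) => ->; case: (I2P l) => ->; rewrite ?l0 ?l1 ?e11 ?add0r /=; ring.
Qed.

Lemma christoffel_continuous G p k i j : metric_near G p ->
  cont p (fun q => christoffel G q k i j).
Proof.
move=> mG.
have ce a b : cont p (fun q => G q a b) := C1near_cont (mG.2 a b).
have cd : cont p (fun q => \det (G q)) := C1near_cont (C1near_det mG).
have ci a b : cont p (fun q => invmx (G q) a b).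
  apply: (near_eq_continuous (f := fun q => (\det (G q))^-1 *
    (if a == b then G q (a + 1) (a + 1) else - G q a b))).
    by apply: filterS mG.1 => q sq; rewrite invmx2// spd_unit.
  apply: contM; first exact: contV cd (lt0r_neq0 (spd_det (nbhs_singleton mG.1))).
  by case: (a == b); [exact: ce|exact: contN (ce _ _)].
have cp l a b : cont p (partial l (fun q => G q a b)) := C1near_dcont (mG.2 a b).
have -> : (fun q => christoffel G q k i j) = fun q => 2^-1 *
  (invmx (G q) k 0 * (partial i (fun q => G q j 0) q + partial j (fun q => G q i 0) q
     - partial 0 (fun q => G q i j) q)
  + invmx (G q) k 1 * (partial i (fun q => G q j 1) q + partial j (fun q => G q i 1) q
     - partial 1 (fun q => G q i j) q)).
  by apply/funext => q; rewrite /christoffel; congr (_ * _); rewrite sum2.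
have t l := contM (ci k l) (contD (contD (cp i j l) (cp j i l)) (contN (cp l i j))).
exact: contM (@contC _ _ _ _) (contD (t 0) (t 1)).
Qed.

Lemma cont_coord (T : topologicalType) (X : T -> V) (p : T) i :
  {for p, continuous X} -> {for p, continuous (fun q => X q 0 i)}.
Proof.
move=> cX; apply: (@continuous_comp _ _ _ X (fun A => A 0 i)) => //.
exact: coord_continuous.
Qed.

Lemma conn_continuous G X p u : metric_near G p -> C1near X p -> X p != 0 ->
  cont p (fun q => conn G X q u).
Proof.
move=> mG cX X0.
have cx i : cont p (fun q => X q 0 i) := cont_coord (i := i) (C1near_cont cX).
have cdx i : cont p (fun q => 'D_u X q 0 i) := cont_coord (i := i) (C1near_dcont (v := u) cX).
have cch k : cont p (fun q => chr G q u (X q) 0 k).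
  have -> : (fun q => chr G q u (X q) 0 k) = fun q =>
    christoffel G q k 0 0 * u 0 0 * X q 0 0 + christoffel G q k 0 1 * u 0 0 * X q 0 1
  + (christoffel G q k 1 0 * u 0 1 * X q 0 0 + christoffel G q k 1 1 * u 0 1 * X q 0 1).
    by apply/funext => q; exact: chrE.
  have t i j := contM (contM (@christoffel_continuous G p k i j mG) (@contC _ _ p (u 0 i))) (cx j).
  exact: contD (contD (t _ _) (t _ _)) (contD (t _ _) (t _ _)).
have cw : cont p (fun q => wdg (X q) (covD G X q u)).
  have -> : (fun q => wdg (X q) (covD G X q u)) = fun q =>
    X q 0 0 * ('D_u X q 0 1 + chr G q u (X q) 0 1)
    + - (X q 0 1 * ('D_u X q 0 0 + chr G q u (X q) 0 0)).
    by apply/funext => q; rewrite covDE /wdg [in LHS]mxE [X in _ - _ * X]mxE.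
  have t i j := contM (cx i) (contD (cdx j) (cch j)).
  exact: contD (t _ _) (contN (t _ _)).
have cs : cont p (fun q => Num.sqrt (\det (G q))).
  exact: C1near_cont (C1near_sqrt (C1near_det mG) (spd_det (nbhs_singleton mG.1))).
apply: contM; first exact: contM cs cw.
apply: contV; first exact: C1near_cont (C1near_ip mG cX cX).
by rewrite gt_eqF//; apply: (nbhs_singleton mG.1).2.
Qed.

Lemma cometric_continuous G (b0 b1 : V -> R) p : metric_near G p ->
  cont p b0 -> cont p b1 -> cont p (fun q => cometric (G q) (b0 q) (b1 q)).
Proof.
move=> mG c0 c1.
have ce a b : cont p (fun q => G q a b) := C1near_cont (mG.2 a b).
have cd : cont p (fun q => \det (G q)) := C1near_cont (C1near_det mG).
have cV := contV cd (lt0r_neq0 (spd_det (nbhs_singleton mG.1))).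
have -> : (fun q => cometric (G q) (b0 q) (b1 q)) = fun q =>
  (G q 1 1 * (b0 q * b0 q) + - (2 * G q 0 1 * b0 q * b1 q) + G q 0 0 * (b1 q * b1 q))
  * (\det (G q))^-1.
  by apply/funext => q; rewrite /cometric !expr2.
apply: contM cV; apply: contD; last exact: contM (ce _ _) (contM c1 c1).
apply: contD; first exact: contM (ce _ _) (contM c0 c0).
exact: contN (contM (contM (contM (@contC _ _ _ _) (ce _ _)) c0) c1).
Qed.

End continuity.

Section surface_continuity.
Context {R : realType} (M : surface R).
Implicit Types (c : chart R M) (x y : M).
Local Notation V := 'rV[R]_2.

Lemma continuous_chart c x (F : V -> R) (f : M -> R) : cdom c x ->
  {for c x, continuous F} -> (\forall y \near x, f y = F (c y)) ->
  {for x, continuous f}.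
Proof.
move=> cx cF fF.
have h : {for x, continuous (fun y => F (c y))}.
  by apply: (@continuous_comp _ _ _ c F) => //; exact: cmap_continuous.
rewrite /prop_for /continuous_at (nbhs_singleton fF).
apply: cvg_trans h; apply: near_eq_cvg.
by apply: filterS fF => y ->.
Qed.

Lemma vertical_norm2_continuous (g : metric_field M) (s : subspace_field M) x :
  riemannian g -> line_field s -> {for x, continuous (vertical_norm2 g s)}.
Proof.
move=> hg hs; have [c ac cx] := atlas_cover x.
have [X HX] := line_field_section hs ac cx.
have [_ lX X0 _] := nbhs_singleton HX.
have mG := gram_metric_near hg ac cx; have cX := local_section_C1near lX.
apply: (@continuous_chart c x (cometric_conn g c X)) => //.
  by apply: cometric_continuous => //; exact: conn_continuous.
by apply: filterS HX => y [cy lY Y0 _]; exact: vertical_norm2E.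
Qed.

Definition C1M (f : M -> R) := forall c x, atlas c -> cdom c x ->
  C1near (fun p => f (cinv c p)) (c x).

Lemma C1M_continuous f x : C1M f -> {for x, continuous f}.
Proof.
move=> cf; have [c ac cx] := atlas_cover x.
apply: (continuous_chart cx (C1near_cont (cf c x ac cx))).
by apply: filterS (near_cdom cx) => y cy; rewrite cmapK.
Qed.

Lemma smooth_function_Ck (mu : M -> R) c k : smooth_function mu -> atlas c ->
  Ck k (cimg c) (fun p => mu (cinv c p)).
Proof. by move=> hmu ac; exact: hmu. Qed.

Lemma smooth_function_C1M (mu : M -> R) : smooth_function mu -> C1M mu.
Proof.
move=> hmu c x ac cx.
exact: (@Ck_C1near _ _ _ (cimg c) _ _ (@cimg_open _ _ c) (hmu c ac 1%N) (cimg_map cx)).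
Qed.

Lemma conformal_riemannian (g : metric_field M) (mu : M -> R) :
  riemannian g -> smooth_function mu -> riemannian (conformal mu g).
Proof.
move=> [sg pg kg ig] hmu; split.
- by move=> c x ac cx; rewrite /conformal linearZ/= sg.
- by move=> c x u ac cx u0; rewrite /conformal ip_scale mulr_gt0 ?expR_gt0 ?pg.
- move=> c i j ac k.
  have oC : open (cimg c) := @cimg_open _ _ c.
  have -> : (fun p => conformal mu g c (cinv c p) i j) =
      fun p => expR (2 * mu (cinv c p)) * g c (cinv c p) i j.
    by apply/funext => p; rewrite mxE.
  apply: (CkM oC _ (kg c i j ac k)); apply: (Ck_exp oC).
  exact: (CkM oC (Ck_cst _ _ _) (hmu c ac k)).
- move=> c c' x u v ac ac' cx c'x.
  by rewrite /conformal !ip_scale (ig c c' x u v).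
Qed.

Lemma variation_line_field K (s : subspace_field M) eps st t :
  compact_variation K s eps st -> `|t| < eps -> line_field (st t).
Proof.
move=> [coh sm _ _] te; split; first exact: coh.
move=> c x ac cx; have [U [X [oU Ux UC sX H]]] := sm c t x ac te cx.
exists [set p | U (t, p)], (fun p => X (t, p)); split => //.
- apply: (@open_comp _ _ (fun p : V => (t, p))) => // y _.
  apply: differentiable_continuous.
  apply: (@differentiable_pair _ _ _ _ (fun=> t) id); first exact: differentiable_cst.
  exact: ex_diff.
- by move=> p Up; exact: (UC (t, p)).
- by move=> k; exact: Ck_slice.
- by move=> p Up; exact: (H (t, p)).
Qed.

End surface_continuity.

(** * The angle between two line fields *)

Section angle.
Context {R : realType} (M : surface R).
Implicit Types (c : chart R M) (x y : M).
Local Notation V := 'rV[R]_2.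
Variable (g : metric_field M).
Hypothesis hg : riemannian g.

(** A nonzero vector of the line obtained by choice, with no regularity in the base point; the angle
    does not depend on it. *)
Definition direction (l : set V) : V := xget 0 [set v | l v /\ v != 0].

Lemma directionP v : v != 0 -> exists2 a, a != 0 & direction (line v) = a *: v.
Proof.
move=> v0; have [] := @xgetI _ 0 [set w | line v w /\ w != 0] v.
  by split => //; exists 1 => //; rewrite scale1r.
by move=> l n; exact: line_neq0_scale.
Qed.

(* The oriented angle from [s] to [s'] in the chart [c], modulo pi; it changes
   sign with the orientation of the chart. *)
Definition angle (s s' : subspace_field M) c x : R :=
  let v := direction (s c x) in let w := direction (s' c x) in
  atan (Num.sqrt (\det (g c x)) * wdg v w / ip (g c x) v w).

Lemma angleE s s' c x v w : v != 0 -> w != 0 -> s c x = line v -> s' c x = line w ->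
  angle s s' c x = atan (Num.sqrt (\det (g c x)) * wdg v w / ip (g c x) v w).
Proof.
move=> v0 w0 sv sw; rewrite /angle sv sw.
have [a a0 ->] := directionP v0; have [b b0 ->] := directionP w0.
rewrite wdgZl wdgZr ipZl ipZr; congr atan.
(* For orthogonal lines both quotients are 0, by the convention for the inverse of 0. *)
have [->|n0] := eqVneq (ip (g c x) v w) 0; first by rewrite !mulr0 !invr0 !mulr0.
by field; rewrite n0 a0 b0.
Qed.

Lemma sqrt_det_chart c c' x : atlas c -> atlas c' -> cdom c x -> cdom c' x ->
  Num.sqrt (\det (g c x)) =
  Num.sqrt (\det (g c' x)) * `|jdet (transition c c') (c x)|.
Proof.
move=> ac ac' cx c'x; have mG := gram_metric_near hg ac cx.
have mG' := gram_metric_near hg ac' c'x.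
rewrite -(transition_map c' cx) in mG'.
have := det_chart mG mG' (gram_isometry hg ac ac' cx c'x).
rewrite (transition_map c' cx) !gram_map// => ->.
by rewrite sqrtrM ?sqrtr_sqr// ltW// spd_det//; exact: gram_spd.
Qed.

Lemma chart_jdet_neq0 c c' x : atlas c -> atlas c' -> cdom c x -> cdom c' x ->
  jdet (transition c c') (c x) != 0.
Proof.
move=> ac ac' cx c'x; have mG := gram_metric_near hg ac cx.
have mG' := gram_metric_near hg ac' c'x.
rewrite -(transition_map c' cx) in mG'.
exact: jdet_neq0 mG mG' (gram_isometry hg ac ac' cx c'x).
Qed.

Lemma transition_diff c c' x : atlas c -> atlas c' -> cdom c x -> cdom c' x ->
  differentiable (transition c c') (c x).
Proof.
move=> ac ac' cx c'x.
exact: (Ck_diff (transition_smooth 1 ac ac') (overlap_map cx c'x)).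
Qed.

Lemma atan_sg (j t : R) : j != 0 -> atan (Num.sg j * t) = Num.sg j * atan t.
Proof.
move=> j0; case: (ltgtP j 0) j0 => [j0|j0|->]; rewrite ?eqxx// => _.
  by rewrite ltr0_sg// !mulN1r atanN.
by rewrite gtr0_sg// !mul1r.
Qed.

Lemma coherent_line s c c' x v : coherent s -> atlas c -> atlas c' -> cdom c x -> cdom c' x ->
  s c x = line v -> s c' x = line ('D_v (transition c c') (c x)).
Proof.
move=> coh ac ac' cx c'x sv; rewrite (coh c c' x ac ac' cx c'x) sv.
have dT := transition_diff ac ac' cx c'x.
have D a : 'D_(a *: v) (transition c c') (c x) = a *: 'D_v (transition c c') (c x).
  by rewrite !deriveE// linearZ.
rewrite /dtransition; apply/seteqP; split => w.
  by move=> [_ [a _ <-] <-]; exists a => //; rewrite D.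
by move=> [a _ <-]; exists (a *: v); [exists a|rewrite D].
Qed.

(** The determinant of the pair is multiplied by the Jacobian, the volume density divided by its
    absolute value, and the inner product kept: only the sign remains, and [atan] is odd. *)
Lemma angle_chart s s' c c' x : line_field s -> line_field s' ->
  atlas c -> atlas c' -> cdom c x -> cdom c' x ->
  angle s s' c' x = Num.sg (jdet (transition c c') (c x)) * angle s s' c x.
Proof.
move=> hs hs' ac ac' cx c'x; set T := transition c c'.
have [v v0 sv] := line_field_line hs ac cx.
have [w w0 sw] := line_field_line hs' ac cx.
have mG := gram_metric_near hg ac cx.
have mG' := gram_metric_near hg ac' c'x.
rewrite -(transition_map c' cx) in mG'.
have iso := gram_isometry hg ac ac' cx c'x.
have dT := transition_diff ac ac' cx c'x.
have j0 := chart_jdet_neq0 ac ac' cx c'x.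
have v0' := dT_neq0 mG iso v0.
have w0' := dT_neq0 mG iso w0.
rewrite (angleE v0 w0 sv sw) -atan_sg//.
rewrite (angleE v0' w0' (coherent_line hs.1 ac ac' cx c'x sv)
  (coherent_line hs'.1 ac ac' cx c'x sw)); congr atan.
have i0 := nbhs_singleton iso v w.
rewrite (transition_map c' cx) !gram_map// in i0.
have wT : wdg ('D_v T (c x)) ('D_w T (c x)) = jdet T (c x) * wdg v w.
  exact: (wdg_dT (@open_overlap _ _ c c') (overlap_map cx c'x)
    (@transition_smooth _ _ c c' 2 ac ac')).
rewrite wT -i0 (sqrt_det_chart ac ac' cx c'x) -/T.
move: (jdet T (c x)) (Num.sqrt _) (wdg v w) (ip _ _ _) => j q n i.
transitivity (q * (Num.sg j * `|j| * n) / i); first by rewrite -numEsg.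
by ring.
Qed.

Lemma jacob_chart (a b : M -> R) c c' x : atlas c -> atlas c' ->
  cdom c x -> cdom c' x ->
  differentiable (fun p => a (cinv c' p)) (c' x) ->
  differentiable (fun p => b (cinv c' p)) (c' x) ->
  jacob (fun p => a (cinv c p)) (fun p => b (cinv c p)) (c x) =
  jdet (transition c c') (c x) *
  jacob (fun p => a (cinv c' p)) (fun p => b (cinv c' p)) (c' x).
Proof.
move=> ac ac' cx c'x da db; set T := transition c c'.
have dT := transition_diff ac ac' cx c'x.
have Tx : T (c x) = c' x := transition_map c' cx.
have D (f : M -> R) u : differentiable (fun p => f (cinv c' p)) (c' x) ->
    'D_u (fun p => f (cinv c p)) (c x) =
    'D_u T (c x) 0 0 * partial 0 (fun p => f (cinv c' p)) (c' x)
    + 'D_u T (c x) 0 1 * partial 1 (fun p => f (cinv c' p)) (c' x).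
  move=> df; have df' := df; rewrite -Tx in df'.
  have e : \forall p \near c x, f (cinv c p) = f (cinv c' (T p)).
    by apply: filterS (near_overlap cx c'x) => p [_ _ _ _ ->].
  apply: etrans (near_eq_derive u e) _.
  apply: etrans (derive_val (der_comp u dT df')) _.
  by rewrite -/T Tx; exact: derive_rV2 _ df.
rewrite /jacob /jdet /wdg.
have D0a := D a (delta_mx 0 0) da; have D1a := D a (delta_mx 0 1) da.
have D0b := D b (delta_mx 0 0) db; have D1b := D b (delta_mx 0 1) db.
rewrite /partial in D0a D1a D0b D1b *.
rewrite D0a D1a D0b D1b.
move: ('D__ _ (c' x)) ('D__ _ (c' x)) ('D__ _ (c' x)) ('D__ _ (c' x)) => x1 x2 x3 x4.
move: ('D__ T (c x)) ('D__ T (c x)) => u v.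
by ring.
Qed.

(* the density of the 2-form [angle da db], an even 2-form *)
Lemma angle_jacob_chart s s' (a b : M -> R) c c' x : line_field s -> line_field s' ->
  atlas c -> atlas c' -> cdom c x -> cdom c' x ->
  differentiable (fun p => a (cinv c' p)) (c' x) ->
  differentiable (fun p => b (cinv c' p)) (c' x) ->
  angle s s' c x * jacob (fun p => a (cinv c p)) (fun p => b (cinv c p)) (c x)
    / Num.sqrt (\det (g c x)) =
  angle s s' c' x * jacob (fun p => a (cinv c' p)) (fun p => b (cinv c' p)) (c' x)
    / Num.sqrt (\det (g c' x)).
Proof.
move=> hs hs' ac ac' cx c'x da db.
rewrite (jacob_chart ac ac' cx c'x da db) (angle_chart hs hs' ac ac' cx c'x).
rewrite (sqrt_det_chart ac ac' cx c'x).
have j0 := chart_jdet_neq0 ac ac' cx c'x.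
have q0 : Num.sqrt (\det (g c' x)) != 0.
  by rewrite gt_eqF// sqrtr_gt0 spd_det//; exact: gram_spd.
move: (jdet _ _) j0 (Num.sqrt _) q0 (angle _ _ _ _) (jacob _ _ _) => j j0 q q0 t n.
have nj : `|j| != 0 by rewrite normr_eq0.
transitivity (t * (Num.sg j * `|j| * n) / (q * `|j|)); first by rewrite -numEsg.
by field; rewrite q0 nj.
Qed.

(** This keeps the angle off pi/2 modulo pi, where the branch given by [atan] jumps. *)
Definition nonorthogonal (s s' : subspace_field M) x := forall c v w,
  atlas c -> cdom c x -> s c x v -> s' c x w -> v != 0 -> w != 0 -> ip (g c x) v w != 0.

Lemma angle_near s s' c x : line_field s -> line_field s' -> atlas c -> cdom c x ->
  exists X Y, [/\ local_section s c x X, local_section s' c x Y,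
    X (c x) != 0 /\ Y (c x) != 0, s c x = line (X (c x)) /\ s' c x = line (Y (c x)) &
   \forall p \near c x, angle s s' c (cinv c p) =
     atan (area (gram g c) X Y p / ip (gram g c p) (X p) (Y p))].
Proof.
move=> hs hs' ac cx.
have [X HX] := line_field_section hs ac cx; have [Y HY] := line_field_section hs' ac cx.
have [_ lX X0 sX] := nbhs_singleton HX; have [_ lY Y0 sY] := nbhs_singleton HY.
exists X, Y; split => //.
apply: filterS3 (near_cimg cx) (near_cinv cx HX) (near_cinv cx HY).
move=> p cp [cy _ X0' sX'] [_ _ Y0' sY'].
rewrite (angleE X0' Y0' sX' sY') (cimgP cp).2.
by rewrite /area /gram.
Qed.

Lemma angle_C1near s s' c x : line_field s -> line_field s' -> atlas c -> cdom c x ->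
  nonorthogonal s s' x -> C1near (fun p => angle s s' c (cinv c p)) (c x).
Proof.
move=> hs hs' ac cx no; have [X [Y [lX lY [X0 Y0] [sX sY] e]]] := angle_near hs hs' ac cx.
have mG := gram_metric_near hg ac cx.
apply: (C1near_eq (f := fun p => atan (area (gram g c) X Y p / ip (gram g c p) (X p) (Y p)))).
  by apply: filterS e => p ->.
apply: (C1near_angle mG (local_section_C1near lX) (local_section_C1near lY)).
by rewrite gram_map//; apply: (no c) => //; rewrite ?sX ?sY; exists 1; rewrite ?scale1r.
Qed.

(** Difference of the two energy densities with respect to the same volume, that of [g]: the factor
    [expR (2 * mu x)] is the ratio of the volumes. *)
Definition excess (mu : M -> R) (s : subspace_field M) x : R :=
  expR (2 * mu x) * vertical_norm2 (conformal mu g) s x - vertical_norm2 g s x.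

(** The last term of [cometric_conf] is common to [s] and [s']. The cross term is linear in the
    connection form, whose increment is the differential of the angle by [derive_angle]. *)
Lemma excess_variation (mu : M -> R) s s' c x : smooth_function mu ->
  line_field s -> line_field s' -> atlas c -> cdom c x -> nonorthogonal s s' x ->
  excess mu s' x - excess mu s x =
  - 2 * jacob (fun p => angle s s' c (cinv c p)) (fun p => mu (cinv c p)) (c x)
    / Num.sqrt (\det (g c x)).
Proof.
move=> hmu hs hs' ac cx no.
have [X [Y [lX lY [X0 Y0] [sX sY] e]]] := angle_near hs hs' ac cx.
have mG := gram_metric_near hg ac cx.
have cm := smooth_function_C1M hmu ac cx.
have hg' := conformal_riemannian hg hmu.
have cX := local_section_C1near lX; have cY := local_section_C1near lY.
rewrite /excess !(vertical_norm2E hg hs ac cx lX X0) !(vertical_norm2E hg' hs ac cx lX X0).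
rewrite !(vertical_norm2E hg hs' ac cx lY Y0) !(vertical_norm2E hg' hs' ac cx lY Y0).
have EX := cometric_conf mG cm X0; have EY := cometric_conf mG cm Y0.
rewrite cmapK// in EX EY.
rewrite /cometric_conn.
have -> : gram (conformal mu g) c = confG (gram g c) (fun p => mu (cinv c p)) by [].
rewrite EX EY.
have P0 : ip (gram g c (c x)) (X (c x)) (Y (c x)) != 0.
  by rewrite gram_map//; apply: (no c) => //; rewrite ?sX ?sY; exists 1; rewrite ?scale1r.
have D u : 'D_u (fun p => angle s s' c (cinv c p)) (c x) =
    conn (gram g c) Y (c x) u - conn (gram g c) X (c x) u.
  apply: etrans (near_eq_derive u e) _.
  exact: derive_val (derive_angle mG u cX cY P0 X0 Y0).
have D0 := D (delta_mx 0 0); have D1 := D (delta_mx 0 1).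
rewrite /jacob [partial 0 (fun p => angle _ _ _ _) _]D0 [partial 1 (fun p => angle _ _ _ _) _]D1.
rewrite gram_map//.
move: (conn _ Y _ _) (conn _ Y _ _) (conn _ X _ _) (conn _ X _ _) => y1 y0 x1 x0.
move: (cometric _ _ _) (partial _ _ _) (partial _ _ _) (_^-1) => k m0 m1 q.
by ring.
Qed.

End angle.

(** * Bump functions and integration over a compact set *)

Section bump.
Context {R : realType}.
Local Notation V := 'rV[R]_2.

(** Squaring the positive part makes it C^1, the regularity that [stokes_plane] asks of its first
    function. *)
Definition pos_sq (s : R) : R := Num.max 0 s ^+ 2.

Lemma pos_sq_derive (s : R) : is_derive s (1 : R) pos_sq (2 * Num.max 0 s).
Proof.
have [s0|s0|->] := ltgtP s 0.
- rewrite mulr0; apply: (near_eq_is_derive _ (derC (0 : R) s 1)).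
  have : \forall y \near s, y < 0 by exact: lt_nbhsl.
  by apply: filterS => y y0; rewrite /pos_sq max_l ?ltW// expr0n.
- have D := derM (is_derive_id s (1 : R)) (is_derive_id s (1 : R)).
  apply: (near_eq_is_derive _ (is_derive_eq D _)).
    have : \forall y \near s, 0 < y by exact: lt_nbhsr.
    by apply: filterS => y y0; rewrite /pos_sq max_r ?ltW// expr2.
  by rewrite /=; ring.
- rewrite ?maxxx mulr0.
  have L : h^-1 *: (pos_sq (h *: (1 : R) + 0) - pos_sq 0) @[h --> (0 : R)^'] --> (0 : R).
    apply/cvgrPdist_le => e e0; near=> h.
    have h0 : h != 0 by near: h; exact: nbhs_dnbhs_neq.
    rewrite sub0r normrN /pos_sq maxxx expr0n subr0 addr0 /GRing.scale/= mulr1.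
    have he : `|h| <= e by near: h; exact: dnbhs0_le.
    rewrite normrM normfV normrX ler_pdivrMl ?normr_gt0//.
    rewrite expr2; apply: ler_pM => //.
    + by rewrite ger0_norm ?le_max ?lexx// ge_max normr_ge0 ler_norm.
    + apply: le_trans he; by rewrite ger0_norm ?le_max ?lexx// ge_max normr_ge0 ler_norm.
  by apply: DeriveDef; [apply/cvg_ex; exists 0; exact: L|exact: cvg_lim L].
Unshelve. all: by end_near. Qed.

Lemma pos_sq_ge0 s : 0 <= pos_sq s. Proof. exact: sqr_ge0. Qed.

Lemma pos_sq_gt0 s : (0 < pos_sq s) = (0 < s).
Proof.
rewrite /pos_sq exprn_even_gt0//=; have [s0|s0] := ltP 0 s; last by rewrite eqxx.
by rewrite gt_eqF.
Qed.

Lemma C1near_pos_sq (W : normedModType R) (f : W -> R) p : C1near f p ->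
  C1near (fun q => pos_sq (f q)) p.
Proof.
move=> cf; apply: (C1near_comp1 (h := pos_sq) (dh := fun s => 2 * Num.max 0 s) cf).
near=> y; split; first exact: pos_sq_derive.
apply: contM; first exact: contC.
by apply: continuous_max; [exact: contC|exact: cvg_id].
Unshelve. all: by end_near. Qed.

Definition flat (a : V) (r : R) (p : V) : R :=
  pos_sq (r ^+ 2 - (p 0 0 - a 0 0) ^+ 2) * pos_sq (r ^+ 2 - (p 0 1 - a 0 1) ^+ 2).

Definition box (a : V) (r : R) : set V := [set p | forall i, `|p 0 i - a 0 i| <= r].

Lemma flat_ge0 a r p : 0 <= flat a r p.
Proof. by rewrite mulr_ge0 ?pos_sq_ge0. Qed.

Lemma flat_box a r p : 0 < r -> flat a r p != 0 -> box a r p.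
Proof.
move=> r0; rewrite mulf_eq0 negb_or => /andP[h0 h1] i.
have : pos_sq (r ^+ 2 - (p 0 i - a 0 i) ^+ 2) != 0 by case: (I2P i) => ->.
move=> h; have : 0 < pos_sq (r ^+ 2 - (p 0 i - a 0 i) ^+ 2).
  by rewrite lt_neqAle eq_sym h pos_sq_ge0.
rewrite pos_sq_gt0 subr_gt0 -[X in X < _]real_normK ?num_real//.
by rewrite ltr_pXn2r ?nnegrE ?normr_ge0 ?(ltW r0)// => /ltW.
Qed.

Lemma flat_center a r : 0 < r -> 0 < flat a r a.
Proof.
move=> r0; rewrite /flat !subrr expr0n subr0.
by rewrite mulr_gt0// pos_sq_gt0 exprn_gt0.
Qed.

Lemma C1near_flat a r p : C1near (flat a r) p.
Proof.
have c i : C1near (fun q : V => pos_sq (r ^+ 2 - (q 0 i - a 0 i) ^+ 2)) p.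
  apply: C1near_pos_sq.
  have ci : C1near (fun q : V => q 0 i) p.
    apply: C1near_coord 0 i _; rewrite -/(@id V).
    apply: filterE => q; split; first exact: ex_diff.
    by move=> u; rewrite (_ : 'D_u id = fun=> u); [exact: cst_continuous|
      apply/funext => y; exact: derive_id].
  have cd := C1nearB ci (C1near_cst (a 0 i) p).
  apply: (C1near_eq (f := fun q : V => r ^+ 2 - (q 0 i - a 0 i) * (q 0 i - a 0 i))).
    by near=> q; rewrite expr2.
  exact: C1nearB (C1near_cst _ _) (C1nearM cd cd).
exact: C1nearM (c 0) (c 1).
Unshelve. all: by end_near. Qed.

Lemma box_compact a r : compact (box a r).
Proof.
have -> : box a r = [set p | forall i, `[a 0 i - r, a 0 i + r]%classic (p 0 i)].
  apply/seteqP; split => p hp i; have := hp i; rewrite /= in_itv/= ler_norml.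
    by move=> /andP[? ?]; apply/andP; split; lra.
  by move=> /andP[? ?]; apply/andP; split; lra.
exact: (@rV_compact R 2 (fun i => `[a 0 i - r, a 0 i + r]%classic) (fun=> @segment_compact R _ _)).
Qed.

Lemma box_closed a r : closed (box a r).
Proof. by apply: compact_closed; [exact: norm_hausdorff|exact: box_compact]. Qed.

Lemma box_nbhs (a : V) (U : set V) : nbhs a U -> exists2 r, 0 < r & box a r `<=` U.
Proof.
move=> /nbhs_ballP[e /= e0 eU]; exists (e / 2); first by rewrite divr_gt0.
move=> p hp; apply: eU; split => // i j; rewrite ord1 /ball/= distrC.
by apply: le_lt_trans (hp j) _; rewrite gtr_pMr// invf_lt1// ltr1n.
Qed.

End bump.

(** * Bumps transported to the surface *)

Section surface_bumps.
Context {R : realType} (M : surface R).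
Implicit Types (c : chart R M) (x y : M).
Local Notation V := 'rV[R]_2.

Definition chart_box c (a : V) (r : R) := [/\ atlas c, 0 < r & box a r `<=` cimg c].

Definition bump c a r x : R := if `[< cdom c x >] then flat a r (c x) else 0.

Lemma bump_ge0 c a r x : 0 <= bump c a r x.
Proof. by rewrite /bump; case: asboolP => // _; exact: flat_ge0. Qed.

Lemma bumpE c a r x : cdom c x -> bump c a r x = flat a r (c x).
Proof. by move=> cx; rewrite /bump; case: asboolP. Qed.

Section one_box.
Variables (c : chart R M) (a : V) (r : R).
Hypothesis hb : chart_box c a r.

Definition boxM : set M := cinv c @` box a r.

Lemma boxM_closed : closed boxM.
Proof.
case: hb => ac r0 bc.
apply: compact_closed; first exact: points_hausdorff.
apply: continuous_compact; last exact: box_compact.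
by apply: continuous_in_subspaceT => p; rewrite inE => /bc cp; exact: cinv_continuous.
Qed.

Lemma boxMP x : boxM x <-> cdom c x /\ box a r (c x).
Proof.
case: hb => ac r0 bc; split => [[p bp <-]|[cx bx]].
  by have [d e] := cimgP (bc _ bp); rewrite e.
by exists (c x) => //; rewrite cmapK.
Qed.

Lemma near_not_boxM x : ~ boxM x -> \forall y \near x, ~ boxM y.
Proof.
by move=> nx; apply: (open_near (U := ~` boxM)) => //; exact: closed_openC boxM_closed.
Qed.

Lemma bump_boxM x : bump c a r x != 0 -> boxM x.
Proof.
case: hb => ac r0 bc; rewrite /bump; case: asboolP => [cx|]; last by rewrite eqxx.
by move=> /(flat_box r0) bx; apply/boxMP.
Qed.

Lemma bump_notin x : ~ boxM x -> bump c a r x = 0.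
Proof. by move=> nx; apply/eqP; apply: contra_notT nx; exact: bump_boxM. Qed.

(** The question is at points off the domain of [c]. There the bump vanishes nearby, since its
    support lies in [boxM], which is compact and therefore closed in the Hausdorff surface. *)
Lemma bump_C1M : C1M (bump c a r).
Proof.
move=> c' x ac' c'x; have [ac r0 bc] := hb.
have [cx|ncx] := pselect (cdom c x); last first.
  have nb : ~ boxM x by move/boxMP => [].
  apply: C1near_eq (C1near_cst (0 : R) (c' x)).
  by apply: filterS (near_cinv c'x (near_not_boxM nb)) => p np; rewrite bump_notin.
have cT : C1near (transition c' c) (c' x).
  exact: Ck_C1near (@open_overlap _ _ c' c) (@transition_smooth _ _ c' c 1 ac' ac) (overlap_map c'x cx).
apply: (C1near_eq (f := fun p => flat a r (transition c' c p))).
  by apply: filterS (near_overlap c'x cx) => p [_ _ cp _ _]; rewrite bumpE.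
by apply: C1near_comp cT _; exact: C1near_flat.
Qed.

End one_box.

(** Each point carries a bump that is positive at it, hence on an open set; a finite subcover of [K]
    gives the family. *)
Lemma bump_cover (K : set M) : compact K -> exists n (c : 'I_n -> chart R M) a r,
  (forall i, chart_box (c i) (a i) (r i)) /\
  (forall x, K x -> 0 < \sum_(i < n) bump (c i) (a i) (r i) x).
Proof.
move=> cK.
have E x : exists d : chart R M * (V * R),
    chart_box d.1 d.2.1 d.2.2 /\ 0 < bump d.1 d.2.1 d.2.2 x.
  have [c ac cx] := atlas_cover x.
  have [r r0 br] := box_nbhs (near_cimg cx).
  by exists (c, (c x, r)); split => //=; rewrite bumpE//; exact: flat_center.
pose d x := sval (cid (E x)).
have Hd x : chart_box (d x).1 (d x).2.1 (d x).2.2 /\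
  0 < bump (d x).1 (d x).2.1 (d x).2.2 x := svalP (cid (E x)).
pose b y x := bump (d y).1 (d y).2.1 (d y).2.2 x.
have cb y : C1M (b y) by exact: bump_C1M (Hd y).1.
move: cK; rewrite compact_cover => /(_ M K (fun y => [set x | 0 < b y x])).
case.
- move=> y _; apply: (@open_comp _ _ (b y) [set t | 0 < t]); last exact: open_gt.
  by move=> x _; exact: C1M_continuous.
- by move=> x Kx; exists x => //; exact: (Hd x).2.
move=> D _ KD; pose n := size (finmap.enum_fset D).
pose y (i : 'I_n) := tnth (in_tuple (finmap.enum_fset D)) i.
exists n, (fun i => (d (y i)).1), (fun i => (d (y i)).2.1), (fun i => (d (y i)).2.2).
split => [i|x Kx]; first exact: (Hd _).1.
have [z /= zD bz] := KD x Kx.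
have [i iz] : exists i, y i = z by have /tnthP[i ->] : z \in in_tuple (finmap.enum_fset D) by []; exists i.
rewrite (bigD1 i)//= ltr_pwDl//; first by rewrite iz.
by apply: sumr_ge0 => j _; exact: bump_ge0.
Qed.

End surface_bumps.

(** * The Riemannian volume in charts *)

Section surface_integrals.
Context {R : realType} (M : surface R).
Implicit Types (c : chart R M) (x y : M).
Local Notation V := 'rV[R]_2.
Local Notation mu := (@lebesgue_measure R).
Local Notation mu2 := (mu \x mu)%E.
Variable (g : metric_field M).
Hypothesis hg : riemannian g.
Variable (vol : {measure set (borel M) -> \bar R}).
Hypothesis hvol : riemannian_volume g vol.

Definition vol_weight c (z : R * R) : R :=
  if `[< cimg c (pt2 z) >] then Num.sqrt (\det (g c (cinv c (pt2 z)))) else 0.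

Lemma vol_weight_ge0 c z : 0 <= vol_weight c z.
Proof. by rewrite /vol_weight; case: asboolP => // _; exact: sqrtr_ge0. Qed.

Lemma measurable_restrict_chart (U : set V) (f : V -> R) : open U ->
  (forall p, U p -> {for p, continuous f}) ->
  measurable_fun setT (fun z => if `[< U (pt2 z) >] then f (pt2 z) else 0).
Proof.
move=> oU cf; apply: (measurability _ (RGenOInfty.measurableE R)) => _ [_ [x ->] <-].
rewrite setTI; set h := fun z => _.
have mU := open_pt2_measurable oU.
have oW : open [set p | U p /\ x < f p].
  rewrite openE => p [Up fp]; rewrite /interior.
  exact: filterI (open_near oU Up) (cvgr_gt _ (cf p Up) _ fp).
have -> : h @^-1` `]x, +oo[ = (@pt2 R @^-1` [set p | U p /\ x < f p])
   `|` (if x < 0 then ~` (@pt2 R @^-1` U) else set0).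
  apply/seteqP; split => z; rewrite /h /= ?in_itv/= ?andbT.
    case: asboolP => Uz xz; first by left.
    by right; rewrite xz.
  move=> [[Uz xz]|]; first by case: asboolP.
  by case: ifP => // x0 nU; case: asboolP.
apply: measurableU; first exact: open_pt2_measurable.
by case: ifP => // _; exact: measurableC.
Qed.

Lemma sqrt_det_continuous c p : atlas c -> cimg c p ->
  {for p, continuous (fun p => Num.sqrt (\det (gram g c p)))}.
Proof.
move=> ac [x cx <-]; have mG := gram_metric_near hg ac cx.
exact: C1near_cont (C1near_sqrt (C1near_det mG) (spd_det (nbhs_singleton mG.1))).
Qed.

Lemma measurable_vol_weight c : atlas c -> measurable_fun setT (vol_weight c).
Proof.
move=> ac; apply: (@measurable_restrict_chart (cimg c) (fun p => Num.sqrt (\det (gram g c p)))).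
  exact: cimg_open.
by move=> p cp; exact: sqrt_det_continuous.
Qed.

Lemma cdom_measurable c : measurable (cdom c : set (borel M)).
Proof. by apply: open_borel; exact: cdom_open. Qed.

Local Open Scope ereal_scope.

(** Passage to the total functions [cpar] and [vol_weight], to which [transfer_integral] applies;
    the weight 0 erases the arbitrary values of [cpar] off the image of the chart. *)
Lemma vol_weightE c (A : set (borel M)) (f : M -> \bar R) : A `<=` cdom c ->
  \int[mu2]_(z in @pt2 R @^-1` (c @` A))
     (f (cinv c (pt2 z)) * (Num.sqrt (\det (g c (cinv c (pt2 z)))))%:E) =
  \int[mu2]_(z in cpar c @^-1` A) (f (cpar c z) * (vol_weight c z)%:E).
Proof.
move=> sAc; rewrite [LHS]integral_mkcond [RHS]integral_mkcond.
apply: eq_integral => z _; rewrite !patchE /vol_weight /cpar.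
case: (asboolP (cimg c (pt2 z))) => cz; last first.
  rewrite mule0 memNset; first by case: ifP.
  by move=> [x Ax e]; apply: cz; exists x => //; exact: sAc.
have [dz ez] := cimgP cz.
have -> // : (z \in @pt2 R @^-1` (c @` A)) = (z \in (fun z0 =>
  if `[< cimg c (pt2 z0) >] then cinv c (pt2 z0) else point) @^-1` A).
apply/idP/idP; rewrite !inE /=; case: asboolP => // _.
  by move=> [x Ax <-]; rewrite cmapK//; exact: sAc.
by move=> Az; exists (cinv c (pt2 z)).
Qed.

Lemma chart_integral c (A : set (borel M)) (f : borel M -> \bar R) : atlas c ->
  measurable A -> A `<=` cdom c -> measurable_fun setT f ->
  \int[vol]_(x in A) f x = \int[mu2]_(z in @pt2 R @^-1` (c @` A))
     (f (cinv c (pt2 z)) * (Num.sqrt (\det (g c (cinv c (pt2 z)))))%:E).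
Proof.
move=> ac mA sAc mf; rewrite (vol_weightE f sAc).
apply: (@transfer_integral _ _ _ _ _ vol mu2 (cpar c) (vol_weight c) A).
- exact: measurable_cpar.
- exact: measurable_vol_weight.
- exact: vol_weight_ge0.
- exact: mA.
- move=> B mB BA; rewrite (hvol ac mB (subset_trans BA sAc)).
  have e := @vol_weightE c B (fun=> 1) (subset_trans BA sAc).
  by apply: etrans (etrans _ e) _; apply: eq_integral => z _; rewrite mul1e.
- exact: mf.
Qed.

End surface_integrals.

Section compact_integrals.
Context {R : realType} (M : surface R).
Implicit Types (c : chart R M) (x y : M).
Local Notation V := 'rV[R]_2.
Local Notation mu := (@lebesgue_measure R).
Local Notation mu2 := (mu \x mu)%E.
Variable (g : metric_field M).
Hypothesis hg : riemannian g.
Variable (vol : {measure set (borel M) -> \bar R}).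
Hypothesis hvol : riemannian_volume g vol.

Lemma chart_integral_plane c (f : borel M -> R) (k : V -> R) : atlas c ->
  measurable_fun setT f ->
  (forall p, cimg c p -> k p = f (cinv c p) * Num.sqrt (\det (gram g c p))) ->
  (forall p, ~ cimg c p -> k p = 0) ->
  (\int[vol]_(x in cdom c) (f x)%:E = \int[mu2]_z (k (pt2 z))%:E)%E.
Proof.
move=> ac mf kE k0.
have mf' : measurable_fun setT (fun x : borel M => (f x)%:E) by exact/measurable_EFinP.
rewrite (chart_integral hg hvol ac (cdom_measurable c) (@subset_refl _ _) mf').
rewrite integral_mkcond; apply: eq_integral => z _; rewrite patchE.
case: ifPn => [|]; rewrite ?inE ?notin_setE => cz; last by rewrite k0.
by rewrite kE.
Qed.

Lemma compact_measurable (K : set M) : compact K -> @measurable _ (borel M) K.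
Proof.
move=> cK; have oK : open (~` K).
  by apply: closed_openC; apply: compact_closed => //; exact: points_hausdorff.
by have := measurableC (open_borel (oK : @open M (~` K))); rewrite setCK.
Qed.

Lemma box_bound (a : V) r p i : 0 < r -> box a r p ->
  `|p 0 i| <= `|a 0 0| + `|a 0 1| + r.
Proof.
move=> r0 /(_ i) h; rewrite -[p 0 i](subrK (a 0 i)).
apply: le_trans (ler_normD _ _) _; rewrite addrC; apply: lerD => //.
by case: (I2P i) => ->; rewrite ?lerDl ?lerDr.
Qed.

(** Functions read in a chart have arbitrary values off its image; replacing these by 0 gives
    functions that can be integrated over the whole plane. *)
Definition cut c (h : V -> R) (p : V) : R := if `[< cimg c p >] then h p else 0.

Lemma cutE c h p : cimg c p -> cut c h p = h p.
Proof. by rewrite /cut; case: asboolP. Qed.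

Lemma cutN c h p : ~ cimg c p -> cut c h p = 0.
Proof. by rewrite /cut; case: asboolP. Qed.

Lemma near_cutE c h p : cimg c p -> \forall q \near p, cut c h q = h q.
Proof.
move=> cp; have : \forall q \near p, cimg c q by apply: open_near => //; exact: cimg_open.
by apply: filterS => q; exact: cutE.
Qed.

Lemma near_cut0 c h a r p : chart_box c a r -> (forall q, cimg c q -> ~ box a r q -> h q = 0) ->
  ~ box a r p -> \forall q \near p, cut c h q = 0.
Proof.
move=> [ac r0 bc] h0 nb; have : \forall q \near p, ~ box a r q.
  by apply: (open_near (U := ~` box a r)) => //; exact/closed_openC/box_closed.
apply: filterS => q nq; have [cq|ncq] := pselect (cimg c q); last exact: cutN.
by rewrite cutE// h0.
Qed.

Lemma cut_continuous c h a r : chart_box c a r ->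
  (forall q, cimg c q -> ~ box a r q -> h q = 0) ->
  (forall q, cimg c q -> {for q, continuous h}) -> continuous (cut c h).
Proof.
move=> hb h0 ch p; have [cp|ncp] := pselect (cimg c p).
  apply: near_eq_continuous (ch p cp).
  by apply: filterS (near_cutE h cp) => q ->.
have nb : ~ box a r p by case: hb => _ _ bc /bc.
apply: near_eq_continuous (@contC R _ p 0).
by apply: filterS (near_cut0 hb h0 nb) => q ->.
Qed.

Lemma cut_support c h a r p i : chart_box c a r ->
  (forall q, cimg c q -> ~ box a r q -> h q = 0) ->
  cut c h p != 0 -> `|p 0 i| <= `|a 0 0| + `|a 0 1| + r.
Proof.
move=> hb h0; have [ac r0 bc] := hb.
have [bp|nb] := pselect (box a r p); first by move=> _; exact: box_bound.
by rewrite (nbhs_singleton (near_cut0 hb h0 nb)) eqxx.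
Qed.

Lemma integral_support (D D' : set (borel M)) (f : borel M -> R) :
  (forall x, f x != 0 -> D x /\ D' x) ->
  (\int[vol]_(x in D) (f x)%:E = \int[vol]_(x in D') (f x)%:E)%E.
Proof.
move=> h; rewrite [LHS]integral_mkcond [RHS]integral_mkcond.
apply: eq_integral => x _; rewrite !patchE.
have [->|/h[Dx D'x]] := eqVneq (f x) 0; first by rewrite !if_same.
by rewrite !mem_set.
Qed.

Lemma bump_integral_fin c a r : chart_box c a r ->
  (\int[vol]_x (bump c a r x)%:E < +oo)%E.
Proof.
move=> hb; have [ac r0 bc] := hb.
pose h p := flat a r p * Num.sqrt (\det (gram g c p)).
have h0 q : cimg c q -> ~ box a r q -> h q = 0.
  move=> _ nb; rewrite /h (_ : flat a r q = 0) ?mul0r//.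
  by apply/eqP; apply: contra_notT nb; exact: flat_box.
have ch q : cimg c q -> {for q, continuous h}.
  by move=> cq; apply: contM; [exact: C1near_cont (C1near_flat a r q)|exact: sqrt_det_continuous].
rewrite (@integral_support setT (cdom c)); last first.
  by move=> x /(bump_boxM hb)/(boxMP hb)[].
rewrite (@chart_integral_plane c _ (cut c h))//.
- apply: integrable_lty => //.
  apply: (integrable_compact_support (cut_continuous hb h0 ch)) => p i.
  exact: cut_support hb h0.
- by apply: continuous_borel => x; exact: C1M_continuous (bump_C1M hb).
- by move=> p cp; have [d e] := cimgP cp; rewrite cutE// /h bumpE// e.
- by move=> p; exact: cutN.
Qed.

(** The sum [B] of the bumps has finite integral, and on [K] it is bounded below by its minimum,
    which is positive. *)
Lemma compact_volume_fin (K : set M) : compact K -> (vol (K : set (borel M)) < +oo)%E.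
Proof.
move=> cK; have [n [c [a [r [hb HB]]]]] := bump_cover cK.
have [->|K0] := eqVneq K set0; first by rewrite measure0.
have mK := compact_measurable cK.
pose B x := \sum_(i < n) bump (c i) (a i) (r i) x.
have cBM : C1M B.
  by move=> c' y ac' cy; apply: C1near_sum => i; exact: bump_C1M.
have cB : continuous B by move=> x; exact: C1M_continuous.
have [x0 Kx0 minB] := compact_EVT_min (proj1 (set0P K) K0) cK (continuous_subspaceT cB).
have d0 : 0 < B x0 by apply: HB; exact: set_mem.
have mb i : measurable_fun setT (fun x : borel M => (bump (c i) (a i) (r i) x)%:E).
  apply/measurable_EFinP; apply: continuous_borel => x.
  exact: C1M_continuous (bump_C1M (hb i)).
have b0 i (x : borel M) : (0 <= (bump (c i) (a i) (r i) x)%:E)%E.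
  by rewrite lee_fin bump_ge0.
have : ((B x0)%:E * vol (K : set (borel M)) < +oo)%E.
  rewrite -integral_cst//.
  apply: (@le_lt_trans _ _ (\int[vol]_(x in (K : set (borel M))) (B x)%:E)%E).
    apply: ge0_le_integral => //.
    - by move=> x _; rewrite lee_fin ltW.
    - apply/measurable_EFinP/measurable_funTS; exact: continuous_borel cB.
    - by move=> x Kx; rewrite lee_fin minB// inE.
  under eq_integral do rewrite -sumEFin.
  rewrite ge0_integral_sum//; last first.
    by move=> i; exact: measurable_funTS.
  apply: lte_sum_pinfty => i _; apply: le_lt_trans (bump_integral_fin (hb i)).
  by apply: ge0_subset_integral.
have : (0 <= vol (K : set (borel M)))%E by [].
case: (vol _) => [v _ _| _ |//]; first by rewrite ltry.
by rewrite gt0_muley ?lte_fin.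
Qed.

Lemma continuous_integrable (K : set M) (f : M -> R) : compact K -> continuous f ->
  vol.-integrable (K : set (borel M)) (fun x => (f x)%:E).
Proof.
move=> cK cf; apply: (@measurable_bounded_integrable _ _ _ vol f K).
- exact: compact_measurable.
- exact: compact_volume_fin.
- by apply: measurable_funTS; exact: continuous_borel.
- have cfK : {within K, continuous f} by exact: continuous_subspaceT.
  have [N [Nr HN]] := compact_bounded (continuous_compact cfK cK).
  by exists N; split => // x Nx y Ky; apply: HN => //; exists y.
Qed.

End compact_integrals.

(** * Stokes' theorem for the angle form *)

Section transversality.
Context {R : realType} (M : surface R).
Implicit Types (c : chart R M) (x y : M).
Local Notation V := 'rV[R]_2.
Variable (g : metric_field M).
Hypothesis hg : riemannian g.

Lemma nonorthogonal_chart s s' c x v w : coherent s -> coherent s' ->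
  atlas c -> cdom c x -> s c x = line v -> s' c x = line w ->
  ip (g c x) v w != 0 -> nonorthogonal g s s' x.
Proof.
move=> hs hs' ac cx sv sw n0 c' v' w' ac' c'x.
rewrite (coherent_line hs ac ac' cx c'x sv) (coherent_line hs' ac ac' cx c'x sw).
move=> lv lw v0 w0.
have [a a0 ->] := line_neq0_scale lv v0; have [b b0 ->] := line_neq0_scale lw w0.
have i0 := nbhs_singleton (gram_isometry hg ac ac' cx c'x) v w.
rewrite (transition_map c' cx) !gram_map// in i0.
by rewrite ipZl ipZr -i0 !mulf_neq0.
Qed.

Lemma nonorthogonal_eq s s' c x : line_field s -> coherent s' -> atlas c -> cdom c x ->
  s' c x = s c x -> nonorthogonal g s s' x.
Proof.
move=> hs hs' ac cx e; have [v v0 sv] := line_field_line hs ac cx.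
apply: (nonorthogonal_chart hs.1 hs' ac cx sv (etrans e sv)).
by rewrite gt_eqF//; exact: (gram_spd hg ac cx).2.
Qed.

(** A line is not orthogonal to itself, so the claim holds at [t = 0]. By continuity it persists
    near each point for small [t], and compactness of [K] makes the range of [t] uniform; off [K]
    nothing moves. *)
Lemma variation_nonorthogonal (K : set M) s eps st : compact K -> 0 < eps ->
  line_field s -> compact_variation K s eps st ->
  \forall t \near (0 : R), forall x, nonorthogonal g s (st t) x.
Proof.
move=> cK eps0 hs hst; have [coh sm st0 stK] := hst.
have neps : \forall t \near (0 : R), `|t| < eps by exact: nbhs0_lt.
have key : near_covering K.
  by apply/compact_near_coveringP.
have : \forall t \near (0 : R), K `<=` (fun x => `|t| < eps -> nonorthogonal g s (st t) x).
  apply: (key R (nbhs (0 : R)) (fun t x => `|t| < eps -> nonorthogonal g s (st t) x)) => x Kx.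
  have [c ac cx] := atlas_cover x.
  have e00 : `|(0 : R)| < eps by rewrite normr0.
  have [U [X [oU Ux UC sX H]]] := sm c 0 x ac e00 cx.
  have cX z : U z -> {for z, continuous X} by move=> Uz; exact: Ck_cont (sX 0%N) Uz.
  pose z0 : R * V := (0, c x).
  (* The same local lift [X] spans [st t] at [z] and [s] at [pr z], so [Phi] compares the two lines
     through one continuous field. *)
  pose pr (z : R * V) : R * V := (0, z.2).
  have cpr z : {for z, continuous pr}.
    apply: (@cvg_pair _ _ _ (nbhs z) (nbhs (0 : R)) (nbhs z.2) _ _ _ (fun=> 0) snd).
      exact: cvg_cst.
    exact: cvg_snd.
  have mG := gram_metric_near hg ac cx.
  pose Phi z := ip (gram g c z.2) (X (pr z)) (X z).
  have cPhi : {for z0, continuous Phi}.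
    have cXp i : {for z0, continuous (fun z => X (pr z) 0 i)}.
      apply: cont_coord; apply: (@continuous_comp _ _ _ pr X); first exact: cpr.
      exact: cX.
    have cX0 i : {for z0, continuous (fun z => X z 0 i)} by apply: cont_coord; exact: cX.
    have cG i j : {for z0, continuous (fun z : R * V => gram g c z.2 i j)}.
      apply: (@continuous_comp _ _ _ (fun z : R * V => z.2) (fun p => gram g c p i j)).
        exact: cvg_snd.
      exact: C1near_cont (mG.2 i j).
    have -> : Phi = fun z => X (pr z) 0 0 * gram g c z.2 0 0 * X z 0 0
      + X (pr z) 0 0 * gram g c z.2 0 1 * X z 0 1
      + (X (pr z) 0 1 * gram g c z.2 1 0 * X z 0 0
        + X (pr z) 0 1 * gram g c z.2 1 1 * X z 0 1).
      by apply/funext => z; exact: ipE.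
    have t i j := contM (contM (cXp i) (cG i j)) (cX0 j).
    exact: contD (contD (t _ _) (t _ _)) (contD (t _ _) (t _ _)).
  have Phi0 : 0 < Phi z0.
    rewrite /Phi /pr /=; apply: (nbhs_singleton mG.1).2.
    by have [] := H _ Ux.
  have nU : \forall z \near z0, U z by exact: open_near.
  have nU' : \forall z \near z0, U (pr z) by exact: (cpr z0 _ nU).
  have nP : \forall z \near z0, 0 < Phi z by exact: (cvgr_gt _ cPhi _ Phi0).
  have [[A B] [/= nA nB] AB] := filterI nU (filterI nU' nP).
  have nB' := filterI (near_cmap cx nB) (near_cdom cx).
  exists ([set y | B (c y) /\ cdom c y], A); first by split; [exact: nB'|rewrite nbhs_filterE; exact: nA].
  move=> [y t] [/= [By cy] At] te.
  have [/= U1 [U2 P0]] := AB (t, c y) (conj At By).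
  have [X1 e1] := H _ U1; have [X2 e2] := H _ U2.
  rewrite /= cmapK// in e1 e2; rewrite st0// in e2.
  apply: (nonorthogonal_chart hs.1 (coh t te) ac cy e2 e1).
  by rewrite gt_eqF//; move: P0; rewrite /Phi /= gram_map.
apply: filterS2 neps => t te Kt x.
have [Kx|nKx] := pselect (K x); first exact: Kt.
have [c ac cx] := atlas_cover x.
by apply: (nonorthogonal_eq hs (coh t te) ac cx); exact: stK.
Qed.

Lemma angle_eq0 s s' c x : line_field s -> atlas c -> cdom c x -> s' c x = s c x ->
  angle g s s' c x = 0.
Proof.
move=> hs ac cx e; have [v v0 sv] := line_field_line hs ac cx.
by rewrite (angleE g v0 v0 sv (etrans e sv)) wdgxx mulr0 mul0r atan0.
Qed.

End transversality.

(** * Localisation by bumps *)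

Section stokes_surface.
Context {R : realType} (M : surface R).
Implicit Types (c : chart R M) (x y : M).
Local Notation V := 'rV[R]_2.
Local Notation mu2 := (@lebesgue_measure R \x @lebesgue_measure R)%E.

Lemma jacob_sum n (f : 'I_n -> V -> R) m p : (forall i, differentiable (f i) p) ->
  \sum_(i < n) jacob (f i) m p = jacob (fun q => \sum_(i < n) f i q) m p.
Proof.
move=> df; have D u : 'D_u (fun q => \sum_(i < n) f i q) p = \sum_(i < n) 'D_u (f i) p.
  rewrite -derive_sum; last by move=> i; exact: diff_derivable.
  by apply: (congr1 (fun h => 'D_u h p)); apply/funext => q; rewrite fct_sumE.
rewrite /jacob /partial !D !mulr_suml -sumrB.
by apply: eq_bigr.
Qed.

Lemma jacob_near0 (f m : V -> R) p a : (\forall q \near p, f q = a) -> jacob f m p = 0.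
Proof.
move=> h; rewrite /jacob /partial !(near_eq_derive _ h) !derive_cst.
by rewrite !mul0r subr0.
Qed.

Variables (g : metric_field M) (mu : M -> R) (K : set M) (s s' : subspace_field M).
Hypotheses (hg : riemannian g) (hmu : smooth_function mu) (cK : compact K).
Hypotheses (hs : line_field s) (hs' : line_field s').
Hypothesis no : forall x, nonorthogonal g s s' x.
Hypothesis sK : forall c x, atlas c -> cdom c x -> ~ K x -> s' c x = s c x.
Variable (vol : {measure set (borel M) -> \bar R}).
Hypothesis hvol : riemannian_volume g vol.

Let near_notK x : ~ K x -> \forall y \near x, ~ K y.
Proof.
move=> nx; apply: (open_near (U := ~` K)) => //; apply: closed_openC.
by apply: compact_closed => //; exact: points_hausdorff.
Qed.

Section piece.
Variables (c : chart R M) (a : V) (r : R) (rho : M -> R).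
Hypotheses (hb : chart_box c a r) (rho0 : forall x, ~ boxM c a r x -> rho x = 0).
Hypothesis crho : forall c' x, atlas c' -> cdom c' x -> K x ->
  C1near (fun p => rho (cinv c' p)) (c' x).

Let ac : atlas c. Proof. by case: hb. Qed.
Let m p := mu (cinv c p).
Let h p := rho (cinv c p) * angle g s s' c (cinv c p).
Let H := cut c h.

(** The 2-form [d (rho theta) /\ dmu] divided by the volume form, both read in [c], where theta is
    the angle; it is extended by 0 off the domain. *)
Definition piece x : R :=
  if `[< cdom c x >] then jacob H m (c x) / Num.sqrt (\det (g c x)) else 0.

Let pieceE x : cdom c x -> piece x = jacob H m (c x) / Num.sqrt (\det (g c x)).
Proof. by rewrite /piece; case: asboolP. Qed.

Let h0 q : cimg c q -> ~ box a r q -> h q = 0.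
Proof.
move=> cq nb; rewrite /h rho0 ?mul0r// => /(boxMP hb)[_].
by rewrite (cimgP cq).2.
Qed.

Let near_h0 x : cdom c x -> ~ K x -> \forall p \near c x, H p = 0.
Proof.
move=> cx nx; apply: filterS2 (near_cimg cx) (near_cinv cx (near_notK nx)) => p cp np.
rewrite /H cutE// /h (angle_eq0 g hs ac (cimgP cp).1) ?mulr0//.
by apply: sK => //; exact: (cimgP cp).1.
Qed.

(** At a point of [K] both factors are C^1; off the closed set [K] the angle vanishes nearby,
    whatever [rho] does there. *)
Let H_C1near p : cimg c p -> C1near H p.
Proof.
move=> [x cx <-]; have [Kx|nKx] := pselect (K x); last first.
  apply: C1near_eq (C1near_cst (0 : R) (c x)).
  by apply: filterS (near_h0 cx nKx) => q ->.
apply: (C1near_eq (f := h)).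
  by apply: filterS (near_cutE h (cimg_map cx)) => q e; exact: esym e.
have C := C1nearM (crho ac cx Kx) (angle_C1near hg hs hs' ac cx (@no x)).
exact: C.
Qed.

Let jacob_out p : ~ box a r p -> jacob H m p = 0.
Proof. by move=> nb; apply: jacob_near0 (near_cut0 hb h0 nb). Qed.

Lemma piece_support x : piece x != 0 -> K x /\ cdom c x.
Proof.
rewrite /piece; case: asboolP => [cx|]; last by rewrite eqxx.
move=> p0; split => //; apply: contrapT => nKx; move/eqP: p0; apply.
by rewrite (jacob_near0 m (near_h0 cx nKx)) mul0r.
Qed.

Lemma piece_continuous : continuous piece.
Proof.
move=> x; have [cx|ncx] := pselect (cdom c x).
  apply: (@continuous_chart _ _ c x
    (fun p => jacob H m p * (Num.sqrt (\det (gram g c p)))^-1)) => //.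
    have cH := H_C1near (cimg_map cx); have cm := smooth_function_C1M hmu ac cx.
    have dc (f : V -> R) i : C1near f (c x) -> {for c x, continuous (partial i f)}.
      by move=> cf; exact: C1near_dcont cf.
    apply: contM.
      apply: contD; first exact: contM (dc _ _ cH) (dc _ _ cm).
      exact: contN (contM (dc _ _ cH) (dc _ _ cm)).
    have q0 : Num.sqrt (\det (gram g c (c x))) != 0.
      by rewrite gt_eqF// sqrtr_gt0 gram_map// spd_det//; exact: gram_spd.
    have cq := sqrt_det_continuous hg ac (cimg_map cx).
    exact: contV cq q0.
  by apply: filterS (near_cdom cx) => y cy; rewrite pieceE// gram_map.
have nb : ~ boxM c a r x by move/(boxMP hb) => [].
apply: near_eq_continuous (@contC R _ x 0).
apply: filterS (near_not_boxM hb nb) => y nby; rewrite /piece.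
case: asboolP => // cy; rewrite jacob_out ?mul0r// => b.
by apply: nby; apply/(boxMP hb).
Qed.

Lemma piece_integral : (\int[vol]_(x in (K : set (borel M))) (piece x)%:E = 0)%E.
Proof.
have [_ r0 bc] := hb.
rewrite (@integral_support _ _ vol K (cdom c) piece); last by move=> x /piece_support.
rewrite (@chart_integral_plane _ _ g hg vol hvol c piece (jacob H m) ac).
(* [box_bound] is a weak inequality; adding 1 makes the bound strict. *)
- apply: (@stokes_plane R (cimg c) (box a r) H m (`|a 0 0| + `|a 0 1| + r + 1)).
  + exact: cimg_open.
  + exact: box_closed.
  + exact: bc.
  + by move=> p i bp; rewrite ltr_pwDr// box_bound.
  + exact: H_C1near.
  + by move=> p nb; exact: nbhs_singleton (near_cut0 hb h0 nb).
  + exact: smooth_function_Ck.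
- by apply: continuous_borel => x; exact: piece_continuous.
- move=> p cp; have [d e] := cimgP cp; rewrite pieceE// /gram e divfK//.
  by rewrite gt_eqF// sqrtr_gt0 spd_det//; exact: gram_spd.
- by move=> p ncp; apply: jacob_out => /bc.
Qed.

(** Leibniz' rule: the term with the differential of the angle is given by [excess_variation], and
    the one with the differential of [rho] is carried to the chart [c'] by [angle_jacob_chart], so
    that pieces living in different charts can be added. *)
Lemma piece_value c' x : atlas c' -> cdom c' x -> K x ->
  piece x = rho x * (- (excess g mu s' x - excess g mu s x) / 2)
   + angle g s s' c' x * jacob (fun p => rho (cinv c' p)) (fun p => mu (cinv c' p)) (c' x)
     / Num.sqrt (\det (g c' x)).
Proof.
move=> ac' c'x Kx; have [cx|ncx] := pselect (cdom c x); last first.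
  have nb : ~ boxM c a r x by move/(boxMP hb) => [].
  have nr : \forall p \near c' x, rho (cinv c' p) = 0.
    by apply: filterS (near_cinv c'x (near_not_boxM hb nb)) => p; exact: rho0.
  rewrite (jacob_near0 _ nr) rho0// mul0r mulr0 mul0r addr0.
  by rewrite /piece; case: asboolP.
rewrite pieceE// (excess_variation hg hmu hs hs' ac cx (@no x)).
have cr := crho ac cx Kx; have ct := angle_C1near hg hs hs' ac cx (@no x).
have cm := smooth_function_C1M hmu ac cx.
rewrite -(angle_jacob_chart hg hs hs' ac ac' cx c'x
  (C1near_diff (crho ac' c'x Kx)) (C1near_diff (smooth_function_C1M hmu ac' c'x))).
have P i : partial i H (c x) = partial i (fun p => rho (cinv c p)) (c x) * angle g s s' c x
   + rho x * partial i (fun p => angle g s s' c (cinv c p)) (c x).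
  apply: etrans (near_eq_derive _ (near_cutE h (cimg_map cx))) _.
  apply: etrans (derive_val (derM (derivable_diff _ (C1near_diff cr))
    (derivable_diff _ (C1near_diff ct)))) _.
  by rewrite cmapK.
rewrite /jacob !P /m.
move: (partial _ _ _) (partial _ _ _) (partial _ _ _) (partial _ _ _) (partial _ _ _) (partial _ _ _) => x1 x2 x3 x4 x5 x6.
by move: (_^-1) (rho x) (angle _ _ _ _ _) => q b t; field.
Qed.

End piece.

Lemma excess_integral : (\int[vol]_(x in (K : set (borel M)))
   (excess g mu s' x - excess g mu s x)%:E = 0)%E.
Proof.
have [n [c [a [r [hb HB]]]]] := bump_cover cK.
pose B x := \sum_(i < n) bump (c i) (a i) (r i) x.
(* [B] may vanish off [K], so the quotients are claimed to be C^1 at points of [K] only. *)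
pose rho i x := bump (c i) (a i) (r i) x / B x.
have cB : C1M B by move=> c' y ac' cy; apply: C1near_sum => i; exact: bump_C1M.
have crho i c' x : atlas c' -> cdom c' x -> K x -> C1near (fun p => rho i (cinv c' p)) (c' x).
  move=> ac' c'x Kx; apply: C1nearM; first exact: bump_C1M.
  by apply: C1nearV; [exact: cB|rewrite cmapK// gt_eqF// HB].
have rho0 i x : ~ boxM (c i) (a i) (r i) x -> rho i x = 0.
  by move=> nb; rewrite /rho bump_notin ?mul0r.
pose F i := piece (c i) (rho i).
have cF i : continuous (F i) := piece_continuous (hb i) (@rho0 i) (@crho i).
have E x : K x -> excess g mu s' x - excess g mu s x = \sum_(i < n) (- 2 * F i x).
  move=> Kx; have [c' ac' c'x] := atlas_cover x.
  have B0 : B x != 0 by rewrite gt_eqF// HB.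
  have r1 : \sum_(i < n) rho i x = 1 by rewrite -mulr_suml divff.
  (* Since [B] stays positive near [x], the [rho i] add up to the constant 1 there, and its
     differential is 0. *)
  have j0 : \sum_(i < n) jacob (fun p => rho i (cinv c' p)) (fun p => mu (cinv c' p)) (c' x) = 0.
    rewrite jacob_sum; last by move=> i; exact: C1near_diff (crho i c' x ac' c'x Kx).
    apply: (@jacob_near0 _ _ _ 1).
    have nB : \forall p \near c' x, 0 < B (cinv c' p).
      apply: (near_cinv c'x (P := fun y => 0 < B y)).
      have cBx : {for x, continuous B} by exact: C1M_continuous.
      exact: (cvgr_gt _ cBx _ (HB x Kx)).
    by apply: filterS nB => p Bp; rewrite -mulr_suml divff// gt_eqF.
  have FE i := piece_value (hb i) (@rho0 i) (@crho i) ac' c'x Kx.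
  under eq_bigr => i _ do rewrite (FE i : F i x = _).
  rewrite -mulr_sumr big_split/= -mulr_suml r1 mul1r.
  rewrite -mulr_suml -mulr_sumr j0 mulr0 mul0r addr0.
  by field.
transitivity (\int[vol]_(x in (K : set (borel M))) \sum_(i < n) (- 2 * F i x)%:E)%E.
  by apply: eq_integral => x; rewrite inE => Kx; rewrite E// sumEFin.
have iF i : vol.-integrable (K : set (borel M)) (fun x => (- 2 * F i x)%:E).
  have cc : continuous (fun x => - 2 * F i x).
    by move=> x; exact: contM (@contC R _ x (- 2)) (cF i x).
  have ic := continuous_integrable hg hvol cK cc.
  exact: ic.
have mK := compact_measurable cK.
rewrite integral_sum// big1// => i _; under eq_integral do rewrite EFinM.
have iFi := continuous_integrable hg hvol cK (cF i).
rewrite (integralZl mK iFi).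
by rewrite (piece_integral (hb i) (@rho0 i) (@crho i)) mule0.
Qed.

End stokes_surface.

(** * Comparison of the two energies *)

Section conformal_energy.
Context {R : realType} (M : surface R).
Variables (g : metric_field M) (mu : M -> R).
Hypotheses (hg : riemannian g) (hmu : smooth_function mu).

Let w (x : borel M) : R := expR (2 * mu x).

Let cw : continuous (w : M -> R).
Proof.
move=> x; have [c ac cx] := atlas_cover x.
have cm := smooth_function_C1M hmu ac cx.
have ce := C1near_exp (C1nearM (C1near_cst (2 : R) (c x)) cm).
apply: (continuous_chart cx (C1near_cont ce)).
by apply: filterS (near_cdom cx) => y cy; rewrite /w cmapK.
Qed.

Let mw : measurable_fun setT w. Proof. exact: continuous_borel cw. Qed.
Let w0 x : 0 <= w x. Proof. exact: expR_ge0. Qed.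

Section volume.
Variable (vol : {measure set (borel M) -> \bar R}).
Hypothesis hvol : riemannian_volume g vol.

Definition conformal_volume : {measure set (borel M) -> \bar R} := density vol mw w0.

Lemma conformal_volumeP : riemannian_volume (conformal mu g) conformal_volume.
Proof.
move=> c A ac mA Ac.
rewrite (_ : conformal_volume A = \int[vol]_(x in A) (w x)%:E)%E//.
have mw' : measurable_fun setT (fun x : borel M => (w x)%:E) by exact/measurable_EFinP.
rewrite (chart_integral hg hvol ac mA Ac mw'); apply: eq_integral => z _.
rewrite -EFinM /conformal detZ sqrtrM ?sqr_ge0// sqrtr_sqr.
by rewrite ger0_norm// expR_ge0.
Qed.

(** The added term involves only the reference field [s]: along a variation it is a constant. *)
Lemma energy_conformal (K : set M) (s s' : subspace_field M) : compact K ->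
  line_field s -> line_field s' -> (forall x, nonorthogonal g s s' x) ->
  (forall c x, atlas c -> cdom c x -> ~ K x -> s' c x = s c x) ->
  vertical_energy (conformal mu g) conformal_volume K s' =
  vertical_energy g vol K s' +
  2^-1 * \int[vol]_(x in (K : set (borel M))) excess g mu s x.
Proof.
move=> cK hs hs' no sK; have hg' := conformal_riemannian hg hmu.
have mK := compact_measurable cK.
have cv (h : metric_field M) t : riemannian h -> line_field t -> continuous (vertical_norm2 h t).
  by move=> hh ht x; exact: vertical_norm2_continuous.
have ce t : line_field t -> continuous (excess g mu t).
  move=> ht x; have h1 := contM (@cw x) (cv _ _ hg' ht x).
  by have := contD h1 (contN (cv _ _ hg ht x)).
have cd : continuous (fun x => excess g mu s' x - excess g mu s x).
  by move=> x; have := contD (ce _ hs' x) (contN (ce _ hs x)).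
have iv := continuous_integrable hg hvol cK (cv _ _ hg hs').
have ie := continuous_integrable hg hvol cK (ce _ hs).
have id := continuous_integrable hg hvol cK cd.
rewrite /vertical_energy -mulrDr; congr (_ * _); rewrite /Rintegral.
have mv : measurable_fun setT (fun x : borel M => (vertical_norm2 (conformal mu g) s' x)%:E).
  by apply/measurable_EFinP; exact: continuous_borel (cv _ _ hg' hs').
rewrite (integral_density vol mw w0 mK mv).
have fv := integrable_fin_num mK iv; have fe := integrable_fin_num mK ie.
rewrite -fineD//; congr fine.
rewrite -(integralD mK iv ie).
(* Adding the vanishing integral replaces the excess of [s] by that of [s'], after which the
   integrands agree pointwise. *)
rewrite -[RHS]adde0 -(excess_integral hg hmu cK hs hs' no sK hvol).
rewrite -integralD//; last exact: integrableD.
apply: eq_integral => x _; rewrite -!EFinD -EFinM /excess /w; congr EFin.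
by move: (expR _) (vertical_norm2 _ _ _) (vertical_norm2 _ _ _) (vertical_norm2 _ _ _) (vertical_norm2 _ _ _) => *; ring.
Qed.

End volume.

(** A given volume for [g] is turned into one for the conformal metric, to which the hypothesis
    applies. The two energies differ by the constant [k] for [t] near 0, which is all that a
    derivative at 0 sees. *)
Lemma harmonic_of_conformal (s : subspace_field M) : line_field s ->
  harmonic_distribution (conformal mu g) s -> harmonic_distribution g s.
Proof.
move=> hs H vol hvol K cK eps st eps0 hst.
pose E' t := vertical_energy (conformal mu g) (conformal_volume vol) K (st t).
have dE' : is_derive (0 : R) (1 : R) E' 0.
  exact: H (conformal_volumeP hvol) K cK eps st eps0 hst.
pose k := 2^-1 * \int[vol]_(x in (K : set (borel M))) excess g mu s x.
have D := derB dE' (derC k (0 : R) (1 : R)).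
rewrite subr0 in D; apply: near_eq_is_derive D.
have neps : \forall t \near (0 : R), `|t| < eps by exact: nbhs0_lt.
apply: filterS2 neps (variation_nonorthogonal hg cK eps0 hs hst) => t te no.
have ht := variation_line_field hst te.
rewrite /E' (energy_conformal hvol cK hs ht no) ?addrK//.
by case: hst => _ _ _ stK c x ac cx nKx; exact: stK.
Qed.

End conformal_energy.

Lemma conformalN (R : realType) (M : surface R) (mu : M -> R) (g : metric_field M) :
  conformal (fun x => - mu x) (conformal mu g) = g.
Proof.
apply/funext => c; apply/funext => x; rewrite /conformal scalerA -expRD.
by rewrite mulrN addNr expR0 scale1r.
Qed.

Lemma smooth_functionN (R : realType) (M : surface R) (mu : M -> R) :
  smooth_function mu -> smooth_function (fun x => - mu x).
Proof.
move=> hmu c ac k; apply: (Ck_eq (f := fun p => -1 * mu (cinv c p))) => //.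
- exact: cimg_open.
- by move=> p _; rewrite mulN1r.
- by apply: (CkM _ (Ck_cst _ _ _) (hmu c ac k)); exact: cimg_open.
Qed.

Theorem corollary4p2 (R : realType) (M : surface R) (s : subspace_field M)
    (hs : line_field s)
    (g : metric_field M) (hg : riemannian g)
    (mu : M -> R) (hmu : smooth_function mu) :
  harmonic_distribution g s <-> harmonic_distribution (conformal mu g) s.
Proof.
split; last exact: harmonic_of_conformal.
(* [g] is itself conformal to [conformal mu g], by the function [- mu]. *)
rewrite -{1}(conformalN mu g); apply: harmonic_of_conformal => //.
- exact: conformal_riemannian.
- exact: smooth_functionN.
Qed.
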